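(* There is a linear-time (i.e. $O(n+m)$ for a graph with $n$ vertices and $m$ edges given by adjacency lists) algorithm that computes a maximum cardinality uniquely restricted matching in a given proper interval graph.
   Context: All graphs are finite, simple and undirected. A matching $M$ in a graph $G$ is a set of edges no two of which share a vertex; the vertices matched by $M$ are the endpoints of edges of $M$. A matching $M$ is uniquely restricted if there is no other matching in $G$ that matches exactly the same set of vertices as $M$. A proper interval graph is a graph $G$ having a family $\{I_u\}_{u\in V(G)}$ of closed real intervals, no one of which strictly contains another, such that for distinct $u,v$, $uv\in E(G)$ iff $I_u\cap I_v\neq\emptyset$ (equivalently, a unit interval graph). *)

(* Defs.v *)
From Stdlib Require Import Reals.
From mathcomp Require Import all_boot.

Set Implicit Arguments.
Unset Strict Implicit.
Unset Printing Implicit Defensive.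

Section Graphs.
Variable T : finType.

Definition simple_graph (e : rel T) : Prop := symmetric e /\ irreflexive e.

Definition is_edge (e : rel T) (E : {set T}) : Prop :=
  exists x y, e x y /\ E = [set x; y].

Definition matching (e : rel T) (M : {set {set T}}) : Prop :=
  (forall E, E \in M -> is_edge e E) /\
  (forall E F, E \in M -> F \in M -> E != F -> [disjoint E & F]).

Definition matched (M : {set {set T}}) : {set T} := cover M.

Definition uniquely_restricted (e : rel T) (M : {set {set T}}) : Prop :=
  matching e M /\
  forall M', matching e M' -> matched M' = matched M -> M' = M.

Definition max_ur_matching (e : rel T) (M : {set {set T}}) : Prop :=
  uniquely_restricted e M /\
  forall M', uniquely_restricted e M' -> #|M'| <= #|M|.

Definition proper_interval_graph (e : rel T) : Prop :=
  exists lo hi : T -> R,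
    (forall u, Rle (lo u) (hi u)) /\
    (forall u v, ~ (Rle (lo v) (lo u) /\ Rle (hi u) (hi v) /\
                    (lo u <> lo v \/ hi u <> hi v))) /\
    (forall u v, u != v ->
       (e u v <-> exists x : R,
          (Rle (lo u) x /\ Rle x (hi u)) /\ (Rle (lo v) x /\ Rle x (hi v)))).
End Graphs.

(* Cost model: unit-cost RAM (Cook-Reckhow style) with natural-number  *)
(* registers and memory cells, addition, truncated subtraction,        *)
(* indirect load/store and conditional jumps.  One step = one          *)
(* instruction.                                                        *)
Inductive instr : Type :=
| IConst (d k : nat)
| IAdd (d a b : nat)
| ISub (d a b : nat)
| ILoad (d a : nat)
| IStore (a s : nat)
| IJz (r l : nat)
| IJmp (l : nat)
| IHalt.

Definition program := seq instr.

Record state := State { pc : nat; reg : nat -> nat; mem : nat -> nat }.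

Definition upd (f : nat -> nat) (a v : nat) : nat -> nat :=
  fun x => if x == a then v else f x.

(* One step; None when the machine has halted (IHalt or pc out of range). *)
Definition step (P : program) (s : state) : option state :=
  let: State p r m := s in
  match nth IHalt P p with
  | IConst d k => Some (State p.+1 (upd r d k) m)
  | IAdd d a b => Some (State p.+1 (upd r d (r a + r b)) m)
  | ISub d a b => Some (State p.+1 (upd r d (r a - r b)) m)
  | ILoad d a => Some (State p.+1 (upd r d (m (r a))) m)
  | IStore a s' => Some (State p.+1 r (upd m (r a) (r s')))
  | IJz c l => Some (State (if r c == 0 then l else p.+1) r m)
  | IJmp l => Some (State l r m)
  | IHalt => None
  end.

Fixpoint halts_in (P : program) (s : state) (t : nat) (s' : state) : Prop :=
  match t with
  | 0 => step P s = None /\ s' = s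
  | t'.+1 => exists s1, step P s = Some s1 /\ halts_in P s1 t' s'
  end.

Definition encode_adj (n : nat) (adj : 'I_n -> seq 'I_n) : seq nat :=
  n :: flatten [seq size (adj i) :: [seq nat_of_ord j | j <- adj i] | i <- enum 'I_n].

Definition init_state (input : seq nat) : state :=
  State 0 (fun _ => 0) (fun a => nth 0 input a).

Definition output_pairs (s : state) : seq (nat * nat) :=
  [seq (mem s (1 + 2 * j), mem s (2 + 2 * j)) | j <- iota 0 (mem s 0)].

Definition outputs_matching (n : nat) (s : state) (M : {set {set 'I_n}}) : Prop :=
  exists ps : seq ('I_n * 'I_n),
    (output_pairs s = [seq (nat_of_ord p.1, nat_of_ord p.2) | p <- ps]) /\
    (uniq [seq [set p.1; p.2] | p <- ps]) /\
    (M = [set [set p.1; p.2] | p in ps]).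

(* Size of the adjacency-list input: n + (sum of degrees) = n + 2m. *)
Definition adj_size (n : nat) (adj : 'I_n -> seq 'I_n) : nat :=
  n + \sum_(i < n) size (adj i).

(* Main.v *)
(* Idea.  Number the vertices of a proper interval graph so that u < v < w and uw an
   edge imply that uv and vw are edges, and let r(i) be the first position after i not
   adjacent to i.  A matching that is uniquely restricted contains no alternating
   4-cycle, which forces its edges (a, b), a < b, to be pairwise separated: b < a', and
   a is not adjacent to a' or b is not adjacent to b'.  Conversely a chain of such edges
   is uniquely restricted: the leftmost edge (a, b) that another matching of the same
   vertices misses would have its ends rematched to the right, which makes a, a' and b, b'
   adjacent for the leftmost later edge (a', b') involved.  Hence a maximum chain is
   wanted.  Of all continuations of (a, b) that use "a not adjacent to a'" (resp.
   "b not adjacent to b'") one is componentwise least, so two tables W and H, filled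
   from right to left, give the optimum in time O(n).

   For the ordering, a breadth-first search of each component followed by a choice of a
   vertex of minimum degree in the last level finds an end of the component.  In a second
   search from the ends, the levels are cliques on which the neighbourhoods in the
   previous and in the next level are nested in opposite ways.  If r(x) counts the
   vertices of level at most that of x together with the neighbours of x in the next
   level, then 2 r(x) - deg x is (up to a constant) the sum of the positions of the
   first and last neighbours of x, and sorting by this key orders the graph.

   The algorithm is written in a language of arrays and bounded loops with a cost
   semantics, which is compiled to the RAM with exactly that cost. *)
Require Import Defs.
From Stdlib Require Import Reals.
From mathcomp Require Import all_boot perm zify.
From Stdlib Require Import FunctionalExtensionality.

Set Implicit Arguments.
Unset Strict Implicit.
Unset Printing Implicit Defensive.

(** * Compiling bounded loops to the RAM *)

(** The input gives no interval model, and a comparison sort is too slow, so the order is recovered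
    from adjacency and sorted by integer keys. The key works because it is a sum of two quantities
    that grow together: with [far x] the vertices left of the first neighbour of x, r(x) - deg x =
    |far x| + 1, and along the wanted order both [upto] and [far] only grow. Vertices of equal key
    thus have equal sets, ties may be broken at will, and keys are at most 2n, so counting sort
    applies. Components need no separate treatment. A new root gets a level above all earlier ones,
    so each level lies in one component and a single level function serves the whole graph. The
    vertex that the first search picks need not be an end of the umbrella order at hand. It is a
    twin of an end, and swapping the two gives another umbrella order in which it is the end. So
    every root comes with an order of its own, and the order computed is never compared with any of
    them: adjacency is rederived from the structure of the levels. *)

Fixpoint runs (P : program) (k : nat) (s s' : state) : Prop :=
  if k is k'.+1 then exists s1, step P s = Some s1 /\ runs P k' s1 s' else s' = s.

Lemma runs_add P k1 k2 s1 s2 s3 :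
  runs P k1 s1 s2 -> runs P k2 s2 s3 -> runs P (k1 + k2) s1 s3.
Proof.
elim: k1 s1 => [|k IH] s1 /= => [->//|[s [Hs H1]] H2].
by exists s; split=> //; apply: IH H1 H2.
Qed.

Lemma runs1 P s s' : step P s = Some s' -> runs P 1 s s'.
Proof. by move=> H; exists s'. Qed.

Lemma halts_runs P k s s' : runs P k s s' -> step P s' = None -> halts_in P s k s'.
Proof.
elim: k s => [|k IH] s /= => [-> //|[s1 [H1 H2]] H3].
by exists s1; split=> //; apply: IH.
Qed.

Fixpoint code_at (P : program) (l : nat) (code : seq instr) : Prop :=
  if code is i :: code' then nth IHalt P l = i /\ code_at P l.+1 code' else True.

Lemma code_at_cat P l a b :
  code_at P l (a ++ b) -> code_at P l a /\ code_at P (l + size a) b.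
Proof.
elim: a l => [|i a IH] l /=; first by rewrite addn0.
by move=> [-> /IH []]; rewrite addSnnS.
Qed.

Lemma code_at_self a b : code_at (a ++ b) (size a) b.
Proof.
elim: b a => //= i b IH a; split; first by rewrite nth_cat ltnn subnn.
by have := IH (rcons a i); rewrite cat_rcons size_rcons.
Qed.

Lemma code_at_eq P l l' c : code_at P l c -> l = l' -> code_at P l' c.
Proof. by move=> H <-. Qed.

Lemma runs_pc P k s l l' r m :
  runs P k s (State l r m) -> l = l' -> runs P k s (State l' r m).
Proof. by move=> H <-. Qed.

Inductive exp :=
| Var of nat | Cst of nat | Add of exp & exp | Sub of exp & exp | Dbl of exp | Ld of exp.

Inductive com :=
| Skip
| Asg of nat & exp
| Str of exp & exp
| Seq of com & com
| If of exp & com & com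
| For of nat & exp & com.

Record cfg := Cfg { cvar : nat -> nat; cmem : nat -> nat }.

Definition cset (s : cfg) x v := Cfg (upd (cvar s) x v) (cmem s).

Fixpoint eval (e : exp) (s : cfg) : nat :=
  match e with
  | Var x => cvar s x
  | Cst k => k
  | Add a b => eval a s + eval b s
  | Sub a b => eval a s - eval b s
  | Dbl a => eval a s + eval a s
  | Ld a => cmem s (eval a s)
  end.

(* Source variables live in the even registers, temporaries in the odd ones. *)
Definition rvar (x : nat) := x.*2.
Definition rtmp (d : nat) := d.*2.+1.

(** There is no move instruction, so a variable is read by adding it to a register just cleared.
    Temporaries act as a stack: the left operand stays in [rtmp d] while the right one is evaluated
    from [d.+1] on. *)
Fixpoint cexp (d : nat) (e : exp) : seq instr :=
  match e with
  | Var x => [:: IConst (rtmp d) 0; IAdd (rtmp d) (rtmp d) (rvar x)]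
  | Cst k => [:: IConst (rtmp d) k]
  | Add a b => cexp d a ++ cexp d.+1 b ++ [:: IAdd (rtmp d) (rtmp d) (rtmp d.+1)]
  | Sub a b => cexp d a ++ cexp d.+1 b ++ [:: ISub (rtmp d) (rtmp d) (rtmp d.+1)]
  | Dbl a => cexp d a ++ [:: IAdd (rtmp d) (rtmp d) (rtmp d)]
  | Ld a => cexp d a ++ [:: ILoad (rtmp d) (rtmp d)]
  end.

Fixpoint ecost (e : exp) : nat :=
  match e with
  | Var _ => 2
  | Cst _ => 1
  | Add a b | Sub a b => ecost a + ecost b + 1
  | Dbl a | Ld a => ecost a + 1
  end.

Lemma size_cexp d e : size (cexp d e) = ecost e.
Proof.
by elim: e d => //= [a IHa b IHb|a IHa b IHb|a IHa|a IHa] d;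
  rewrite !size_cat ?IHa ?IHb ?addnA.
Qed.

Fixpoint csize (c : com) : nat :=
  match c with
  | Skip => 0
  | Asg _ e => ecost e + 2
  | Str a e => ecost a + ecost e + 1
  | Seq a b => csize a + csize b
  | If e a b => ecost e + 1 + csize a + 1 + csize b
  | For _ e a => ecost e + 5 + csize a + 1
  end.

(** Jumps are absolute, hence the load address [l]. A loop variable is its own counter, tested and
    decremented at the head: the body sees k-1, ..., 0 and must not assign it, which is what [wf]
    checks. *)
Fixpoint ccom (l : nat) (c : com) : seq instr :=
  match c with
  | Skip => [::]
  | Asg x e => cexp 0 e ++ [:: IConst (rtmp 1) 0; IAdd (rvar x) (rtmp 0) (rtmp 1)]
  | Str a e => cexp 0 a ++ cexp 1 e ++ [:: IStore (rtmp 0) (rtmp 1)]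
  | Seq a b => ccom l a ++ ccom (l + csize a) b
  | If e a b =>
      let la := l + ecost e + 1 in
      let lb := la + csize a + 1 in
      cexp 0 e ++ [:: IJz (rtmp 0) lb] ++ ccom la a ++
      [:: IJmp (lb + csize b)] ++ ccom lb b
  | For x e a =>
      let lh := l + ecost e + 2 in
      cexp 0 e ++ [:: IConst (rtmp 1) 0; IAdd (rvar x) (rtmp 0) (rtmp 1);
        IJz (rvar x) (lh + 3 + csize a + 1);
        IConst (rtmp 0) 1; ISub (rvar x) (rvar x) (rtmp 0)] ++
      ccom (lh + 3) a ++ [:: IJmp lh]
  end.

Lemma size_ccom l c : size (ccom l c) = csize c.
Proof.
elim: c l => //= [x e|a e|a IHa b IHb|e a IHa b IHb|x e a IHa] l;
  by rewrite !size_cat /= ?size_cat ?size_cexp ?IHa /= ?IHb; lia.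
Qed.

Section Loop.
Variables (T : Type) (f : T -> T) (w : T -> nat) (set : T -> nat -> T).

Fixpoint loop (k : nat) (s : T) : T :=
  if k is k'.+1 then loop k' (f (set s k')) else s.

(** Per round: the test, the constant 1, the decrement and the jump back. The final 1 is the test
    that leaves the loop. *)
Fixpoint lcost (k : nat) (s : T) : nat :=
  if k is k'.+1 then 4 + w (set s k') + lcost k' (f (set s k')) else 1.

Lemma loop_ind (I : nat -> T -> Prop) k s :
  (forall j s, j < k -> I j.+1 s -> I j (f (set s j))) -> I k s -> I 0 (loop k s).
Proof.
elim: k s => //= k IH s Hs H; apply: IH; last exact: Hs.
by move=> j s' lt_jk; apply: Hs; apply: ltnW.
Qed.

(** The invariant carries the cost spent so far, so it can relate it to the state; this is what
    amortised bounds for nested loops need. *)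
Lemma lcost_ind (I : nat -> T -> nat -> Prop) k s t :
  (forall j s t, j < k -> I j.+1 s t -> I j (f (set s j)) (t + 4 + w (set s j))) ->
  I k s t -> exists t', I 0 (loop k s) t' /\ t + lcost k s = t' + 1.
Proof.
elim: k s t => /= [|k IH] s t Hs H; first by exists t.
have [|t' [H1 H2]] := IH (f (set s k)) _ _ (Hs _ _ _ (ltnSn _) H).
  by move=> j s' t' lt_jk; apply: Hs; apply: ltnW.
by exists t'; split=> //; rewrite -H2; lia.
Qed.

Lemma lcost_le c k s : (forall s, w s <= c) -> lcost k s <= (c + 4) * k + 1.
Proof.
move=> H; elim: k s => [|k IH] s /=; first lia.
by have := IH (f (set s k)); have := H (set s k); lia.
Qed.

End Loop.

Fixpoint den (c : com) (s : cfg) : cfg :=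
  match c with
  | Skip => s
  | Asg x e => cset s x (eval e s)
  | Str a e => Cfg (cvar s) (upd (cmem s) (eval a s) (eval e s))
  | Seq a b => den b (den a s)
  | If e a b => if eval e s != 0 then den a s else den b s
  | For x e a => loop (den a) (cset^~ x) (eval e s) (cset s x (eval e s))
  end.

Fixpoint time (c : com) (s : cfg) : nat :=
  match c with
  | Skip => 0
  | Asg _ e => ecost e + 2
  | Str a e => ecost a + ecost e + 1
  | Seq a b => time a s + time b (den a s)
  | If e a b => ecost e + 1 + (if eval e s != 0 then time a s + 1 else time b s)
  | For x e a =>
      ecost e + 2 + lcost (den a) (time a) (cset^~ x) (eval e s) (cset s x (eval e s))
  end.

Fixpoint writes (x : nat) (c : com) : bool :=
  match c with
  | Skip | Str _ _ => false
  | Asg y _ => y == x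
  | Seq a b | If _ a b => writes x a || writes x b
  | For y _ a => (y == x) || writes x a
  end.

Fixpoint wf (c : com) : bool :=
  match c with
  | Seq a b | If _ a b => wf a && wf b
  | For x _ a => ~~ writes x a && wf a
  | _ => true
  end.

Lemma writesN x c s : ~~ writes x c -> cvar (den c s) x = cvar s x.
Proof.
elim: c s => //= [y e|a IHa b IHb|e a IHa b IHb|y e a IHa] s.
- by rewrite /upd eq_sym => /negbTE ->.
- by rewrite negb_or => /andP[/IHa Ha /IHb ->].
- by rewrite negb_or => /andP[/IHa Ha /IHb Hb]; case: ifP.
- rewrite negb_or => /andP[yx /IHa Ha].
  apply: (loop_ind (I := fun _ s' => cvar s' x = cvar s x)) => [j s' _ <-|].
    by rewrite Ha /= /upd eq_sym (negbTE yx).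
  by rewrite /= /upd eq_sym (negbTE yx).
Qed.

Definition agree (r : nat -> nat) (s : cfg) := forall x, r (rvar x) = cvar s x.

Definition above (d j : nat) := exists2 d', d <= d' & j = rtmp d'.

Lemma rvar_above d x : ~ above d (rvar x).
Proof. by case=> d' _; rewrite /rvar /rtmp => H; lia. Qed.

Lemma updE f a v : upd f a v a = v. Proof. by rewrite /upd eqxx. Qed.

Lemma updN f a v b : b != a -> upd f a v b = f b.
Proof. by rewrite /upd => /negbTE ->. Qed.

Lemma upd_above f d v j : ~ above d j -> upd f (rtmp d) v j = f j.
Proof. by move=> H; apply: updN; apply/eqP=> E; apply: H; exists d. Qed.

Lemma agree_same r r' s d :
  (forall j, ~ above d j -> r' j = r j) -> agree r s -> agree r' s.
Proof. by move=> H1 H2 x; rewrite H1 ?H2 //; apply: rvar_above. Qed.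

Lemma aboveW d j : above d.+1 j -> above d j.
Proof. by case=> d' /ltnW H ->; exists d'. Qed.

Lemma rtmp_above d : ~ above d.+1 (rtmp d).
Proof. by case=> d' H; rewrite /rtmp; lia. Qed.

Lemma rtmp_inj d d' : (rtmp d == rtmp d') = (d == d').
Proof. by rewrite /rtmp; apply/eqP/eqP; lia. Qed.

Lemma cexp_ok P d e l r s :
  code_at P l (cexp d e) -> agree r s ->
  exists r', runs P (ecost e) (State l r (cmem s)) (State (l + ecost e) r' (cmem s))
    /\ r' (rtmp d) = eval e s /\ forall j, ~ above d j -> r' j = r j.
Proof.
(* Addition and subtraction share one argument, parametrised by the operation and its
   instruction. *)
have bin o (i : nat -> nat -> nat -> instr) a b d' l' r' :
   (forall p x y z q m, nth IHalt P p = i x y z ->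
      step P (State p q m) = Some (State p.+1 (upd q x (o (q y) (q z))) m)) ->
   (forall d l r, code_at P l (cexp d a) -> agree r s ->
      exists r', runs P (ecost a) (State l r (cmem s)) (State (l + ecost a) r' (cmem s))
       /\ r' (rtmp d) = eval a s /\ forall j, ~ above d j -> r' j = r j) ->
   (forall d l r, code_at P l (cexp d b) -> agree r s ->
      exists r', runs P (ecost b) (State l r (cmem s)) (State (l + ecost b) r' (cmem s))
       /\ r' (rtmp d) = eval b s /\ forall j, ~ above d j -> r' j = r j) ->
   code_at P l' (cexp d' a ++ cexp d'.+1 b ++ [:: i (rtmp d') (rtmp d') (rtmp d'.+1)]) ->
   agree r' s ->
   exists r'', runs P (ecost a + ecost b + 1) (State l' r' (cmem s))
       (State (l' + (ecost a + ecost b + 1)) r'' (cmem s))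
     /\ r'' (rtmp d') = o (eval a s) (eval b s) /\ forall j, ~ above d' j -> r'' j = r' j.
  move=> Ho IHa IHb /code_at_cat[Ca]; rewrite size_cexp => /code_at_cat[Cb].
  rewrite size_cexp => -[Ci _] Hr.
  have [r1 [R1 [E1 K1]]] := IHa _ _ _ Ca Hr.
  have [r2 [R2 [E2 K2]]] := IHb _ _ _ Cb (agree_same K1 Hr).
  exists (upd r2 (rtmp d') (o (eval a s) (eval b s))); split; last split.
  - apply: runs_add (runs_add R1 R2) _; apply: runs1.
    rewrite (Ho _ _ _ _ _ _ Ci) E2 K2; last exact: rtmp_above.
    by rewrite E1; congr (Some (State _ _ _)); lia.
  - by rewrite updE.
  - move=> j Hj; rewrite upd_above // K2 ?K1 //.
    by move/aboveW.
elim: e d l r => [x|k|a IHa b IHb|a IHa b IHb|a IHa|a IHa] d l r.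
- move=> [C1 [C2 _]] Hr /=.
  exists (upd (upd r (rtmp d) 0) (rtmp d) (cvar s x)); split; last split.
  + exists (State l.+1 (upd r (rtmp d) 0) (cmem s)); split; first by rewrite /step C1.
    rewrite addn2; eexists; split; last reflexivity.
    by rewrite /step C2 updE add0n upd_above ?Hr //; apply: rvar_above.
  + by rewrite updE.
  + by move=> j Hj; rewrite !upd_above.
- move=> [C1 _] Hr /=; exists (upd r (rtmp d) k); split; last split.
  + by rewrite addn1; eexists; split; last reflexivity; rewrite /step C1.
  + by rewrite updE.
  + by move=> j Hj; rewrite upd_above.
- by move=> C Hr; apply: (bin addn IAdd) C Hr => // p x y z q m H; rewrite /step H.
- by move=> C Hr; apply: (bin subn ISub) C Hr => // p x y z q m H; rewrite /step H.
- move=> /code_at_cat[Ca]; rewrite size_cexp => -[Ci _] Hr /=.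
  have [r1 [R1 [E1 K1]]] := IHa _ _ _ Ca Hr.
  exists (upd r1 (rtmp d) (eval a s + eval a s)); split; last split.
  + apply: runs_add R1 _; apply: runs1; rewrite /step Ci E1.
    by congr (Some (State _ _ _)); lia.
  + by rewrite updE.
  + by move=> j Hj; rewrite upd_above ?K1.
- move=> /code_at_cat[Ca]; rewrite size_cexp => -[Ci _] Hr /=.
  have [r1 [R1 [E1 K1]]] := IHa _ _ _ Ca Hr.
  exists (upd r1 (rtmp d) (cmem s (eval a s))); split; last split.
  + apply: runs_add R1 _; apply: runs1; rewrite /step Ci E1.
    by congr (Some (State _ _ _)); lia.
  + by rewrite updE.
  + by move=> j Hj; rewrite upd_above ?K1.
Qed.

Lemma ccom_ok P c l r s :
  wf c -> code_at P l (ccom l c) -> agree r s ->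
  exists r', runs P (time c s) (State l r (cmem s))
                  (State (l + csize c) r' (cmem (den c s))) /\ agree r' (den c s).
Proof.
elim: c l r s => [|x e|a e|a IHa b IHb|e a IHa b IHb|x e a IHa] l r s /=.
- by move=> _ _ Hr; exists r; rewrite addn0.
- move=> _ /code_at_cat[Ce]; rewrite size_cexp => -[C1 [C2 _]] Hr.
  have [r1 [R1 [E1 K1]]] := cexp_ok Ce Hr.
  exists (upd (upd r1 (rtmp 1) 0) (rvar x) (eval e s)); split.
    apply: runs_add R1 _; eexists; split; first by rewrite /step C1.
    eexists; split; first by rewrite /step C2.
    by rewrite updE addn0 updN ?E1 ?rtmp_inj //; congr (State _ _ _); lia.
  move=> y /=; rewrite /upd /rvar -!muln2 eqn_mul2r /=; case: eqP => // _.
  rewrite /rtmp; case: eqP => [|_]; first lia.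
  by rewrite K1 ?muln2; [exact: Hr | exact: rvar_above].
- move=> _ /code_at_cat[Ca]; rewrite size_cexp => /code_at_cat[Ce].
  rewrite size_cexp => -[Ci _] Hr.
  have [r1 [R1 [E1 K1]]] := cexp_ok Ca Hr.
  have [r2 [R2 [E2 K2]]] := cexp_ok Ce (agree_same K1 Hr).
  exists r2; split; last by apply: agree_same K2 _; apply: agree_same K1 Hr.
  apply: runs_add (runs_add R1 R2) _; apply: runs1.
  by rewrite /step Ci E2 K2 ?E1; [congr (Some (State _ _ _)); lia | exact: rtmp_above].
- move=> /andP[wa wb] /code_at_cat[Ca]; rewrite size_ccom => Cb Hr.
  have [r1 [R1 A1]] := IHa _ _ _ wa Ca Hr.
  have [r2 [R2 A2]] := IHb _ _ _ wb Cb A1.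
  by exists r2; split=> //; rewrite addnA; apply: runs_add R1 R2.
- move=> /andP[wa wb] /code_at_cat[Ce]; rewrite size_cexp => -[Cj /code_at_cat[Ca]].
  rewrite size_ccom => -[Ck Cb] Hr.
  have [r1 [R1 [E1 K1]]] := cexp_ok Ce Hr; have A1 := agree_same K1 Hr.
  case: ifPn => [ne|].
    rewrite -addn1 in Ca; have [r2 [R2 A2]] := IHa _ _ _ wa Ca A1.
    exists r2; split=> //; rewrite -addnA; apply: runs_add R1 _.
    apply: (@runs_add _ 1 _ _ (State (l + ecost e + 1) r1 (cmem s))).
      by apply: runs1; rewrite /step Cj E1 (negbTE ne) addn1.
    apply: runs_add R2 _; apply: runs1; rewrite /step addn1 Ck.
    by congr (Some (State _ _ _)); lia.
  rewrite negbK => eq0.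
  have Cb' : code_at P (l + ecost e + 1 + csize a + 1) (ccom (l + ecost e + 1 + csize a + 1) b).
    by apply: code_at_eq Cb _; lia.
  have [r2 [R2 A2]] := IHb _ _ _ wb Cb' A1.
  exists r2; split=> //; rewrite -addnA; apply: runs_add R1 _.
  apply: (@runs_add _ 1 _ _ (State (l + ecost e + 1 + csize a + 1) r1 (cmem s))).
    by apply: runs1; rewrite /step Cj E1 eq0.
  by apply: runs_pc R2 _; lia.
- move=> /andP[nw wa] /code_at_cat[Ce]; rewrite size_cexp => -[C1 [C2 [C3 [C4 [C5 C6]]]]] Hr.
  have [Ca Cj] := code_at_cat C6; rewrite size_ccom /= in Cj; case: Cj => Cj _.
  have [r1 [R1 [E1 K1]]] := cexp_ok Ce Hr; have A1 := agree_same K1 Hr.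
  set k := eval e s; set lh := l + ecost e + 2.
  have init : exists r2, runs P (ecost e + 2) (State l r (cmem s)) (State lh r2 (cmem s))
      /\ agree r2 (cset s x k).
    exists (upd (upd r1 (rtmp 1) 0) (rvar x) k); split.
      apply: runs_add R1 _; eexists; split; first by rewrite /step C1.
      eexists; split; first by rewrite /step C2.
      by rewrite updE addn0 updN ?E1 ?rtmp_inj //; congr (State _ _ _); rewrite /lh; lia.
    move=> y /=; rewrite /upd /rvar -!muln2 eqn_mul2r /=; case: eqP => // _.
    rewrite /rtmp; case: eqP => [|_]; first lia.
    by rewrite muln2; apply: A1.
  case: init => r2 [R2 A2].
  (* The loop is treated from its head, for any state whose counter holds j; the initial state alone
     would not support the induction. *)
  suff: forall j s' r', cvar s' x = j -> agree r' s' ->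
    exists r'', runs P (lcost (den a) (time a) (cset^~ x) j s') (State lh r' (cmem s'))
       (State (lh + 3 + csize a + 1) r'' (cmem (loop (den a) (cset^~ x) j s')))
      /\ agree r'' (loop (den a) (cset^~ x) j s').
    move=> /(_ k (cset s x k) r2); rewrite /= updE => /(_ erefl A2) [r3 [R3 A3]].
    exists r3; split=> //; apply: runs_add R2 _.
    by apply: runs_pc R3 _; rewrite /lh; lia.
  have e3 : l + ecost e + 2 = (l + ecost e).+2 by lia.
  elim=> [|j IH] s' r' Ex Ar.
    exists r'; split=> //; apply: runs1.
    by rewrite /step /lh e3 C3 Ar Ex e3.
  have Cb : code_at P (lh + 3) (ccom (lh + 3) a).
    by apply: code_at_eq Ca _; rewrite /lh; lia.
  have A3 : agree (upd (upd r' (rtmp 0) 1) (rvar x) j) (cset s' x j).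
    move=> y /=; rewrite /upd /rvar -!muln2 eqn_mul2r /=; case: eqP => // _.
    by rewrite /rtmp; case: eqP => [|_]; [lia | rewrite muln2; apply: Ar].
  have [r4 [R4 A4]] := IHa _ _ _ wa Cb A3.
  have [|r5 [R5 A5]] := IH (den a (cset s' x j)) r4 _ A4.
    by rewrite writesN //= updE.
  exists r5; split=> //.
  set w := time a (cset s' x j); set u := lcost _ _ _ j _ in R5.
  have Hk : 4 + w + u = 3 + (w + (1 + u)) by lia.
  rewrite -[lcost _ _ _ j.+1 s']/(4 + w + u) Hk.
  apply: (runs_add (k1 := 3) (s2 := State (lh + 3) (upd (upd r' (rtmp 0) 1) (rvar x) j) (cmem s'))).
    eexists; split; first by rewrite /step /lh e3 C3 Ar Ex.
    eexists; split; first by rewrite /step C4.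
    eexists; split; first by rewrite /step C5.
    rewrite updE updN ?Ar ?Ex; last by rewrite /rvar /rtmp; apply/eqP; lia.
    by rewrite subn1 /=; congr (State _ _ _); rewrite /lh; lia.
  apply: runs_add R4 _; apply: runs_add R5; apply: runs1; rewrite /step.
  by rewrite (_ : lh + 3 + csize a = (l + ecost e).+1.+4 + csize a) ?Cj // /lh; lia.
Qed.

(** * Arrays *)

Inductive aexp :=
| AVar of nat | ACst of nat | AAdd of aexp & aexp | ASub of aexp & aexp | AGet of nat & aexp.

Inductive acom :=
| ASkip
| AAsg of nat & aexp
| APut of nat & aexp & aexp
| ASeq of acom & acom
| AIf of aexp & acom & acom
| AFor of nat & aexp & acom.

Record ast := Ast { avar : nat -> nat; arr : nat -> nat -> nat }.

Definition aset (s : ast) x v := Ast (upd (avar s) x v) (arr s).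

Definition aupd (f : nat -> nat -> nat) k i v : nat -> nat -> nat :=
  fun k' i' => if (k' == k) && (i' == i) then v else f k' i'.

Fixpoint aeval (e : aexp) (s : ast) : nat :=
  match e with
  | AVar x => avar s x
  | ACst k => k
  | AAdd a b => aeval a s + aeval b s
  | ASub a b => aeval a s - aeval b s
  | AGet k a => arr s k (aeval a s)
  end.

(* Array [k] occupies the cells [B + 16 i + k], so that the (unbounded) arrays
   with [k < 16] never overlap; variable 0 of the target program holds [B]. *)
Definition acell k e :=
  Add (Add (Var 0) (Cst k)) (Dbl (Dbl (Dbl (Dbl e)))).

Fixpoint trexp (e : aexp) : exp :=
  match e with
  | AVar x => Var x.+1
  | ACst k => Cst k
  | AAdd a b => Add (trexp a) (trexp b)
  | ASub a b => Sub (trexp a) (trexp b)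
  | AGet k a => Ld (acell k (trexp a))
  end.

Fixpoint tr (c : acom) : com :=
  match c with
  | ASkip => Skip
  | AAsg x e => Asg x.+1 (trexp e)
  | APut k a e => Str (acell k (trexp a)) (trexp e)
  | ASeq a b => Seq (tr a) (tr b)
  | AIf e a b => If (trexp e) (tr a) (tr b)
  | AFor x e a => For x.+1 (trexp e) (tr a)
  end.

Definition cst (e : aexp) := ecost (trexp e).

Fixpoint aden (c : acom) (s : ast) : ast :=
  match c with
  | ASkip => s
  | AAsg x e => aset s x (aeval e s)
  | APut k a e => Ast (avar s) (aupd (arr s) k (aeval a s) (aeval e s))
  | ASeq a b => aden b (aden a s)
  | AIf e a b => if aeval e s != 0 then aden a s else aden b s
  | AFor x e a => loop (aden a) (aset^~ x) (aeval e s) (aset s x (aeval e s))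
  end.

(** The 10 of a store is nine instructions for the address [acell] and the store itself. *)
Fixpoint atime (c : acom) (s : ast) : nat :=
  match c with
  | ASkip => 0
  | AAsg _ e => cst e + 2
  | APut _ a e => cst a + cst e + 10
  | ASeq a b => atime a s + atime b (aden a s)
  | AIf e a b => cst e + 1 + (if aeval e s != 0 then atime a s + 1 else atime b s)
  | AFor x e a =>
      cst e + 2 + lcost (aden a) (atime a) (aset^~ x) (aeval e s) (aset s x (aeval e s))
  end.

Fixpoint aexp_wf (e : aexp) : bool :=
  match e with
  | AAdd a b | ASub a b => aexp_wf a && aexp_wf b
  | AGet k a => (k < 16) && aexp_wf a
  | _ => true
  end.

Fixpoint acom_wf (c : acom) : bool :=
  match c with
  | ASkip => true
  | AAsg _ e => aexp_wf e
  | APut k a e => [&& k < 16, aexp_wf a & aexp_wf e]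
  | ASeq a b => acom_wf a && acom_wf b
  | AIf e a b => [&& aexp_wf e, acom_wf a & acom_wf b]
  | AFor _ e a => aexp_wf e && acom_wf a
  end.

Definition asim (B : nat) (s : ast) (s' : cfg) : Prop :=
  [/\ cvar s' 0 = B, forall x, cvar s' x.+1 = avar s x
    & forall k i, k < 16 -> cmem s' (B + k + 16 * i) = arr s k i].

Lemma asim_set B s s' x v : asim B s s' -> asim B (aset s x v) (cset s' x.+1 v).
Proof. by case=> H1 H2 H3; split=> //= y; rewrite /upd eqSS H2. Qed.

Lemma eval_acell B s s' k e v :
  asim B s s' -> eval e s' = v -> eval (acell k e) s' = B + k + 16 * v.
Proof. by case=> H1 _ _ <- /=; rewrite H1; lia. Qed.

Lemma trexp_ok B s s' e : asim B s s' -> aexp_wf e -> eval (trexp e) s' = aeval e s.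
Proof.
move=> H; elim: e => [x|k|a IHa b IHb|a IHa b IHb|k a IHa].
- by move=> _; case: H => _ H _; apply: H.
- by [].
- by move=> /= /andP[/IHa -> /IHb ->].
- by move=> /= /andP[/IHa -> /IHb ->].
- move=> /andP[Hk /IHa Ha].
  by rewrite -[LHS]/(cmem s' (eval (acell k (trexp a)) s')) (eval_acell k H Ha); case: H => _ _ ->.
Qed.

Lemma loop_rel (T U : Type) (R : T -> U -> Prop) f w set f' w' set' k s s' :
  (forall s s' j, R s s' -> R (set s j) (set' s' j)) ->
  (forall s s', R s s' -> R (f s) (f' s') /\ w s = w' s') ->
  R s s' ->
  R (@loop T f set k s) (@loop U f' set' k s') /\
  lcost f w set k s = lcost f' w' set' k s'.
Proof.
move=> Hset Hf; elim: k s s' => //= k IH s s' H.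
by have [H1 ->] := Hf _ _ (Hset _ _ k H); have [? ->] := IH _ _ H1.
Qed.

Lemma tr_ok B c s s' : acom_wf c -> asim B s s' ->
  asim B (aden c s) (den (tr c) s') /\ atime c s = time (tr c) s'.
Proof.
elim: c s s' => [|x e|k a e|a IHa b IHb|e a IHa b IHb|x e a IHa] s s'.
- by [].
- by move=> He H; rewrite /= (trexp_ok H He); split=> //; apply: asim_set.
- move=> /and3P[Hk Ha He] H; split; last by rewrite /= /cst; lia.
  rewrite -[den _ _]/(Cfg (cvar s') (upd (cmem s') (eval (acell k (trexp a)) s') (eval (trexp e) s'))).
  rewrite (eval_acell k H (trexp_ok H Ha)) (trexp_ok H He).
  case: H => H1 H2 H3; split=> //= k' i Hk'; rewrite /upd /aupd -H3 //.
  (* Both array numbers are below 16, so equal addresses force equal array and equal index. *)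
  congr (if _ then _ else _); apply/eqP/andP => [E|[/eqP -> /eqP ->] //].
  by split; apply/eqP; lia.
- move=> /andP[wa wb] H /=; have [H1 ->] := IHa _ _ wa H.
  by have [H2 ->] := IHb _ _ wb H1.
- move=> /and3P[we wa wb] H /=; rewrite (trexp_ok H we).
  by case: ifP => _; [have [H1 ->] := IHa _ _ wa H | have [H1 ->] := IHb _ _ wb H].
- move=> /andP[we wa] H /=; rewrite (trexp_ok H we).
  have [H1 ->] := loop_rel (w := atime a) (w' := time (tr a)) (f := aden a) (f' := den (tr a))
    (aeval e s) (fun s s' j H => asim_set x j H) (fun s s' H => IHa s s' wa H)
    (asim_set x (aeval e s) H).
  by [].
Qed.

Fixpoint aflat (c : acom) : bool :=
  match c with
  | ASeq a b | AIf _ a b => aflat a && aflat b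
  | AFor _ _ _ => false
  | _ => true
  end.

(* Only meaningful on loop-free commands. *)
Fixpoint amax (c : acom) : nat :=
  match c with
  | ASkip => 0
  | AAsg _ e => cst e + 2
  | APut _ a e => cst a + cst e + 10
  | ASeq a b => amax a + amax b
  | AIf e a b => cst e + 2 + (amax a + amax b)
  | AFor _ e _ => 0
  end.

Lemma atime_le c s : aflat c -> atime c s <= amax c.
Proof.
elim: c s => //= [a IHa b IHb|e a IHa b IHb] s /andP[fa fb].
  by have := IHa s fa; have := IHb (aden a s) fb; lia.
by case: ifP => _; have := IHa s fa; have := IHb s fb; lia.
Qed.

Lemma atime_for x e c s : aflat c ->
  atime (AFor x e c) s <= (amax c + 4) * aeval e s + (cst e + 3).
Proof.
move=> fc /=; have H := lcost_le (aden c) (aset^~ x) (aeval e s) (aset s x (aeval e s))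
  (fun s => atime_le s fc).
by move: H; lia.
Qed.

(** * Ordering a proper interval graph *)

Section Ordering.
Variables (T : finType) (e : rel T).
Hypotheses (esym : symmetric e) (eirr : irreflexive e).

(** The combinatorial form of a proper interval model: every vertex under an edge is adjacent to
    both of its ends. *)
Definition umbrella (rk : T -> nat) : Prop :=
  injective rk /\
  forall u v w, rk u < rk v -> rk v < rk w -> e u w -> e u v && e v w.

Lemma umbrella_rev rk : umbrella rk ->
  exists2 rk', umbrella rk' & forall u v, (rk' u < rk' v) = (rk v < rk u).
Proof.
move=> [inj umb]; set M := \max_u rk u.
have le u : rk u <= M by apply: leq_bigmax.
exists (fun u => M - rk u); last by move=> u v; have := le u; have := le v; lia.
split=> [u v H|u v w Huv Hvw Euw].
  by apply: inj; have := le u; have := le v; lia.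
rewrite andbC esym [e u v]esym; apply: umb; last by rewrite esym.
  by have := le v; have := le w; lia.
by have := le v; have := le u; lia.
Qed.

(** What is needed from a breadth-first forest with roots [rt]. The field [lay_comp] says that
    distinct components occupy distinct levels. *)
Record layering (D : T -> nat) (rt : T -> Prop) : Prop := Layering {
  lay_edge : forall x y, e x y -> D y <= (D x).+1;
  lay_par : forall x, rt x \/ exists2 p, e p x & D x = (D p).+1;
  lay_root : forall x y, rt x -> rt y -> connect e x y -> x = y;
  lay_comp : forall x y, D x = D y -> connect e x y }.

Lemma esymc : connect_sym e. Proof. exact: sym_connect_sym. Qed.

Section Layers.
Variables (D : T -> nat) (rt : T -> Prop).
Hypothesis lay : layering D rt.

Lemma layer_ind (P : T -> Prop) :
  (forall x, rt x -> P x) ->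
  (forall x p, e p x -> D x = (D p).+1 -> P p -> P x) ->
  forall x, P x.
Proof.
move=> Hr Hp x; have [k] := ubnP (D x); elim: k x => // k IH x Hk.
have [|[p e1 e2]] := lay_par lay x; first exact: Hr.
by apply: (Hp _ _ e1 e2 (IH _ _)); rewrite -ltnS -e2.
Qed.

Lemma layer_root x : exists2 r, rt r & connect e r x.
Proof.
elim/layer_ind: x => [x Hx|x p e1 _ [r Hr c]]; first by exists x.
by exists r => //; apply: connect_trans c (connect1 e1).
Qed.

(** Going left from the root, levels do not decrease. Follow the parent p of x: either z lies
    between p and s, or z lies under the edge xp and is adjacent to p. *)
Lemma layer_left rk s x z : umbrella rk -> rt s -> connect e s x ->
  rk x <= rk z <= rk s -> D z <= D x.
Proof.
move=> [inj umb] Hs; elim/layer_ind: x => [x Hx|x p e1 e2 IH] c /andP[H1 H2].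
  have E := lay_root lay Hs Hx c.
  have : rk z = rk x by rewrite -E in H1 *; lia.
  by move=> /inj ->.
case: (ltngtP (rk p) (rk z)) => [lt|lt|/inj <-]; last by rewrite e2.
- rewrite e2 leqW // IH ?(ltnW lt) ?H2 //.
  by apply: connect_trans c (connect1 _); rewrite esym.
- case: (ltngtP (rk x) (rk z)) H1 => // [lt2 _|/inj -> //].
  have /andP[_ e3] := umb _ _ _ lt2 lt (etrans (esym _ _) e1).
  by rewrite e2; apply: lay_edge lay _ _ _; rewrite esym.
Qed.

(** Let v be the leftmost vertex of the component. It is in the last level too and adjacent to y,
    and everything adjacent to v is adjacent or equal to y. Since y has minimum degree there, v and
    y are twins, and exchanging them puts y at the end. *)
Lemma layer_end_left rk s y : umbrella rk -> rt s -> connect e s y ->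
  (forall z, connect e y z -> D z < D y \/ D z = D y /\ #|e y| <= #|e z|) ->
  rk y <= rk s ->
  exists2 rk', umbrella rk' & forall z, connect e y z -> rk' y <= rk' z.
Proof.
move=> U Hs cy last le_ys; have [inj umb] := U.
case: (arg_minnP (P := connect e y) rk (connect0 e y)) => v cv minv.
have [E|neq] := eqVneq v y; first by subst v; exists rk.
have csv : connect e s v := connect_trans cy cv.
have lt_vy : rk v < rk y.
  by rewrite ltn_neqAle minv ?connect0 // andbT; apply: contra neq => /eqP/inj ->.
(* By [layer_left] v is at least as deep as y, which is in the last level. *)
have Dv : D v = D y.
  have := layer_left (z := y) U Hs csv; rewrite (ltnW lt_vy) le_ys => /(_ isT).
  by case: (last v cv) => [|[]]; lia.
(* The parent of v has a smaller level, so it cannot lie left of y; hence y is that parent or lies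
   under the edge from v to it. *)
have evy : e v y.
  have [Hv|[p e1 e2]] := lay_par lay v.
    by have := lay_root lay Hs Hv csv => E; rewrite -E ltnNge le_ys in lt_vy.
  case: (ltngtP (rk p) (rk y)) => [lt|lt|/inj E].
  + have cp : connect e s p by apply: connect_trans csv (connect1 _); rewrite esym.
    have := layer_left (x := p) (z := y) U Hs cp; rewrite (ltnW lt) le_ys => /(_ isT).
    lia.
  + by have /andP[] := umb _ _ _ lt_vy lt (etrans (esym _ _) e1).
  + by rewrite -E esym.
have sub z : e v z -> z != y -> e y z.
  move=> evz zy; have cz : connect e y z := connect_trans cv (connect1 evz).
  have vz : v != z by apply: contraTneq evz => ->; rewrite eirr.
  have lt_vz : rk v < rk z.
    by rewrite ltn_neqAle minv // andbT; apply: contra vz => /eqP/inj ->.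
  case: (ltngtP (rk z) (rk y)) => [lt|lt|/inj E]; last by rewrite E eqxx in zy.
  + by rewrite esym; have /andP[] := umb _ _ _ lt_vz lt evy.
  + by have /andP[] := umb _ _ _ lt_vy lt evz.
have twin z : z != y -> z != v -> e y z = e v z.
  move=> zy zv; apply/idP/idP => [eyz|]; last by move/sub; apply.
  have [lt|[_ le]] := last v cv; first by rewrite Dv ltnn in lt.
  (* Closed neighbourhoods of v and y: the first is contained in the second and, by minimality of
     the degree of y, not smaller. *)
  set A := [set z | (z == v) || e v z]; set B := [set z | (z == y) || e y z].
  have sAB : A \subset B.
    apply/subsetP=> u; rewrite !inE => /orP[/eqP ->|evu]; first by rewrite [e y v]esym evy orbT.
    by case: eqVneq => //= uy; apply: sub.
  have cA w : #|[set z | (z == w) || e w z]| = #|e w|.+1.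
    rewrite (_ : [set _ | _] = w |: [set z | e w z]).
      by rewrite cardsU1 inE eirr cardsE add1n.
    by apply/setP => u; rewrite !inE.
  have E : A == B by rewrite eqEcard sAB !cA ltnS.
  have zB : z \in B by rewrite inE eyz orbT.
  by rewrite -(eqP E) inE (negbTE zv) in zB.
exists (rk \o tperm v y).
  split=> [|a b c]; first by apply: inj_comp => //; apply: perm_inj.
  have swap a' b' : e (tperm v y a') (tperm v y b') = e a' b'.
    case: (tpermP v y a') => [->|->|/eqP a1 /eqP a2];
    case: (tpermP v y b') => [->|->|/eqP b1 /eqP b2]; rewrite ?eirr //.
    * by rewrite twin.
    * by rewrite -twin.
    * by rewrite ![e a' _]esym twin.
    * by rewrite ![e a' _]esym -twin.
  by move=> H1 H2 H3; rewrite -![e _ b]swap -[e b c]swap; apply: umb => //; rewrite swap.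
move=> z cz /=; rewrite tpermR; apply: minv.
case: (tpermP v y z) => // -> ; exact: cv.
Qed.

Lemma layer_end rk y : umbrella rk ->
  (forall z, connect e y z -> D z < D y \/ D z = D y /\ #|e y| <= #|e z|) ->
  exists2 rk', umbrella rk' & forall z, connect e y z -> rk' y <= rk' z.
Proof.
move=> U last; have [s Hs cs] := layer_root y.
case: (leqP (rk y) (rk s)) => [le|lt]; first exact: (layer_end_left U Hs cs).
have [rk1 U1 E1] := umbrella_rev U.
by apply: (layer_end_left U1 Hs cs) => //; rewrite leqNgt E1 -leqNgt ltnW.
Qed.

Hypothesis ends : forall r, rt r ->
  exists2 rk, umbrella rk & forall z, connect e r z -> rk r <= rk z.

(** Once the root is an end, levels are consecutive intervals of the order: if x lies left of y but
    right of the parent of y, it lies under that edge. *)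
Lemma layer_mono rk r x y : umbrella rk -> rt r ->
  (forall z, connect e r z -> rk r <= rk z) -> connect e r x -> connect e r y ->
  rk x < rk y -> D x <= D y.
Proof.
move=> [inj umb] Hr min cx; elim/layer_ind: y => [y Hy|y p e1 e2 IH] c lt.
  by rewrite -(lay_root lay Hr Hy c) in lt; have := min _ cx; lia.
have cp : connect e r p by apply: connect_trans c (connect1 _); rewrite esym.
case: (ltngtP (rk x) (rk p)) => [lt2|lt2|/inj ->]; last by lia.
  by have := IH cp lt2; lia.
have /andP[e3 _] := umb _ _ _ lt2 lt e1.
by rewrite e2; apply: lay_edge lay _ _ _.
Qed.

(* [before x y]: x can be placed left of y in a proper interval order, as far as
   the two adjacent levels are concerned. *)
Definition before x y : Prop :=
  (forall z, D z = (D x).+1 -> e x z -> e y z) /\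
  (forall z, D x = (D z).+1 -> e y z -> e x z).

(** Say x is left of y in an order starting at the root. The parent of y is in an earlier level, so
    left of x, and x lies under its edge to y. For the nesting, apply the umbrella property to x, y
    and a vertex of an adjacent level, which lies wholly on one side. *)
Lemma layer_struct x y : D x = D y -> x != y -> e x y /\ (before x y \/ before y x).
Proof.
wlog: x y / exists2 rk, umbrella rk &
    rk x < rk y /\ exists2 r, rt r /\ (forall z, connect e r z -> rk r <= rk z) & connect e r x.
  move=> W Dxy neq.
  have [r Hr cr] := layer_root x; have [rk U min] := ends Hr; have [inj _] := U.
  case: (ltngtP (rk x) (rk y)) => [lt|lt|/inj E]; last by rewrite E eqxx in neq.
    by apply: W => //; exists rk => //; split=> //; exists r.
  have [] : e y x /\ (before y x \/ before x y); last by rewrite esym; tauto.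
  apply: W; rewrite 1?eq_sym //; exists rk => //; split=> //; exists r => //.
  exact: connect_trans cr (lay_comp lay Dxy).
move=> [rk U [lt [r [Hr min] cx]]] Dxy neq; have [inj umb] := U.
have cy := connect_trans cx (lay_comp lay Dxy).
have mono a b : connect e r a -> connect e r b -> rk a < rk b -> D a <= D b.
  by move=> ca cb; apply: (layer_mono U Hr).
have sep a b : connect e r a -> connect e r b -> D a < D b -> rk a < rk b.
  move=> ca cb lt2; case: (ltngtP (rk a) (rk b)) => // [lt3|/inj E]; last by rewrite E ltnn in lt2.
  by have := mono _ _ cb ca lt3; lia.
have exy : e x y.
  have [Hy|[p e1 e2]] := lay_par lay y.
    by rewrite -(lay_root lay Hr Hy cy) in lt; have := min _ cx; lia.
  have cp : connect e r p by apply: connect_trans cy (connect1 _); rewrite esym.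
  have lt2 : rk p < rk x by apply: sep => //; lia.
  by have /andP[] := umb _ _ _ lt2 lt e1.
split=> //; left; split=> z Hz ez.
  have cz := connect_trans cx (connect1 ez).
  have lt2 : rk y < rk z by apply: sep => //; lia.
  by have /andP[] := umb _ _ _ lt lt2 ez.
have cz := connect_trans cy (connect1 ez).
have lt2 : rk z < rk x by apply: sep => //; lia.
by rewrite esym; have /andP[] := umb _ _ _ lt2 lt (etrans (esym _ _) ez).
Qed.

(** In the final order this is the initial segment ending at the last neighbour of x, or at x if
    none is later; [far x] will be the segment before its first neighbour, or before x. *)
Definition upto x := [set z | (D z <= D x) || e x z].
Definition reach x := #|upto x|.
Definition key x := reach x + (reach x - #|e x|).

Definition far x := [set z | (D z < D x) && ~~ e x z].

(** Since levels are cliques, [upto x] is the disjoint union of [far x], x and its neighbours. *)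
Lemma keyE x : key x = reach x + #|far x|.+1.
Proof.
rewrite /key; congr (_ + _).
have -> : #|far x| = #|upto x| - #|x |: [set z | e x z]|.
  have sub : x |: [set z | e x z] \subset upto x.
    apply/subsetP=> z; rewrite !inE => /orP[/eqP ->|ez]; first by rewrite leqnn.
    by rewrite ez orbT.
  rewrite -(cardsDS sub); apply: eq_card => z; rewrite !inE.
  case: (eqVneq z x) => [->|zx] /=; first by rewrite ltnn.
  case ez: (e x z); rewrite /= ?andbF //= orbF andbT ltn_neqAle.
  by case: eqP => // /layer_struct /(_ zx) []; rewrite esym ez.
have lt : #|x |: [set z | e x z]| <= reach x.
  apply/subset_leq_card/subsetP=> z; rewrite !inE => /orP[/eqP ->|ez]; first by rewrite leqnn.
  by rewrite ez orbT.
move: lt; rewrite cardsU1 !inE eirr /= cardsE /reach add1n.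
by lia.
Qed.

Definition prec x y : Prop := D x < D y \/ D x = D y /\ before x y.

Lemma prec_total x y : x != y -> prec x y \/ prec y x.
Proof.
move=> xy; case: (ltngtP (D x) (D y)) => H; [by left; left|by right; left|].
by have [_ [b|b]] := layer_struct H xy; [left|right]; right.
Qed.

Lemma prec_sub x y : prec x y -> (upto x \subset upto y) && (far x \subset far y).
Proof.
case=> [lt|[E [b1 b2]]]; apply/andP; split; apply/subsetP=> z; rewrite !inE.
- case/orP=> [le|ez]; first by rewrite (leq_trans le (ltnW lt)).
  by have := lay_edge lay ez => le; rewrite (leq_trans le lt).
- case/andP=> lt2 _; rewrite (ltn_trans lt2 lt) /=; apply/negP; rewrite esym => ez.
  by have := lay_edge lay ez; lia.
- rewrite E; case: leqP => //= lt ez; apply: b1 => //.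
  by have := lay_edge lay ez; move: lt; lia.
- rewrite -E; case/andP=> lt2 nez; rewrite lt2 /=; apply: contra nez => ez; apply: b2 => //.
  by have := lay_edge lay (etrans (esym z y) ez); move: lt2; lia.
Qed.

(** Through this duality the growth of [far] along the order says that each [upto x] is closed
    downwards. *)
Lemma mem_farN x z : (x \in far z) = (z \notin upto x).
Proof. by rewrite !inE negb_or -ltnNge esym. Qed.

(** If [prec] orders x and y against their keys, the inclusions go the other way, while the sum of
    the sizes does not: all sizes agree and the sets coincide. So a sum of two sizes suffices as
    sorting key. *)
Lemma key_sub x y : key x <= key y -> (upto x \subset upto y) && (far x \subset far y).
Proof.
case: (eqVneq x y) => [-> _|xy]; first by rewrite !subxx.
case: (prec_total xy) => [/prec_sub //|/prec_sub/andP[s1 s2]].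
rewrite !keyE => le; have l1 := subset_leq_card s1; have l2 := subset_leq_card s2.
have /eqP <- : upto y == upto x by rewrite eqEcard s1; move: le l1 l2; rewrite /reach; lia.
have /eqP <- : far y == far x by rewrite eqEcard s2; move: le l1 l2; rewrite /reach; lia.
by rewrite !subxx.
Qed.

Variable pos : T -> nat.
Hypotheses (pos_inj : injective pos) (pos_lt : forall x, pos x < #|T|)
  (pos_key : forall x y, pos x < pos y -> key x <= key y).

Lemma card_pos_lt k : k <= #|T| -> #|[set w | pos w < k]| = k.
Proof.
move=> le.
have H (A : {set T}) (m l : nat) : (forall x, x \in A -> m <= pos x < m + l) -> #|A| <= l.
  move=> HA; rewrite cardE -(size_map pos) -(size_iota m l); apply: uniq_leq_size.
    by rewrite map_inj_uniq ?enum_uniq.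
  by move=> y /mapP[x]; rewrite mem_enum => /HA Hx ->; rewrite mem_iota.
have H1 : #|[set w | pos w < k]| <= k by apply: (H _ 0) => x; rewrite inE.
have H2 : #|~: [set w | pos w < k]| <= #|T| - k.
  by apply: (H _ k) => x; rewrite !inE -leqNgt => ->; have := pos_lt x; lia.
by have := cardsC [set w | pos w < k]; move: H1 H2; lia.
Qed.

Lemma pos_neq x y : pos x < pos y -> x != y.
Proof. by apply: contraTneq => ->; rewrite ltnn. Qed.

Lemma pos_sub x y : pos x < pos y -> (upto x \subset upto y) && (far x \subset far y).
Proof. by move=> /pos_key/key_sub. Qed.

Lemma upto_down x w z : pos w < pos z -> z \in upto x -> w \in upto x.
Proof.
move=> /pos_sub/andP[_ s]; apply: contraTT; rewrite -!mem_farN.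
exact: (subsetP s).
Qed.

Lemma mem_upto x z : (z \in upto x) = (pos z < reach x).
Proof.
have lt := pos_lt z; apply/idP/idP => Hz.
  rewrite -[(pos z).+1]card_pos_lt //; apply/subset_leq_card/subsetP => w; rewrite inE ltnS.
  by rewrite leq_eqVlt => /predU1P[/pos_inj -> //|lt2]; apply: upto_down lt2 Hz.
rewrite ltnNge -[pos z]card_pos_lt ?(ltnW lt) // in Hz; apply: contraNT Hz => nz.
apply/subset_leq_card/subsetP => w Hw; rewrite inE; case: ltngtP => // [lt2|/pos_inj E].
  by rewrite (upto_down lt2 Hw) in nz.
by rewrite -E Hw in nz.
Qed.

Lemma reach_edge x y : pos x < pos y -> e x y = (pos y < reach x).
Proof.
move=> lt; rewrite -mem_upto; apply/idP/idP => [exy|]; first by rewrite inE exy orbT.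
case: (ltngtP (D x) (D y)) => [lD|lD|E].
- by rewrite inE leqNgt lD.
(* Were y not adjacent to x, it would be in [far x], hence in [far y], which never contains y. *)
- move=> _; have /andP[_ /subsetP/(_ y)] := pos_sub lt.
  by rewrite !inE lD ltnn /=; case: (e x y) => // /(_ isT).
- by move=> _; case: (layer_struct E (pos_neq lt)).
Qed.

Lemma reach_mono x y : pos x < pos y -> reach x <= reach y.
Proof. by move=> /pos_sub/andP[/subset_leq_card]. Qed.

Lemma reach_gt x : pos x < reach x.
Proof. by rewrite -mem_upto inE leqnn. Qed.

Lemma reach_le x : reach x <= #|T|.
Proof. exact: max_card. Qed.

End Layers.
End Ordering.

(** * Ranks in a strict total order, and the umbrella order of a proper interval model *)

Section Rank.
Variables (T : finType) (lt : rel T).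
Hypotheses (lt_irr : irreflexive lt) (lt_trans : transitive lt)
  (lt_total : forall x y, x != y -> lt x y || lt y x).

Definition rank x := #|[set z | lt z x]|.

Lemma rank_ltn x y : lt x y -> rank x < rank y.
Proof.
move=> xy; apply/proper_card/properP; split.
  by apply/subsetP=> z; rewrite !inE => zx; apply: lt_trans xy.
by exists x; rewrite !inE ?lt_irr.
Qed.

Lemma rank_ltE x y : (rank x < rank y) = lt x y.
Proof.
apply/idP/idP=> [H|/rank_ltn //]; case: (eqVneq x y) => [E|/lt_total/orP[] // /rank_ltn].
  by rewrite E ltnn in H.
by lia.
Qed.

Lemma rank_inj : injective rank.
Proof.
move=> x y E; apply/eqP; apply: contraT => /lt_total/orP[] /rank_ltn; lia.
Qed.

Lemma rank_max x : rank x < #|T|.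
Proof.
rewrite -cardsT; apply/proper_card/properP; split; first exact: subsetT.
by exists x; rewrite !inE ?lt_irr.
Qed.

End Rank.

(** Sort by left ends, with indices breaking ties because intervals may coincide. Properness makes
    right ends monotone too, so if u and w meet, the left end of w is a common point of all three
    intervals. *)
Lemma interval_umbrella (n : nat) (e : rel 'I_n) :
  proper_interval_graph e -> exists rk, umbrella e rk.
Proof.
move=> [lo [hi [le [proper edge]]]].
pose rlt (a b : R) : bool := if Rlt_dec a b then true else false.
have rltP a b : reflect (Rlt a b) (rlt a b).
  by rewrite /rlt; case: Rlt_dec => H; constructor.
pose lt u v := rlt (lo u) (lo v) || ~~ rlt (lo v) (lo u) && (u < v).
have irr : irreflexive lt.
  by move=> u; rewrite /lt ltnn andbF orbF; apply/negP => /rltP /Rlt_irrefl.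
have tot x y : x != y -> lt x y || lt y x.
  move=> xy; rewrite /lt; case: (rltP (lo x) (lo y)) => //= _; case: (rltP (lo y) (lo x)) => //= _.
  by rewrite -neq_ltn.
have tr : transitive lt.
  move=> y x z; rewrite /lt => H1 H2.
  case: (rltP (lo x) (lo z)) => //= nxz.
  have [xy|xy] := rltP (lo x) (lo y).
    move: H2 => /orP[/rltP yz|/andP[/rltP yz _]]; first by have := Rlt_trans _ _ _ xy yz.
    by case: nxz; apply: (Rlt_le_trans _ _ _ xy); apply: Rnot_lt_le.
  move: H1; case: (rltP (lo x) (lo y)) => //= _ /andP[/rltP yx lxy].
  move: H2 => /orP[/rltP yz|/andP[/rltP zy lyz]].
    by case: nxz; apply: (Rle_lt_trans _ (lo y)) => //; apply: Rnot_lt_le.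
  rewrite (ltn_trans lxy lyz) andbT; apply/rltP => zx.
  by apply: zy; apply: (Rlt_le_trans _ _ _ zx); apply: Rnot_lt_le.
have mono u v : lt u v -> Rle (lo u) (lo v) /\ Rle (hi u) (hi v).
  move=> H; have lo_le : Rle (lo u) (lo v).
    move: H => /orP[/rltP|/andP[/rltP H _]]; first exact: Rlt_le.
    exact: Rnot_lt_le.
  split=> //; apply: Rnot_lt_le => lt_hi; apply: (proper v u); split=> //; split.
    exact: Rlt_le.
  by right; apply: Rlt_not_eq.
exists (rank lt); split; first exact: rank_inj.
move=> u v w; rewrite !rank_ltE // => uv vw.
have neq a b : lt a b -> a != b by apply: contraTneq => ->; rewrite irr.
move=> /(edge _ _ (neq _ _ (tr _ _ _ uv vw)))[x [[x1 x2] [x3 x4]]].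
have [l1 h1] := mono _ _ uv; have [l2 h2] := mono _ _ vw.
have lw : Rle (lo w) (hi u) by apply: Rle_trans x3 x2.
apply/andP; split.
  apply/(edge _ _ (neq _ _ uv)); exists (lo w); split; split=> //.
  - exact: Rle_trans l1 l2.
  - exact: Rle_trans lw h1.
apply/(edge _ _ (neq _ _ vw)); exists (lo w); split; split=> //.
- exact: Rle_trans lw h1.
- exact: Rle_refl.
Qed.

(** * Longest chains *)

(* Positions 0..n-1; position i is adjacent to i < j < n iff j < r i. *)
Section Chains.
Variables (n : nat) (r W H : nat -> nat).
Hypotheses (r_gt : forall i, i < n -> i < r i) (r_le : forall i, i < n -> r i <= n)
  (r_mono : forall i j, i <= j -> j < n -> r i <= r j).

Definition adj_pos (p : nat * nat) := [&& p.1 < p.2, p.2 < n & p.2 < r p.1].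

Definition indep (p q : nat * nat) :=
  [&& p.1 < p.2, q.1 < q.2, p.2 < q.1 & (r p.1 <= q.1) || (r p.2 <= q.2)].

(** Because of transitivity it is enough to separate consecutive edges, which is what opens the
    problem to dynamic programming. *)
Lemma indep_trans : transitive indep.
Proof.
by move=> q p s /and4P[pp _ l1 /orP o1] /and4P[qq ss l2 _]; apply/and4P; split=> //; lia.
Qed.

(* [W i]: most edges in a chain of positions >= i.  [H b]: most edges in a chain
   whose first edge (a', b') has b < a' and b' not adjacent to b. *)
Hypotheses (WE : forall i, i < n ->
    W i = if i.+1 < r i then (maxn (W (r i)) (H i.+1)).+1 else W i.+1)
  (HE : forall i, i < n ->
    H i = if i.+1 == r i then W i.+1 else
          if r i.+1 == r i then H i.+1 else (maxn (W (r i.+1)) (H (r i))).+1)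
  (W0 : forall i, n <= i -> W i = 0) (H0 : forall i, n <= i -> H i = 0).

(** Longest chain starting with p, split by the reason why the next edge is separated from p. It can
    only drop when either end of p moves right. *)
Definition value (p : nat * nat) := (maxn (W (r p.1)) (H p.2)).+1.

(** The branches of the recurrence for H. If i has no later neighbour, an end beyond [r i] is
    automatic and H reduces to W. If [i.+1] reaches no further than i, it cannot start a suitable
    edge. Otherwise [(i.+1, r i)] is an edge and is componentwise least among the suitable ones. *)
Lemma H_cases i : i < n ->
  [\/ i.+1 = r i, [/\ i.+1 < n, i.+1 < r i & r i.+1 = r i]
    | [/\ i.+1 < r i, r i < r i.+1, i.+1 < n & r i.+1 <= n]].
Proof.
move=> lt; have le := r_le lt; have := r_gt lt; rewrite leq_eqVlt => /predU1P[->|lt2].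
  by constructor.
have lt3 : i.+1 < n by move: le; lia.
have := r_mono (leqnSn i) lt3; rewrite leq_eqVlt => /predU1P[E|lt4].
  by constructor 2.
by constructor 3; split=> //; apply: r_le.
Qed.

Lemma down_ind (P : nat -> Prop) :
  (forall i, n <= i -> P i) -> (forall i, i < n -> (forall j, i < j -> P j) -> P i) ->
  forall i, P i.
Proof.
move=> big IH i; have [k] := ubnP (n - i); elim: k i => // k IHk i Hk.
case: (leqP n i) => [/big //|lt]; apply: IH => // j lt_ij.
by case: (leqP n j) => [/big //|lt_jn]; apply: IHk; lia.
Qed.

(** Soundness of the tables: a nonzero entry comes from an actual edge. The converse inequality is
    in [bounds]. *)
Lemma attained i :
  (W i = 0 \/ exists2 q, adj_pos q & i <= q.1 /\ W i = value q) /\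
  (i < n -> H i = 0 \/ exists2 q, adj_pos q & [/\ i < q.1, r i <= q.2 & H i = value q]).
Proof.
elim/down_ind: i => [i le|i lt IH]; first by split; [left; apply: W0 | lia].
split=> [|_].
  rewrite (WE lt); case: ifP => H1.
    right; exists (i, i.+1) => //; rewrite /adj_pos /= ltnSn H1 andbT.
    by have := r_le lt; lia.
  have [[->|[q Eq [le ->]]] _] := IH i.+1 (ltnSn _); first by left.
  by right; exists q => //; split=> //; apply: ltnW.
rewrite (HE lt); case: (H_cases lt) => [E|[lt1 lt2 E]|[lt1 lt2 lt3 le]].
- rewrite E eqxx -E; have [[->|[q Eq [le ->]]] _] := IH i.+1 (ltnSn _); first by left.
  by right; exists q => //; split=> //; case/and3P: Eq; lia.
- rewrite E eqxx ltn_eqF //.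
  have [_ /(_ lt1) [->|[q Eq [le1 le2 ->]]]] := IH i.+1 (ltnSn _); first by left.
  by right; exists q => //; split=> //; rewrite -?E //; apply: ltnW.
- rewrite ltn_eqF // gtn_eqF //; right; exists (i.+1, r i) => //.
  by rewrite /adj_pos /= lt1 lt2 andbT /=; lia.
Qed.

Lemma bounds i :
  [/\ forall j, i <= j -> W j <= W i, forall j, i <= j -> H j <= H i,
      forall q, adj_pos q -> i <= q.1 -> value q <= W i
    & i < n -> forall q, adj_pos q -> i < q.1 -> r i <= q.2 -> value q <= H i].
Proof.
elim/down_ind: i => [i le|i lt IH].
  split=> [j lj|j lj|q /and3P[]|]; [by rewrite W0; lia | by rewrite H0; lia | by lia | by lia].
have L1 q : adj_pos q -> i <= q.1 -> value q <= W i.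
  move=> Eq le; rewrite (WE lt); case: ifP => H1.
    have [Wi _ _ _] := IH (r i) (r_gt lt); have [_ Hi _ _] := IH i.+1 (ltnSn _).
    have [q1 q2 q3] := and3P Eq; rewrite ltnS.
    have := Wi (r q.1) (r_mono le (ltn_trans q1 q2)); have := Hi q.2 (leq_ltn_trans le q1).
    by rewrite /value; lia.
  have [_ _ L _] := IH i.+1 (ltnSn _); apply: L => //.
  rewrite ltn_neqAle le andbT; apply: contraFneq H1 => ->.
  by case/and3P: Eq; lia.
have L2 q : adj_pos q -> i < q.1 -> r i <= q.2 -> value q <= H i.
  move=> Eq lt_iq le; rewrite (HE lt); have [q1 q2 q3] := and3P Eq.
  case: (H_cases lt) => [E|[lt1 lt2 E]|[lt1 lt2 lt3 le3]].
  - by rewrite E eqxx -E; have [_ _ L _] := IH i.+1 (ltnSn _); apply: L.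
  - rewrite E eqxx ltn_eqF //; have [_ _ _ /(_ lt1) L] := IH i.+1 (ltnSn _); apply: L => //.
      rewrite ltn_neqAle lt_iq andbT; apply: contraTneq q3 => <-.
      by rewrite E -leqNgt.
    by rewrite E.
  - rewrite ltn_eqF // gtn_eqF //.
    have lr : i < r i.+1 by lia.
    have [Wi _ _ _] := IH _ lr; have [_ Hi _ _] := IH _ (r_gt lt).
    have := Wi (r q.1) (r_mono lt_iq (ltn_trans q1 q2)); have := Hi _ le.
    by rewrite /value; lia.
(* The tables decrease because an entry at j is the value of an edge that also competes at i. *)
split=> // j; rewrite leq_eqVlt => /predU1P[<- //|lt_ij].
  have [[->//|[q Eq [le ->]]] _] := attained j.
  by apply: L1 => //; lia.
case: (leqP n j) => [le|lt_jn]; first by rewrite H0.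
have [_ /(_ lt_jn) [->//|[q Eq [le1 le2 ->]]]] := attained j.
apply: L2 => //; first by lia.
by apply: leq_trans le2; apply: r_mono => //; apply: ltnW.
Qed.

Lemma chain_value p s : path indep p s -> all adj_pos (p :: s) -> size (p :: s) <= value p.
Proof.
elim: s p => [|q s IH] p //=.
move=> /andP[Hpq Hs] /and3P[Hp Hq Ha]; rewrite ltnS.
apply: leq_trans (IH q Hs _) _; first by rewrite /= Hq.
have [p1 p2 p3] := and3P Hp; have [_ q1 l /orP[le|le]] := and4P Hpq.
  by have [_ _ L _] := bounds (r p.1); have := L _ Hq le; lia.
by have [_ _ _ /(_ p2) L] := bounds p.2; have := L _ Hq l le; lia.
Qed.

Lemma chain_le s : sorted indep s -> all adj_pos s -> size s <= W 0.
Proof.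
case: s => // p s Hs Ha; apply: leq_trans (chain_value Hs Ha) _.
by have [_ _ L _] := bounds 0; apply: L => //; case/andP: Ha.
Qed.

(* One step of the reconstruction; the flag tells whether the current optimum is [H i]
   rather than [W i]. *)
Definition ostep (h : bool) (i : nat) : option (nat * nat) * (bool * nat) :=
  if n <= i then (None, (h, i)) else
  if ~~ h then
    if i.+1 < r i then
      (Some (i, i.+1), if H i.+1 <= W (r i) then (false, r i) else (true, i.+1))
    else (None, (false, i.+1))
  else if i.+1 == r i then (None, (false, i.+1))
  else if r i.+1 == r i then (None, (true, i.+1))
  else (Some (i.+1, r i),
        if H (r i) <= W (r i.+1) then (false, r i.+1) else (true, r i)).

(** The parameter k is fuel: every step before n advances the position, so n steps are enough from
    position 0. *)
Fixpoint optimum (k : nat) (c : bool * nat) : seq (nat * nat) :=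
  if k is k'.+1 then
    let: (o, c') := ostep c.1 c.2 in
    if o is Some p then p :: optimum k' c' else optimum k' c'
  else [::].

Definition admissible (c : bool * nat) (q : nat * nat) :=
  if c.1 then (c.2 < q.1) && (r c.2 <= q.2) else c.2 <= q.1.

(** The last clause feeds the induction: all later edges satisfy the constraint recorded in the
    state, hence are separated from the edge emitted just before it. *)
Lemma optimum_ok k c : n <= c.2 + k ->
  [/\ size (optimum k c) = (if c.1 then H c.2 else W c.2),
      sorted indep (optimum k c), all adj_pos (optimum k c)
    & c.2 < n -> all (admissible c) (optimum k c)].
Proof.
elim: k c => [|k IH] [h i] /= le.
  by rewrite addn0 in le; case: h => /=; rewrite ?W0 ?H0.
rewrite /ostep; case: (leqP n i) => [le_ni|lt].
  have [/= -> s a _] := IH (h, i) ltac:(move: le; rewrite /=; lia).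
  by split=> //; lia.
have weak (c c' : bool * nat) s : (forall q, adj_pos q -> admissible c q -> admissible c' q) ->
    all adj_pos s -> all (admissible c) s -> all (admissible c') s.
  by move=> Hw; elim: s => //= q s IHs /andP[q1 /IHs IHq] /andP[/(Hw _ q1) -> /IHq].
have step c p v : v = (if c.1 then H c.2 else W c.2).+1 -> i < c.2 -> adj_pos p -> admissible (h, i) p ->
    (forall q, adj_pos q -> admissible c q -> indep p q) ->
    [/\ size (p :: optimum k c) = v,
        sorted indep (p :: optimum k c), all adj_pos (p :: optimum k c)
      & true -> all (admissible (h, i)) (p :: optimum k c)].
  move=> -> lt_ic Hp Ap Hw; have [s1 s2 s3 s4] := IH c ltac:(move: le; lia).
  have Ai : all (indep p) (optimum k c).
    (* At or past position n the tail is empty, since its size is a table entry there, namely 0. *)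
    case: (leqP n c.2) => [le_nc|/s4 s5].
      by move: s1; case: c.1; rewrite ?W0 ?H0 // => /size0nil ->.
    by apply/allP=> q Hq; apply: Hw; [apply: (allP s3) | apply: (allP s5)].
  split=> [|||_] /=; rewrite ?s1 ?Hp ?Ap //.
    by rewrite path_sortedE ?Ai //; apply: indep_trans.
  apply/allP=> q Hq; have /and4P[p1 q1 l _] := allP Ai q Hq.
  have [pa pb pc] := and3P Hp; have /and3P[_ qn _] := allP s3 q Hq.
  move: Ap; rewrite /admissible /=; case: h => /=; last by lia.
  by move=> /andP[? ?]; lia.
have skip c : i < c.2 -> (forall q, adj_pos q -> admissible c q -> admissible (h, i) q) ->
    [/\ size (optimum k c) = (if c.1 then H c.2 else W c.2),
        sorted indep (optimum k c), all adj_pos (optimum k c)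
      & true -> all (admissible (h, i)) (optimum k c)].
  move=> lt_ic Hw; have [s1 s2 s3 s4] := IH c ltac:(move: le; lia); split=> // _.
  case: (leqP n c.2) => [le_nc|/s4]; last exact: weak.
  by move: s1; case: c.1; rewrite ?W0 ?H0 // => /size0nil ->.
case: h step skip => /= step skip.
  rewrite (HE lt); case: (H_cases lt) => [E|[lt1 lt2 E]|[lt1 lt2 lt3 le3]].
  - rewrite E eqxx -E; apply: (skip (false, i.+1)) => // q /and3P[q1 q2 q3]; rewrite /admissible /= => le1.
    by rewrite le1 /= -E; lia.
  - rewrite E eqxx ltn_eqF //; apply: (skip (true, i.+1)) => // q _; rewrite /admissible /= E => /andP[l ->].
    by rewrite ltnW.
  - rewrite ltn_eqF // gtn_eqF //.
    have Hp : adj_pos (i.+1, r i) by rewrite /adj_pos /= lt1 lt2 andbT /=; lia.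
    case: leqP => Hm.
      apply: (step (false, r i.+1) (i.+1, r i)) => //.
      + by rewrite /=; lia.
      + by rewrite /admissible /= ltnSn leqnn.
      + move=> q /and3P[q1 q2 q3]; rewrite /admissible /= => le1.
        by rewrite /indep /= lt1 q1 le1 orTb andbT /=; lia.
    apply: (step (true, r i) (i.+1, r i)) => //.
    + exact: r_gt.
    + by rewrite /admissible /= ltnSn leqnn.
    + move=> q /and3P[q1 q2 q3]; rewrite /admissible /= => /andP[l1 l2].
      by rewrite /indep /= lt1 q1 l1 l2 orbT.
rewrite (WE lt); case: ifPn => Hi; last first.
  by apply: (skip (false, i.+1)) => // q _; rewrite /admissible /=; apply: ltnW.
have Hp : adj_pos (i, i.+1) by rewrite /adj_pos /= ltnSn Hi andbT; have := r_le lt; lia.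
case: leqP => Hm.
  apply: (step (false, r i) (i, i.+1)) => //.
  + exact: r_gt.
  + by rewrite /admissible /=.
  + move=> q /and3P[q1 q2 q3]; rewrite /admissible /= => le1.
    by rewrite /indep /= ltnSn q1 le1 orTb andbT /=; lia.
apply: (step (true, i.+1) (i, i.+1)) => //.
+ by rewrite /admissible /=.
+ move=> q /and3P[q1 q2 q3]; rewrite /admissible /= => /andP[l1 l2].
  by rewrite /indep /= ltnSn q1 l1 l2 orbT.
Qed.

End Chains.

(** * Uniquely restricted matchings are chains *)

Lemma matching_meet (T : finType) (e : rel T) M E F x :
  matching e M -> E \in M -> F \in M -> x \in E -> x \in F -> E = F.
Proof.
move=> [_ dis] ME MF xE xF; apply/eqP; apply: contraT => /(dis _ _ ME MF).
by move=> /disjoint_setI0 /setP /(_ x); rewrite !inE xE xF.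
Qed.

Lemma set2_inj (T : finType) (a b c d : T) :
  a != b -> [set a; b] = [set c; d] -> a = c /\ b = d \/ a = d /\ b = c.
Proof.
move=> ab E; have : a \in [set c; d] by rewrite -E set21.
have : b \in [set c; d] by rewrite -E set22.
rewrite !inE => /orP[]/eqP Eb /orP[]/eqP Ea; subst; try (by rewrite eqxx in ab); tauto.
Qed.

(** Otherwise x y w z is an alternating 4-cycle, and replacing xy and zw by xz and yw gives a
    different matching of the same vertices. *)
Lemma ur_no_swap (T : finType) (e : rel T) M x y z w :
  symmetric e -> irreflexive e -> uniquely_restricted e M ->
  [set x; y] \in M -> [set z; w] \in M -> [set x; y] != [set z; w] ->
  e x z -> ~~ e y w.
Proof.
move=> es eirr [mM ur] M1 M2 neq exz; apply/negP=> eyw.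
have irr a b : e a b -> a != b by apply: contraTneq => ->; rewrite eirr.
have edge a b : [set a; b] \in M -> a != b.
  move=> Mab; have [/(_ _ Mab) [c [d [ecd Ecd]]] _] := mM.
  have := cards2 a b; rewrite Ecd cards2 (irr _ _ ecd).
  by case: eqP.
have meet a b c d u : [set a; b] \in M -> [set c; d] \in M -> [set a; b] != [set c; d] ->
    u \in [set a; b] -> u \notin [set c; d].
  by move=> Mab Mcd nab ua; apply: contra nab => uc; apply/eqP; apply: (matching_meet mM Mab Mcd ua uc).
have [xy zw] := (edge _ _ M1, edge _ _ M2).
have := meet _ _ _ _ x M1 M2 neq (set21 _ _); have := meet _ _ _ _ y M1 M2 neq (set22 _ _).
rewrite !inE !negb_or => /andP[yz yw] /andP[xz xw].
pose R := M :\: [set [set x; y]; [set z; w]].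
pose N := [set x; z] |: ([set y; w] |: R).
have inR E u : E \in R -> u \in E -> [&& u != x, u != y, u != z & u != w].
  rewrite !inE negb_or => /andP[/andP[n1 n2] ME] uE.
  have : u \notin [set x; y] by apply: contra n1 => H; apply/eqP; apply: (matching_meet mM ME M1 uE H).
  have : u \notin [set z; w] by apply: contra n2 => H; apply/eqP; apply: (matching_meet mM ME M2 uE H).
  by rewrite !inE !negb_or => /andP[-> ->] /andP[-> ->].
have mR E : E \in R -> E \in M by rewrite !inE => /andP[].
have dis_pair a b E : E \in R -> a \in [:: x; y; z; w] -> b \in [:: x; y; z; w] ->
    [disjoint [set a; b] & E].
  move=> RE; have nE c : c \in [:: x; y; z; w] -> c \notin E.
    move=> Hc; apply/negP=> /(inR _ _ RE); move: Hc; rewrite !inE.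
    by case/or4P=> /eqP->; rewrite eqxx ?andbF.
  by move=> /nE aE /nE bE; rewrite disjoint_subset; apply/subsetP=> u;
    rewrite !inE => /orP[] /eqP ->.
have dis0 : [disjoint [set x; z] & [set y; w]].
  rewrite disjoint_subset; apply/subsetP=> u; rewrite !inE negb_or.
  by case/orP=> /eqP ->; rewrite ?xy ?xw // [z == y]eq_sym yz zw.
have mN : matching e N.
  split=> [E|E F].
    rewrite /N in_setU1 => /orP[/eqP ->|]; first by exists x, z.
    rewrite in_setU1 => /orP[/eqP ->|/mR ME]; first by exists y, w.
    exact: mM.1.
  rewrite /N !in_setU1 => /or3P[/eqP->|/eqP->|RE] /or3P[/eqP->|/eqP->|RF] nEF.
  - by rewrite eqxx in nEF.
  - exact: dis0.
  - by apply: (dis_pair _ _ _ RF); rewrite !inE ?eqxx ?orbT.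
  - by rewrite disjoint_sym.
  - by rewrite eqxx in nEF.
  - by apply: (dis_pair _ _ _ RF); rewrite !inE ?eqxx ?orbT.
  - by rewrite disjoint_sym; apply: (dis_pair _ _ _ RE); rewrite !inE ?eqxx ?orbT.
  - by rewrite disjoint_sym; apply: (dis_pair _ _ _ RE); rewrite !inE ?eqxx ?orbT.
  - by apply: mM.2 => //; apply: mR.
have cN : matched N = matched M.
  have -> : M = [set x; y] |: ([set z; w] |: R).
    apply/setP=> E; rewrite !inE; case: eqP => [->|_] //; case: eqP => [->|_] //.
  rewrite /matched /N /cover !bigcup_setU !big_set1; apply/setP=> u.
  by rewrite !inE; do 4 case: (u == _); rewrite ?orbT.
have /setP /(_ [set x; z]) := ur _ mN cN; rewrite !inE eqxx /= => /esym Mxz.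
have := matching_meet mM Mxz M1 (set21 _ _) (set21 _ _) => /setP /(_ z).
by rewrite !inE eqxx orbT eq_sym (negbTE xz) eq_sym (negbTE yz).
Qed.

Section Positions.
Variables (T : finType) (e : rel T) (pos : T -> nat) (n : nat) (r : nat -> nat).
Hypotheses (es : symmetric e) (eirr : irreflexive e).
Hypotheses (pos_inj : injective pos) (pos_lt : forall x, pos x < n).
Hypotheses (edge_pos : forall x y, pos x < pos y -> e x y = (pos y < r (pos x))).
Hypothesis r_mono : forall i j, i <= j -> j < n -> r i <= r j.

Definition at_pos (p : T * T) := (pos p.1, pos p.2).

Definition edges_of (ps : seq (T * T)) := [set [set p.1; p.2] | p in ps].

Lemma matching_edge M a b : matching e M -> [set a; b] \in M -> a != b -> e a b.
Proof.
move=> [edge _] /edge[c [d [ecd E]]] ab.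
by case: (set2_inj ab E) => -[-> ->] //; rewrite es.
Qed.

Lemma ltn_pos_neq x y : pos x < pos y -> x != y.
Proof. by apply: contraTneq => ->; rewrite ltnn. Qed.

(** If the edges overlapped in the order, x would be adjacent to z, and y to w whichever of these
    two comes first, by monotonicity of [r]; that contradicts [ur_no_swap]. If they do not overlap,
    the same lemma is exactly the required non-adjacency. *)
Lemma ur_indep M x y z w : uniquely_restricted e M ->
  [set x; y] \in M -> [set z; w] \in M -> pos x < pos y -> pos z < pos w -> pos x < pos z ->
  indep r (at_pos (x, y)) (at_pos (z, w)).
Proof.
move=> U M1 M2 xy zw xz; have [mM _] := U.
have e1 : pos y < r (pos x).
  by rewrite -edge_pos // (matching_edge mM M1) // ltn_pos_neq.
have e2 : pos w < r (pos z).
  by rewrite -edge_pos // (matching_edge mM M2) // ltn_pos_neq.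
have neq : [set x; y] != [set z; w].
  apply/eqP=> /(set2_inj (ltn_pos_neq xy)) [] [E1 E2]; subst; first by rewrite ltnn in xz.
  by have := ltn_trans xy zw; lia.
have noswap := ur_no_swap es eirr U M1 M2 neq.
have yw : pos y != pos w.
  apply/eqP=> /pos_inj E; case/negP: neq; apply/eqP.
  by apply: (matching_meet mM M1 M2 (set22 _ _)); rewrite E set22.
have yz : pos y != pos z.
  apply/eqP=> /pos_inj E; case/negP: neq; apply/eqP.
  by apply: (matching_meet mM M1 M2 (set22 _ _)); rewrite E set21.
rewrite /indep /at_pos /= xy zw /=.
have rxy := r_mono (ltnW xy) (pos_lt y); have rzy := r_mono (ltnW xz) (pos_lt z).
case: (ltngtP (pos y) (pos z)) yz => // [lt|lt] _ /=.
  case: leqP => //= lt2; rewrite leqNgt; apply/negP=> lt3.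
  have /negP[] := noswap (etrans (edge_pos xz) lt2).
  by rewrite edge_pos //; apply: ltn_trans lt zw.
have xz' : e x z by rewrite edge_pos // (ltn_trans lt e1).
have /negP[] := noswap xz'; case: (ltngtP (pos y) (pos w)) yw => // lt2 _.
  by rewrite edge_pos //; apply: leq_trans e2 (r_mono (ltnW lt) (pos_lt y)).
by rewrite es edge_pos //; apply: leq_trans e1 _; apply: r_mono (pos_lt w); apply: ltnW (ltn_trans xz zw).
Qed.

Lemma ur_chain M : uniquely_restricted e M ->
  exists ps, [/\ #|M| <= size ps, sorted (indep r) (map at_pos ps) & all (adj_pos n r) (map at_pos ps)].
Proof.
move=> U; have [mM _] := U.
(* The edges of M, each oriented from left to right; as M is a matching, the left end determines the
   edge and sorting by it is strict. *)
pose A := [set p : T * T | ([set p.1; p.2] \in M) && (pos p.1 < pos p.2)].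
pose s := sort (relpre (fun p => pos p.1) leq) (enum A).
have sA p : p \in s -> p \in A by rewrite mem_sort mem_enum.
have fst_inj p q : p \in A -> q \in A -> pos p.1 = pos q.1 -> p = q.
  case: p q => x y [z w]; rewrite !inE /= => /andP[M1 l1] /andP[M2 l2] /pos_inj E; subst z.
  have E := matching_meet mM M1 M2 (set21 _ _) (set21 _ _).
  case: (set2_inj (ltn_pos_neq l1) E) => -[E1 E2]; first by rewrite E2.
  by rewrite E2 ltnn in l1.
exists s; split.
- rewrite size_sort -cardE; apply: leq_trans (leq_imset_card (fun p => [set p.1; p.2]) A).
  apply/subset_leq_card/subsetP=> E ME; have [/(_ _ ME) [x [y [exy EE]]] _] := mM.
  have : pos x != pos y by apply: contraTneq exy => /pos_inj ->; rewrite eirr.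
  rewrite neq_ltn => /orP[lt|lt]; apply/imsetP.
    by exists (x, y) => //; rewrite inE -EE ME.
  by exists (y, x); rewrite ?inE /= 1?setUC -?EE ?ME.
- have : sorted ltn (map (fun p => pos p.1) s).
    rewrite ltn_sorted_uniq_leq sorted_map sort_sorted ?andbT; last by move=> p q; apply: leq_total.
    rewrite map_inj_in_uniq ?sort_uniq ?enum_uniq // => p q /sA Ap /sA Aq; exact: fst_inj.
  rewrite !sorted_map; apply: (sub_in_sorted (P := mem A)); last by apply/allP.
  case=> x y [z w]; rewrite !inE /= => /andP[M1 l1] /andP[M2 l2] l3.
  exact: (ur_indep U M1 M2 l1 l2 l3).
- apply/allP=> q /mapP[[x y] /sA]; rewrite inE /= => /andP[M1 l1] ->.
  rewrite /adj_pos /at_pos /= l1 pos_lt -edge_pos //=.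
  exact: (matching_edge mM M1 (ltn_pos_neq l1)).
Qed.

Section FromChain.
Variable ps : seq (T * T).
Hypotheses (ps_sorted : sorted (indep r) (map at_pos ps))
  (ps_adj : all (adj_pos n r) (map at_pos ps)).

Lemma chain_indep (p q : T * T) : p \in ps -> q \in ps -> pos p.1 < pos q.1 -> indep r (at_pos p) (at_pos q).
Proof.
move=> Hp Hq lt; have srt := ps_sorted; rewrite sorted_map in srt.
have tr : transitive (relpre at_pos (indep r)) by move=> a b c; apply: indep_trans.
have nth_lt := sorted_ltn_nth tr p srt.
have [ip iq] : index p ps < size ps /\ index q ps < size ps by rewrite !index_mem.
case: (ltngtP (index p ps) (index q ps)) => [lt2|lt2|E].
- by have := nth_lt _ _ ip iq lt2; rewrite !nth_index.
- by have := nth_lt _ _ iq ip lt2; rewrite !nth_index // => /and4P[/= l1 l2 l3 _]; exfalso; lia.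
- by have := nth_index p Hp; rewrite E nth_index // => E2; rewrite E2 ltnn in lt.
Qed.

Lemma chain_adj (p : T * T) : p \in ps -> [/\ pos p.1 < pos p.2, pos p.2 < r (pos p.1) & e p.1 p.2].
Proof.
move=> Hp; have /and3P[/= p1 _ p3] := allP ps_adj _ (map_f at_pos Hp).
by split=> //; rewrite edge_pos.
Qed.

Lemma chain_meet (p q : T * T) (x : T) : p \in ps -> q \in ps -> x \in [set p.1; p.2] -> x \in [set q.1; q.2] -> p = q.
Proof.
move=> Hp Hq; have [p1 _ _] := chain_adj Hp; have [q1 _ _] := chain_adj Hq.
case: (ltngtP (pos p.1) (pos q.1)) => [lt|lt|E].
- have /and4P[_ _ /= l _] := chain_indep Hp Hq lt.
  by rewrite !inE => /orP[]/eqP -> /orP[]/eqP E; move: p1 q1 l lt; rewrite E; lia.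
- have /and4P[_ _ /= l _] := chain_indep Hq Hp lt.
  by rewrite !inE => /orP[]/eqP -> /orP[]/eqP E; move: p1 q1 l lt; rewrite E; lia.
- move=> _ _; have srt := ps_sorted; rewrite sorted_map in srt.
  have tr : transitive (relpre at_pos (indep r)) by move=> a b c; apply: indep_trans.
  have nth_lt := sorted_ltn_nth tr p srt.
  have [ip iq] : index p ps < size ps /\ index q ps < size ps by rewrite !index_mem.
  case: (ltngtP (index p ps) (index q ps)) => [lt2|lt2|E2].
  + by have := nth_lt _ _ ip iq lt2; rewrite !nth_index // => /and4P[/= l1 l2 l3 _]; exfalso; lia.
  + by have := nth_lt _ _ iq ip lt2; rewrite !nth_index // => /and4P[/= l1 l2 l3 _]; exfalso; lia.
  + by have := nth_index p Hp; rewrite E2 nth_index.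
Qed.

Lemma chain_uniq : uniq [seq [set p.1; p.2] | p <- ps].
Proof.
rewrite map_inj_in_uniq.
  have srt := ps_sorted; rewrite sorted_map in srt; apply: (sorted_uniq _ _ srt).
    by move=> a b c; apply: indep_trans.
  by move=> p; apply/negP=> /and4P[/= l1 l2 l3 _]; lia.
by move=> p q Hp Hq E; apply: (chain_meet (x := p.1) Hp Hq); rewrite -?E set21.
Qed.

Lemma chain_matching : matching e (edges_of ps).
Proof.
split=> [E /imsetP[p Hp ->]|E F /imsetP[p Hp ->] /imsetP[q Hq ->] neq].
  by have [_ _ epp] := chain_adj Hp; exists p.1, p.2.
rewrite -setI_eq0; apply: contraNT neq => /set0Pn[x]; rewrite in_setI => /andP[xp xq].
by rewrite (chain_meet Hp Hq xp xq).
Qed.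

Lemma chain_ur : uniquely_restricted e (edges_of ps).
Proof.
split=> [|M mM cM]; first exact: chain_matching.
have partner x : x \in matched M -> exists2 y, [set x; y] \in M & e x y.
  move=> /bigcupP[E ME xE]; have [/(_ _ ME) [c [d [ecd EE]]] _] := mM.
  subst E; move: xE; rewrite !inE => /orP[]/eqP ->; first by exists d.
  by exists c; rewrite 1?setUC // es.
have covered x : x \in matched M -> exists2 p, p \in ps & x \in [set p.1; p.2].
  by rewrite cM => /bigcupP[E /imsetP[p Hp ->] xp]; exists p.
have cover x p : p \in ps -> x \in [set p.1; p.2] -> x \in matched M.
  move=> Hp xp; rewrite cM; apply/bigcupP; exists [set p.1; p.2] => //.
  exact: imset_f.
(* Induction on the left end: the edges to the left are already known to be in M, so a deviating
   partner of a or b can only lie to the right. *)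
have inM p : p \in ps -> [set p.1; p.2] \in M.
  have [k] := ubnP (pos p.1); elim: k p => // k IH [a b] /= Hk Hp.
  have [/= ab rab eab] := chain_adj Hp.
  (* A partner other than the prescribed one lies in a later edge of the chain. *)
  have later x y : x \in [set a; b] -> [set x; y] \in M -> e x y -> y \notin [set a; b] ->
      exists2 q, q \in ps & y \in [set q.1; q.2] /\ pos a < pos q.1.
    move=> xab Mxy exy yab.
    have cy : y \in matched M by apply/bigcupP; exists [set x; y]; rewrite ?set22.
    have [q Hq yq] := covered _ cy; exists q => //; split=> //.
    rewrite ltnNge leq_eqVlt; apply/negP=> /predU1P[E|lt].
      have [q1 _ _] := chain_adj Hq; have Eq := pos_inj E.
      have Epq : (a, b) = q by apply: (chain_meet (x := a) Hp Hq); rewrite -?Eq set21.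
      by move: yq; rewrite -Epq (negbTE yab).
    have Mq := IH q (leq_trans lt Hk) Hq.
    have Exy := matching_meet mM Mxy Mq (set22 _ _) yq.
    have xq : x \in [set q.1; q.2] by rewrite -Exy set21.
    by have Epq := chain_meet Hp Hq xab xq; rewrite -Epq ltnn in lt.
  have [x Max eax] := partner a (cover a (a, b) Hp (set21 _ _)).
  have [y Mby eby] := partner b (cover b (a, b) Hp (set22 _ _)).
  case: (boolP (x \in [set a; b])) => [|nx].
    rewrite !inE => /orP[]/eqP E; last by rewrite -E.
    by rewrite E eirr in eax.
  case: (boolP (y \in [set a; b])) => [|ny].
    rewrite !inE => /orP[]/eqP E; first by rewrite setUC -E.
    by rewrite E eirr in eby.
  have [[c d] Hq [/= xq lt]] := later a x (set21 _ _) Max eax nx.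
  have [[c' d'] Hq' [/= yq lt']] := later b y (set22 _ _) Mby eby ny.
  have xy : x != y.
    apply/eqP=> E; subst y; have := matching_meet mM Max Mby (set22 _ _) (set22 _ _).
    case/set2_inj; first by apply: contraTneq eax => ->; rewrite eirr.
      by case=> E _; rewrite E ltnn in ab.
    by case=> E _; rewrite -E eirr in eax.
  have /and4P[/= _ cd bc /orP o] := chain_indep Hp Hq lt.
  have /and4P[/= _ cd' bc' /orP o'] := chain_indep Hp Hq' lt'.
  have mab := r_mono (ltnW ab) (pos_lt b).
  have [cx xd] : pos c <= pos x /\ pos x <= pos d.
    by case/set2P: xq => /= ->; rewrite leqnn ltnW.
  have [cy yd] : pos c' <= pos y /\ pos y <= pos d'.
    by case/set2P: yq => /= ->; rewrite leqnn ltnW.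
  have xr : pos x < r (pos a) by rewrite -edge_pos // (leq_trans lt cx).
  have yr : pos y < r (pos b) by rewrite -edge_pos // (leq_trans bc' cy).
  (* Take the edge further left among those containing x and y. In each case a reaches its left end
     and b its right end, against its separation from (a, b). *)
  case: (ltngtP (pos c) (pos c')) => [l|l|/pos_inj E].
  - have /and4P[/= _ _ dc _] := chain_indep Hq Hq' l.
    by clear - o dc cx xr cy yr; lia.
  - have /and4P[/= _ _ dc _] := chain_indep Hq' Hq l.
    by clear - o' dc l cd' cx xr mab; lia.
  - have Eq : (c, d) = (c', d') by apply: (chain_meet (x := c) Hq Hq'); rewrite /= ?E set21.
    case: Eq => _ Ed; subst c' d'.
    have nxy : pos x <> pos y by move=> /pos_inj Exy; rewrite Exy eqxx in xy.
    case/set2P: xq => /= Ex; case/set2P: yq => /= Ey; subst; try by case: nxy.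
      by clear - o cd xr yr; lia.
    by clear - o cd xr yr mab; lia.
(* M contains the whole chain, which already covers every vertex matched by M, so there is no room
   for another edge. *)
apply/eqP; rewrite eqEsubset andbC; apply/andP; split.
  by apply/subsetP=> E /imsetP[p Hp ->]; apply: inM.
apply/subsetP=> E ME; have [/(_ _ ME) [c [d [ecd EE]]] _] := mM; subst E.
have cc : c \in matched M by apply/bigcupP; exists [set c; d]; rewrite ?set21.
have [p Hp cp] := covered _ cc.
by rewrite (matching_meet mM ME (inM p Hp) (set21 _ _) cp); apply: imset_f.
Qed.

End FromChain.

Lemma chain_max ps (W H : nat -> nat) :
  (forall i, i < n -> i < r i) -> (forall i, i < n -> r i <= n) ->
  (forall i, i < n ->
    W i = if i.+1 < r i then (maxn (W (r i)) (H i.+1)).+1 else W i.+1) ->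
  (forall i, i < n ->
    H i = if i.+1 == r i then W i.+1 else
          if r i.+1 == r i then H i.+1 else (maxn (W (r i.+1)) (H (r i))).+1) ->
  (forall i, n <= i -> W i = 0) -> (forall i, n <= i -> H i = 0) ->
  map at_pos ps = optimum n r W H n (false, 0) ->
  max_ur_matching e (edges_of ps) /\ uniq [seq [set p.1; p.2] | p <- ps].
Proof.
move=> r_gt r_le WE HE W0 H0 Eps.
have [sz so ad _] := optimum_ok r_gt r_le r_mono WE HE W0 H0 (k := n) (c := (false, 0)) (leqnn n).
rewrite -Eps in sz so ad; have U := chain_uniq so ad.
split=> //; split; first exact: chain_ur so ad.
move=> M' /ur_chain[qs [le so' ad']]; apply: leq_trans le _.
have -> : #|edges_of ps| = size ps.
  rewrite /edges_of -(size_map (fun p : T * T => [set p.1; p.2]) ps) -(card_uniqP U).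
  apply: eq_card => E; apply/imsetP/mapP => -[p Hp ->]; by exists p.
rewrite size_map in sz; rewrite sz /= -(size_map at_pos qs).
exact: (chain_le r_gt r_le r_mono WE HE W0 H0).
Qed.

End Positions.

(** * Breadth-first search *)

Lemma pairwise_const (T : eqType) (r : rel T) s :
  (forall x y, x \in s -> y \in s -> r x y) -> pairwise r s.
Proof.
elim: s => //= x s IH H; rewrite IH ?andbT => [|a b sa sb]; last first.
  by apply: H; rewrite inE ?sa ?sb orbT.
by apply/allP=> y sy; apply: H; rewrite inE ?eqxx ?sy ?orbT.
Qed.

Lemma mem_split (T : eqType) (x : T) s : x \in s -> exists s1 s2, s = s1 ++ x :: s2.
Proof. by case/path.splitPr=> s1 s2; exists s1, s2. Qed.

Section Search.
Variables (T : finType) (e : rel T).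
Hypothesis es : symmetric e.

Definition better (D : T -> nat) (b x : T) : Prop :=
  D x < D b \/ D x = D b /\ #|e b| <= #|e x|.

(** The seeds that become roots, described by the seed list alone; the description therefore does
    not change while the search runs. *)
Definition first_seed (sds : seq T) (x : T) : Prop :=
  exists s1 s2, sds = s1 ++ x :: s2 /\ forall z, z \in s1 -> ~~ connect e z x.

Lemma first_seed_inj sds x y :
  first_seed sds x -> first_seed sds y -> connect e x y -> x = y.
Proof.
move=> [s1 [s2 [E1 H1]]] [t1 [t2 [E2 H2]]] cxy.
have E : s1 ++ x :: s2 = t1 ++ y :: t2 by rewrite -E1.
case: (ltngtP (size s1) (size t1)) => lt.
- have := congr1 (fun s => nth x s (size s1)) E; rewrite !nth_cat ltnn subnn lt /= => Ex.
  by have := H2 x; rewrite Ex mem_nth // -Ex cxy => /(_ isT).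
- have := congr1 (fun s => nth x s (size t1)) E; rewrite !nth_cat ltnn subnn lt /= => Ey.
  by have := H1 y; rewrite -Ey mem_nth // Ey (esymc es) cxy => /(_ isT).
- by move/eqP: E; rewrite eqseq_cat // => /andP[_ /eqP[]].
Qed.

(* State of the search: [P] are the processed vertices, [F] the rest of the queue,
   [lv] the level of the last processed vertex, [used] the seeds examined so far,
   [isb] selects the best vertex of the current component, and [bests] records it
   after each step. *)
Record search (sds : seq T) (D : T -> nat) (P F : seq T) (lv : nat) (used : seq T)
    (isb : T -> Prop) (bests : seq T) : Prop := Search {
  se_uniq : uniq (P ++ F);
  se_vis : forall x, (D x != 0) = (x \in P ++ F);
  se_nbr : forall x y, x \in P -> e x y -> y \in P ++ F /\ D y <= (D x).+1;
  se_sorted : sorted leq (map D (P ++ F));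
  se_old : forall x, x \in P -> D x <= lv;
  se_new : forall x, x \in F -> lv <= D x <= lv.+1;
  se_par : forall x, x \in P ++ F ->
    first_seed sds x \/ exists2 p, p \in P & e p x /\ D x = (D p).+1;
  se_comp : forall x y, x \in P ++ F -> y \in P ++ F -> D x = D y -> connect e x y;
  se_best : F != [::] -> exists2 b, isb b & [/\ b \in P \/ F = [:: b], forall x, x \in F -> connect e b x
     & forall x, x \in P -> connect e b x -> better D b x];
  se_used : forall x, x \in used -> x \in P ++ F;
  se_size : size bests = size P;
  se_bests : forall B1 b B2 P1 x P2, bests = B1 ++ b :: B2 -> P = P1 ++ x :: P2 ->
    size B1 = size P1 ->
    [/\ b \in P, connect e b x & forall y, y \in rcons P1 x -> connect e b y -> better D b y] }.

Lemma search0 sds isb : search sds (fun _ => 0) [::] [::] 0 [::] isb [::].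
Proof. by split=> // -[]. Qed.

Section Steps.
Variables (sds : seq T) (D : T -> nat) (P F : seq T) (lv : nat) (used : seq T).
Variables (isb : T -> Prop) (bests : seq T).

(** With an empty queue the processed vertices form a union of components. *)
Lemma search_closed x y : search sds D P [::] lv used isb bests ->
  x \in P -> connect e x y -> y \in P.
Proof.
move=> S Px /connectP[p]; elim: p x Px => [|z p IH] x Px /=; first by move=> _ ->.
move=> /andP[exz path_p] E; apply: IH path_p E.
by have [] := se_nbr S Px exz; rewrite cats0.
Qed.

Lemma search_skip z isb' : search sds D P [::] lv used isb bests -> z \in P ->
  search sds D P [::] lv (rcons used z) isb' bests.
Proof.
move=> S Pz; have [? ? ? ? ? ? ? ? _ us ? ?] := S; split=> // x.
by rewrite mem_rcons inE cats0 => /predU1P[-> //|/us]; rewrite cats0.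
Qed.

(** The new root is one level above everything seen so far rather than at a fixed level; this keeps
    the levels of different components disjoint and the queue sorted. *)
Lemma search_seed z rest isb' : search sds D P [::] lv used isb bests ->
  z \notin P -> sds = used ++ z :: rest -> isb' z ->
  search sds (fun x => if x == z then lv.+1 else D x) P [:: z] lv (rcons used z) isb' bests.
Proof.
move=> S nPz Es bz; have Px x : x \in P -> (x == z) = false.
  by apply: contraTF => /eqP ->.
have [un vi nb so ol _ pa co _ us si be] := S; rewrite !cats0 in un vi so pa co us nb.
have inz x : (x \in P ++ [:: z]) = (x == z) || (x \in P).
  by rewrite mem_cat inE orbC.
split=> //.
- by rewrite cats1 rcons_uniq nPz.
- by move=> x; rewrite inz; case: (x =P z) => //= _; apply: vi.
- move=> x y xP exy; have [yP le] := nb x y xP exy.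
  by rewrite inz yP orbT (Px _ xP) (Px _ yP).
- rewrite map_cat cats1 /= eqxx (_ : map _ P = map D P); last by apply/eq_in_map=> x /Px ->.
  move: so; case Em: (map D P) => [//|a m] /= pm.
  rewrite rcons_path pm /=; have : last a m \in map D P by rewrite Em mem_last.
  by case/mapP=> x xP ->; apply: leqW; apply: ol.
- by move=> x xP; rewrite Px //; apply: ol.
- by move=> x; rewrite inE => ->; rewrite leqnSn leqnn.
- move=> x; rewrite inz; case: eqP => [-> _|_ /= xP].
    left; exists used, rest; split=> // z' /us zP'; apply: contra nPz.
    exact: search_closed S zP'.
  have [|[p pP [e1 e2]]] := pa x xP; first by left.
  by right; exists p => //; rewrite Px.
- move=> x y; rewrite !inz; case: eqP => [-> _|_ /= xP]; case: eqP => [-> _|_ /= yP].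
  + by rewrite connect0.
  + by move=> E; have := ol _ yP; rewrite -E ltnn.
  + by move=> E; have := ol _ xP; rewrite E ltnn.
  + exact: co.
- move=> _; exists z => //; split=> [|x|x xP].
  + by right.
  + by rewrite inE => /eqP ->; apply: connect0.
  + rewrite (esymc es) => /(search_closed S xP); by rewrite (negbTE nPz).
- move=> x; rewrite mem_rcons inE inz => /predU1P[->|/us ->]; first by rewrite eqxx.
  by rewrite orbT.
- move=> B1 b B2 P1 x P2 E1 E2 E3; have [bP cbx H] := be _ _ _ _ _ _ E1 E2 E3; split=> // y yP.
  have yP' : y \in P by rewrite E2 mem_cat; move: yP; rewrite mem_rcons !inE => /predU1P[->|->];
    rewrite ?eqxx ?orbT.
  by rewrite /better !Px //; apply: H.
Qed.

Definition fresh (s : seq T) (l : seq T) := [seq w <- l | w \notin s].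

(** Levels along the queue never decrease, so u is at least as deep as the current best vertex;
    comparing levels for equality and then degrees keeps the best one. *)
Lemma search_pop u l b isb' :
  search sds D P (u :: F) lv used isb bests -> uniq l -> (forall w, (w \in l) = e u w) ->
  (forall b0, isb b0 -> b = if (D u == D b0) && (#|e b0| <= #|e u|) then b0 else u) ->
  isb' b ->
  search sds (fun x => if x \in fresh (P ++ u :: F) l then (D u).+1 else D x)
    (rcons P u) (F ++ fresh (P ++ u :: F) l) (D u) used isb' (rcons bests b).
Proof.
move=> S ul le Hb bb; set new := fresh _ _.
have [un vi nb so ol ne pa co be us si bs] := S.
have memQ x : (x \in rcons P u ++ F ++ new) = (x \in P ++ u :: F) || (x \in new).
  by rewrite cat_rcons -cat_cons catA mem_cat.
have newN x : x \in new -> x \notin P ++ u :: F by rewrite mem_filter => /andP[].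
have old x : x \in P ++ u :: F -> (x \in new) = false.
  by move=> H; apply: contraTF H; apply: newN.
have uQ : u \in P ++ u :: F by rewrite mem_cat inE eqxx orbT.
have oldP x : x \in P -> x \in P ++ u :: F by rewrite mem_cat => ->.
have oldF x : x \in F -> x \in P ++ u :: F by rewrite mem_cat inE => ->; rewrite !orbT.
have newE x : x \in new -> e u x by rewrite mem_filter => /andP[_]; rewrite le.
have [lu1 lu2] : lv <= D u /\ D u <= lv.+1 by apply/andP; apply: ne; rewrite inE eqxx.
have so_cat : pairwise leq (map D P ++ D u :: map D F).
  by rewrite -(sorted_pairwise leq_trans) -(map_cat D P (u :: F)).
have [Du_le le_Du] : (forall x, x \in P -> D x <= D u) /\ (forall x, x \in F -> D u <= D x).
  move: so_cat; rewrite pairwise_cat => /and3P[/allrelP al _ /= /andP[/allP al2 _]].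
  split=> x xP; last by apply: al2; apply: map_f.
  by apply: al; rewrite ?map_f // inE eqxx.
have F_le x : x \in F -> D x <= (D u).+1.
  move=> xF; have /andP[_ H] : lv <= D x <= lv.+1 by apply: ne; rewrite inE xF orbT.
  by apply: leq_trans H _.
have [b0 ib0 [b0Q b0F b0P]] := be isT.
have cbu : connect e b0 u by apply: b0F; rewrite inE eqxx.
have b0Pu : b0 \in rcons P u.
  by rewrite mem_rcons inE; case: b0Q => [->|[->]]; rewrite ?eqxx ?orbT.
have Db0 : D b0 <= D u.
  by move: b0Pu; rewrite mem_rcons inE => /predU1P[-> //|/Du_le].
have bbu : [/\ b \in rcons P u, connect e b u & forall y, y \in rcons P u -> connect e b y -> better D b y].
  rewrite (Hb _ ib0); case: ifPn => [/andP[/eqP ED dg]|cond].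
    split=> // y; rewrite mem_rcons inE => /predU1P[-> _|]; [by right | exact: b0P].
  split; [by rewrite mem_rcons inE eqxx | by apply: connect0 |].
  move=> y; rewrite mem_rcons inE => /predU1P[-> _|yP cuy]; first by right.
  rewrite /better; have [lt|[E dg]] := b0P y yP (connect_trans cbu cuy); first by left; apply: leq_trans Db0.
  move: Db0; rewrite leq_eqVlt -E => /predU1P[Eu|]; last by left.
  right; split=> //; rewrite -Eu E eqxx /= -ltnNge in cond.
  exact: leq_trans (ltnW cond) dg.
have oldPu x : x \in rcons P u -> (x \in new) = false.
  by rewrite mem_rcons inE => /predU1P[->|/oldP]; [apply: old | apply: old].
have [bPu cbu' bb_u] := bbu.
split.
- rewrite cat_rcons -cat_cons catA cat_uniq un filter_uniq // andbT.
  by apply/hasPn=> x /newN.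
- move=> x; rewrite memQ; case: (boolP (x \in new)) => [_|_]; first by rewrite orbT.
  by rewrite orbF vi.
- move=> x y; rewrite mem_rcons inE memQ => /predU1P[->|xP] exy.
    rewrite (old u uQ); case: ifP => Hy; first by rewrite orbT.
    have yQ : y \in P ++ u :: F.
      by apply: contraFT Hy => nyQ; rewrite mem_filter nyQ le.
    split; first by rewrite yQ.
    by move: yQ; rewrite mem_cat inE => /or3P[/Du_le/leqW|/eqP->|/F_le].
  have [yQ le1] := nb x y xP exy; by rewrite yQ (old y yQ) (old x (oldP x xP)).
- rewrite cat_rcons -cat_cons catA map_cat (sorted_pairwise leq_trans) pairwise_cat.
  rewrite (_ : map _ (P ++ u :: F) = map D (P ++ u :: F)); last first.
    by apply/eq_in_map=> x /old ->.
  rewrite -(sorted_pairwise leq_trans) so /=; apply/andP; split.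
    apply/allrelP=> _ _ /mapP[x xQ ->] /mapP[y yn ->]; rewrite yn.
    by move: xQ; rewrite mem_cat inE => /or3P[/Du_le/leqW|/eqP->|/F_le].
  by apply: pairwise_const => _ _ /mapP[x xn ->] /mapP[y yn ->]; rewrite xn yn.
- by move=> x xP; rewrite oldPu //; move: xP; rewrite mem_rcons inE => /predU1P[->|/Du_le].
- move=> x; rewrite mem_cat; case: (boolP (x \in new)) => [_ _|_]; first by rewrite leqnSn leqnn.
  by rewrite orbF => xF; rewrite le_Du // F_le.
- move=> x; rewrite memQ; case: (boolP (x \in new)) => [xn _|_].
    right; exists u; first by rewrite mem_rcons inE eqxx.
    by rewrite (old u uQ) newE.
  rewrite orbF => /pa[|[p pP [e1 e2]]]; first by left.
  by right; exists p; rewrite ?(old p (oldP p pP)) // mem_rcons inE pP orbT.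
(* An old vertex one level below u must still be queued, and everything queued is connected to the
   current best vertex. *)
- have lvl x y : x \in new -> y \in P ++ u :: F -> D y = (D u).+1 -> connect e x y.
    move=> xn; rewrite mem_cat inE => /or3P[/Du_le H|/eqP->|yF] E;
      [by rewrite E ltnn in H | by case: (n_Sn _ E) |].
    apply: connect_trans (connect_trans _ (b0F y _)); last by rewrite inE yF orbT.
      by rewrite (esymc es); apply: connect1 (newE _ xn).
    by rewrite (esymc es).
  move=> x y; rewrite !memQ; case: (boolP (x \in new)) => xn; case: (boolP (y \in new)) => yn;
    rewrite ?orbF => xQ yQ E.
  + by apply: connect_trans (connect1 (newE _ yn)); rewrite (esymc es) connect1 // newE.
  + by apply: lvl.
  + by rewrite (esymc es); apply: lvl.
  + exact: co.
- move=> _; exists b => //; split=> [|x|x xP cbx].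
  + by left.
  + rewrite mem_cat => /orP[xF|xn]; last exact: connect_trans cbu' (connect1 (newE _ xn)).
    apply: connect_trans cbu' (connect_trans _ (b0F x _)); last by rewrite inE xF orbT.
    by rewrite (esymc es).
  + by rewrite /better !oldPu //; apply: bb_u.
- by move=> x /us xQ; rewrite memQ xQ.
- by rewrite !size_rcons si.
- move=> B1 c B2 P1 x P2.
  (* The entry in question is the one just appended or an older one; counting lengths excludes the
     mixed cases. *)
  case/lastP: P2 => [|P2 x'] E1 E2 E3.
    move: E2; rewrite cats1 => /rcons_inj[E4 E5]; subst P1 x.
    have EB : B2 = [::].
      apply: size0nil; move: (congr1 size E1); rewrite size_rcons size_cat /= si E3; clear; lia.
    move: E1; rewrite EB cats1 => /rcons_inj[_ E6]; subst c.
    by split=> // y yP cby; rewrite /better !oldPu //; apply: bb_u.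
  move: E2; rewrite -rcons_cons -rcons_cat => /rcons_inj[E4 E5].
  case/lastP: B2 E1 => [|B2 c'] E1.
    move: (congr1 size E1); rewrite size_rcons size_cat /= si E4 size_cat /= E3; clear; lia.
  move: E1; rewrite -rcons_cons -rcons_cat => /rcons_inj[E6 E7].
  have [cP ccx H] := bs _ _ _ _ _ _ E6 E4 E3; split=> //.
    by rewrite mem_rcons inE cP orbT.
  move=> y yP ccy.
  have yP' : y \in P.
    by rewrite E4 mem_cat; move: yP; rewrite mem_rcons !inE => /predU1P[->|->]; rewrite ?eqxx ?orbT.
  by rewrite /better !(old _ (oldP _ _)) //; apply: H.
Qed.

End Steps.

Lemma search_stuck sds D P lv used isb bests :
  (forall x, exists2 z, z \in sds & connect e z x) ->
  search sds D P [::] lv used isb bests -> {subset sds <= used} -> forall x, x \in P.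
Proof.
move=> cover S sub x; have [z zs czx] := cover x.
apply: (search_closed S _ czx); have := se_used S (sub _ zs); by rewrite cats0.
Qed.

Section Final.
Variables (sds : seq T) (D : T -> nat) (P : seq T) (lv : nat) (used : seq T).
Variables (isb : T -> Prop) (bests : seq T).
Hypotheses (S : search sds D P [::] lv used isb bests) (PT : forall x, x \in P).

Lemma search_layering : layering e D (first_seed sds).
Proof.
have [_ _ nb _ _ _ pa co _ _ _ _] := S; rewrite cats0 in pa co; split.
- by move=> x y /(nb x y (PT x))[].
- by move=> x; have [|[p _ [e1 e2]]] := pa x (PT x); [left|right; exists p].
- exact: first_seed_inj.
- by move=> x y; apply: co.
Qed.

(** A first seed of the reversed list is the last entry recorded for its component. Had z been
    processed after that entry was made, the entry made for z would be a later one in the same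
    component. *)
Lemma bests_better r z : first_seed (rev bests) r -> connect e r z -> better D r z.
Proof.
move=> [s1 [s2 [Er Hr]]] crz.
have Eb : bests = rev s2 ++ r :: rev s1.
  by rewrite -[bests]revK Er rev_cat rev_cons cat_rcons.
have split_at i : i < size P -> exists P1 x P2, P = P1 ++ x :: P2 /\ size P1 = i.
  move=> lt; exists (take i P), (nth r P i), (drop i.+1 P).
  by rewrite -drop_nth // cat_take_drop size_take lt.
have [|P1 [x [P2 [EP sP1]]]] := split_at (size (rev s2)).
  by rewrite -(se_size S) Eb size_cat /= -addn1 leq_add2l.
have [_ crx H] := se_bests S Eb EP (esym sP1).
have : z \in rcons P1 x ++ P2 by rewrite cat_rcons -EP.
rewrite mem_cat => /orP[zP|zP2]; first exact: H.
have [P3 [P4 EP2]] := mem_split zP2.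
set i := size P3.
have lt : i < size (rev s1).
  have := se_size S; rewrite Eb EP EP2 !size_cat /= size_cat /= sP1 /i; set p3 := size P3; lia.
have Es1 : rev s1 = take i (rev s1) ++ nth r (rev s1) i :: drop i.+1 (rev s1).
  by rewrite -drop_nth // cat_take_drop.
set b := nth r (rev s1) i in Es1.
have Eb2 : bests = (rev s2 ++ r :: take i (rev s1)) ++ b :: drop i.+1 (rev s1).
  by rewrite Eb {1}Es1 -catA.
have EP3 : P = (P1 ++ x :: P3) ++ z :: P4 by rewrite EP EP2 -catA.
have sz : size (rev s2 ++ r :: take i (rev s1)) = size (P1 ++ x :: P3).
  by rewrite !size_cat /= size_take lt sP1.
have [_ cbz _] := se_bests S Eb2 EP3 sz.
have := Hr b; rewrite -mem_rev mem_nth // => /(_ isT) /negP[].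
by apply: connect_trans cbz _; rewrite (esymc es).
Qed.

Lemma bests_cover x : exists2 z, z \in rev bests & connect e z x.
Proof.
have [P1 [P2 EP]] := mem_split (PT x).
set i := size P1; have lt : i < size bests.
  by rewrite (se_size S) EP size_cat addnS ltnS leq_addr.
have Eb : bests = take i bests ++ nth x bests i :: drop i.+1 bests.
  by rewrite -drop_nth // cat_take_drop.
have [|_ c _] := se_bests S Eb EP; first by rewrite size_take lt.
by exists (nth x bests i); rewrite // mem_rev mem_nth.
Qed.

End Final.
End Search.

(** * The algorithm *)

Fixpoint puts (k : nat) (c : acom) : bool :=
  match c with
  | APut j _ _ => j == k
  | ASeq a b | AIf _ a b => puts k a || puts k b
  | AFor _ _ a => puts k a
  | _ => false
  end.

Fixpoint asgs (x : nat) (c : acom) : bool :=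
  match c with
  | AAsg y _ => y == x
  | ASeq a b | AIf _ a b => asgs x a || asgs x b
  | AFor y _ a => (y == x) || asgs x a
  | _ => false
  end.

Lemma putsN c s k i : ~~ puts k c -> arr (aden c s) k i = arr s k i.
Proof.
elim: c s => //= [j a e|a IHa b IHb|e a IHa b IHb|y e a IHa] s.
- by rewrite /aupd eq_sym => /negbTE ->.
- by rewrite negb_or => /andP[/IHa Ha /IHb ->].
- by rewrite negb_or => /andP[/IHa Ha /IHb Hb]; case: ifP.
- move=> /IHa Ha; apply: (loop_ind (I := fun _ s' => arr s' k i = arr s k i)) => // j s' _ <-.
  by rewrite Ha.
Qed.

Lemma asgsN c s x : ~~ asgs x c -> avar (aden c s) x = avar s x.
Proof.
elim: c s => //= [y e|a IHa b IHb|e a IHa b IHb|y e a IHa] s.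
- by rewrite /upd eq_sym => /negbTE ->.
- by rewrite negb_or => /andP[/IHa Ha /IHb ->].
- by rewrite negb_or => /andP[/IHa Ha /IHb Hb]; case: ifP.
- rewrite negb_or => /andP[yx /IHa Ha].
  apply: (loop_ind (I := fun _ s' => avar s' x = avar s x)) => [j s' _ <-|].
    by rewrite Ha /= /upd eq_sym (negbTE yx).
  by rewrite /= /upd eq_sym (negbTE yx).
Qed.

(** Loops count down while lists are read from the left. The invariant is indexed by the prefix
    already read, and programs keep an ascending index of their own. *)
Lemma loop_list (T S : Type) (f : T -> T) set (I : seq S -> T -> Prop) l s :
  (forall l1 w l2 t, l = l1 ++ w :: l2 -> I l1 t -> I (rcons l1 w) (f (set t (size l2)))) ->
  I [::] s -> I l (loop f set (size l) s).
Proof.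
move=> H; suff G l2 l1 t : l = l1 ++ l2 -> I l1 t -> I l (loop f set (size l2) t) by apply: G.
elim: l2 l1 t => [|w l2 IH] l1 t E I1 /=; first by rewrite E cats0.
by apply: (IH (rcons l1 w)); [rewrite cat_rcons | apply: H E I1].
Qed.

Lemma afor_ind (I : nat -> ast -> Prop) k x e c s :
  aeval e s = k -> I k (aset s x k) ->
  (forall j t, j < k -> I j.+1 t -> I j (aden c (aset t x j))) ->
  I 0 (aden (AFor x e c) s).
Proof. by move=> /= -> H0 H; apply: loop_ind H0. Qed.

Lemma afor_list (S : Type) (I : seq S -> ast -> Prop) l x e c s :
  aeval e s = size l -> I [::] (aset s x (size l)) ->
  (forall l1 w l2 t, l = l1 ++ w :: l2 -> I l1 t -> I (rcons l1 w) (aden c (aset t x (size l2)))) ->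
  I l (aden (AFor x e c) s).
Proof. by move=> /= -> H0 H; apply: loop_list H0. Qed.

Lemma aseqE a b s : aden (ASeq a b) s = aden b (aden a s). Proof. by []. Qed.

Declare Scope prog_scope.
Delimit Scope prog_scope with P.
Notation "! x" := (AVar x) (at level 9, x at level 9, format "! x") : prog_scope.
Notation "# k" := (ACst k) (at level 9, k at level 9, format "# k") : prog_scope.
Notation "a + b" := (AAdd a b) : prog_scope.
Notation "a - b" := (ASub a b) : prog_scope.
Notation "k @[ i ]" := (AGet k i) (at level 9, format "k @[ i ]") : prog_scope.
Notation "x ::= e" := (AAsg x e) (at level 80) : prog_scope.
Notation "k $[ i ] ::= e" := (APut k i e) (at level 80) : prog_scope.
Notation "a ;; b" := (ASeq a b) (at level 90, right associativity) : prog_scope.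
Notation "'IF' e 'THEN' a 'ELSE' b" := (AIf e a b) (at level 85) : prog_scope.
Notation "'FOR' x 'OF' e 'DO' a" := (AFor x e a) (at level 85) : prog_scope.


Notation vN := 0 (only parsing).
Notation vI := 1 (only parsing).
Notation vX := 2 (only parsing).
Notation vY := 3 (only parsing).
Notation vHd := 4 (only parsing).
Notation vTl := 5 (only parsing).
Notation vPt := 6 (only parsing).
Notation vLv := 7 (only parsing).
Notation vBs := 8 (only parsing).
Notation vU := 9 (only parsing).
Notation vD := 10 (only parsing).
Notation vO := 11 (only parsing).
Notation vW := 12 (only parsing).
Notation vC := 13 (only parsing).
Notation vM := 14 (only parsing).

(* [aUpto] maps a level to the number of vertices of at most that level, [aVert] and
   [aPos] map a position to the vertex there and to its reach. *)
Notation aIn := 0 (only parsing).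
Notation aOff := 1 (only parsing).
Notation aSeed := 2 (only parsing).
Notation aLev := 3 (only parsing).
Notation aQueue := 4 (only parsing).
Notation aBest := 5 (only parsing).
Notation aUpto := 6 (only parsing).
Notation aReach := 7 (only parsing).
Notation aKey := 8 (only parsing).
Notation aCnt := 9 (only parsing).
Notation aVert := 10 (only parsing).
Notation aPos := 11 (only parsing).
Notation aW := 12 (only parsing).
Notation aH := 13 (only parsing).
Notation aOut := 14 (only parsing).

Local Open Scope prog_scope.

(** [aOff] points at the degree cell of a block; the neighbours follow it, so the next block is one
    more than the degree away. *)
Definition offsets_body :=
  aOff$[!vI] ::= !vO ;;
  vO ::= !vO + aIn@[!vO] + #1 ;;
  vI ::= !vI + #1.

Definition offsets :=
  vN ::= aIn@[#0] ;; vI ::= #0 ;; vO ::= #1 ;; FOR vX OF !vN DO offsets_body.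

Definition seeds_body := aSeed$[!vX] ::= !vX.

Definition initial_seeds := FOR vX OF !vN DO seeds_body.

Definition scan_body :=
  vO ::= !vO + #1 ;;
  vW ::= aIn@[!vO] ;;
  IF aLev@[!vW] THEN ASkip ELSE
    (aLev$[!vW] ::= !vD + #1 ;; aQueue$[!vTl] ::= !vW ;; vTl ::= !vTl + #1).

Definition deg_of x := aIn@[aOff@[x]].

Definition pop_head :=
  vU ::= aQueue@[!vHd] ;;
  vD ::= aLev@[!vU] ;;
  (IF !vD - aLev@[!vBs] THEN vBs ::= !vU
   ELSE IF deg_of !vBs - deg_of !vU THEN vBs ::= !vU ELSE ASkip) ;;
  aBest$[!vHd] ::= !vBs ;;
  vHd ::= !vHd + #1 ;;
  vLv ::= !vD ;;
  vO ::= aOff@[!vU].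

Definition pop := pop_head ;; FOR vY OF aIn@[!vO] DO scan_body.

Definition seed :=
  vU ::= aSeed@[!vPt] ;;
  vPt ::= !vPt + #1 ;;
  IF aLev@[!vU] THEN ASkip ELSE
    (aLev$[!vU] ::= !vLv + #1 ;; aQueue$[!vTl] ::= !vU ;; vTl ::= !vTl + #1 ;;
     vBs ::= !vU).

Definition bfs_init := vHd ::= #0 ;; vTl ::= #0 ;; vPt ::= #0 ;; vLv ::= #0.

Definition bfs_body := IF !vTl - !vHd THEN pop ELSE seed.

(* Each of the 2n rounds processes a vertex or consumes a seed.  Levels start at 1,
   0 marks the vertices not reached yet. *)
Definition bfs := bfs_init ;; FOR vX OF !vN + !vN DO bfs_body.

(** Reversing puts the final choice of each component before its provisional ones, so exactly the
    final choices become roots of the second search. *)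
Definition reset_body :=
  aSeed$[!vN - #1 - !vX] ::= aBest@[!vX] ;; aLev$[!vX] ::= #0.

Definition reset := FOR vX OF !vN DO reset_body.

(** The queue is sorted by level, so the last write for a level leaves the number of vertices of at
    most that level. *)
Definition ends_body :=
  aUpto$[aLev@[aQueue@[!vI]]] ::= !vI + #1 ;; vI ::= !vI + #1.

Definition level_ends := vI ::= #0 ;; FOR vX OF !vN DO ends_body.

Definition count_next :=
  vO ::= !vO + #1 ;;
  IF aLev@[aIn@[!vO]] - !vD THEN vC ::= !vC + #1 ELSE ASkip.

Definition reach_head :=
  vU ::= aOff@[!vX] ;; vO ::= !vU ;; vD ::= aLev@[!vX] ;; vC ::= aUpto@[!vD].

Definition reach_tail :=
  aReach$[!vX] ::= !vC ;;
  vW ::= !vC + (!vC - aIn@[!vU]) ;;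
  aKey$[!vX] ::= !vW ;;
  aCnt$[!vW] ::= aCnt@[!vW] + #1.

Definition reaches :=
  FOR vX OF !vN DO
    (reach_head ;; (FOR vY OF aIn@[!vU] DO count_next) ;; reach_tail).

Definition sums_body :=
  vW ::= aCnt@[!vI] ;; aCnt$[!vI] ::= !vC ;; vC ::= !vC + !vW ;; vI ::= !vI + #1.

(** Keys range over 0, ..., 2n, hence 2n + 1 rounds. *)
Definition prefix_sums :=
  vI ::= #0 ;; vC ::= #0 ;; FOR vX OF !vN + !vN + #1 DO sums_body.

Definition placement_body :=
  vW ::= aKey@[!vX] ;; vC ::= aCnt@[!vW] ;;
  aVert$[!vC] ::= !vX ;; aPos$[!vC] ::= aReach@[!vX] ;; aCnt$[!vW] ::= !vC + #1.

Definition placement := FOR vX OF !vN DO placement_body.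

(* [maxn a b = a + (b - a)] *)
Definition succ_max a b := a + (b - a) + #1.

Definition dp_W :=
  IF aPos@[!vX] - (!vX + #1)
  THEN aW$[!vX] ::= succ_max (aW@[aPos@[!vX]]) (aH@[!vX + #1])
  ELSE aW$[!vX] ::= aW@[!vX + #1].

Definition dp_H :=
  IF aPos@[!vX] - (!vX + #1)
  THEN IF aPos@[!vX + #1] - aPos@[!vX]
       THEN aH$[!vX] ::= succ_max (aW@[aPos@[!vX + #1]]) (aH@[aPos@[!vX]])
       ELSE aH$[!vX] ::= aH@[!vX + #1]
  ELSE aH$[!vX] ::= aW@[!vX + #1].

Definition dp_body := dp_W ;; dp_H.

Definition dp := FOR vX OF !vN DO dp_body.

Definition emit i j :=
  aOut$[!vC + !vC + #1] ::= aVert@[i] ;; aOut$[!vC + !vC + #2] ::= aVert@[j] ;;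
  vC ::= !vC + #1.

(** Together with [trace_H] this is [ostep], with flag [vM] and position [vI]. *)
Definition trace_W :=
  IF aPos@[!vI] - (!vI + #1) THEN
    (emit !vI (!vI + #1) ;;
     IF aH@[!vI + #1] - aW@[aPos@[!vI]]
     THEN (vM ::= #1 ;; vI ::= !vI + #1)
     ELSE vI ::= aPos@[!vI])
  ELSE vI ::= !vI + #1.

Definition trace_H :=
  IF aPos@[!vI] - (!vI + #1) THEN
    (IF aPos@[!vI + #1] - aPos@[!vI] THEN
       (emit (!vI + #1) (aPos@[!vI]) ;;
        IF aH@[aPos@[!vI]] - aW@[aPos@[!vI + #1]]
        THEN vI ::= aPos@[!vI]
        ELSE (vM ::= #0 ;; vI ::= aPos@[!vI + #1]))
     ELSE vI ::= !vI + #1)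
  ELSE (vM ::= #0 ;; vI ::= !vI + #1).

Definition trace_body :=
  IF !vN - !vI THEN (IF !vM THEN trace_H ELSE trace_W) ELSE ASkip.

Definition trace :=
  vM ::= #0 ;; vI ::= #0 ;; vC ::= #0 ;;
  (FOR vX OF !vN DO trace_body) ;;
  aOut$[#0] ::= !vC.

Definition ur_program :=
  offsets ;; initial_seeds ;; bfs ;; reset ;; bfs ;; level_ends ;; reaches ;;
  prefix_sums ;; placement ;; dp ;; trace.

Local Close Scope prog_scope.

Lemma ur_program_wf : acom_wf ur_program && wf (tr ur_program).
Proof. by []. Qed.

(** * Adjacency lists in memory *)

Section Encoding.
Variables (n : nat) (adj : 'I_n -> seq 'I_n).

Definition blocks := [seq size (adj i) :: [seq nat_of_ord j | j <- adj i] | i <- enum 'I_n].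

Definition offset (u : nat) := (size (flatten (take u blocks))).+1.

Lemma size_blocks : size blocks = n.
Proof. by rewrite size_map size_enum_ord. Qed.

Lemma nth_blocks (u : 'I_n) :
  nth [::] blocks u = size (adj u) :: [seq nat_of_ord j | j <- adj u].
Proof. by rewrite (nth_map u) ?size_enum_ord // nth_ord_enum. Qed.

Lemma encodeE (u : 'I_n) :
  encode_adj adj = (n :: flatten (take u blocks)) ++
    (size (adj u) :: [seq nat_of_ord j | j <- adj u]) ++ flatten (drop u.+1 blocks).
Proof.
rewrite /encode_adj -/blocks cat_cons; congr (_ :: _).
by rewrite -{1}(cat_take_drop u blocks) flatten_cat (drop_nth [::]) ?size_blocks // nth_blocks.
Qed.

Lemma nth_encode (u : 'I_n) j : j < (size (adj u)).+1 ->
  nth 0 (encode_adj adj) (offset u + j) =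
  nth 0 (size (adj u) :: [seq nat_of_ord j | j <- adj u]) j.
Proof.
move=> lt; rewrite (encodeE u) nth_cat /= ltnNge leq_addr /= addKn.
by rewrite -cat_cons nth_cat /= size_map lt.
Qed.

Lemma offsetS (u : 'I_n) : offset u.+1 = offset u + size (adj u) + 1.
Proof.
rewrite /offset (take_nth [::]) ?size_blocks // nth_blocks flatten_rcons size_cat /= size_map.
by rewrite addnS addn1.
Qed.

Lemma offset_n : offset n = size (encode_adj adj).
Proof. by rewrite /offset -{1}size_blocks take_size. Qed.

Lemma size_encode : size (encode_adj adj) = adj_size adj + 1.
Proof.
rewrite /encode_adj /= size_flatten /shape -map_comp /adj_size sumnE big_map.
rewrite big_enum /= (eq_bigr (fun i => size (adj i) + 1)); last first.
  by move=> i _ /=; rewrite size_map addn1.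
by rewrite big_split /= sum_nat_const card_ord muln1 addnC addn1 addnC.
Qed.

Definition loaded (s : ast) : Prop :=
  avar s vN = n /\ forall u : 'I_n,
    arr s aIn (arr s aOff u) = size (adj u) /\
    forall j, j < size (adj u) ->
      arr s aIn ((arr s aOff u).+1 + j) = nth 0 [seq nat_of_ord j | j <- adj u] j.

Lemma loaded_frame c s :
  ~~ puts aIn c -> ~~ puts aOff c -> ~~ asgs vN c -> loaded s -> loaded (aden c s).
Proof.
move=> H1 H2 H3 [L1 L2]; split; first by rewrite asgsN.
move=> u; have [L3 L4] := L2 u; rewrite !(putsN _ _ H1) !(putsN _ _ H2); split=> // j lt.
by rewrite !(putsN _ _ H1) L4.
Qed.

Lemma offsets_ok s : (forall i, arr s aIn i = nth 0 (encode_adj adj) i) ->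
  loaded (aden offsets s).
Proof.
move=> Hin.
rewrite /offsets !aseqE; set s1 := aden _ (aden _ (aden _ s)).
pose I k t := [/\ avar t vN = n, forall i, arr t aIn i = nth 0 (encode_adj adj) i,
     avar t vI = n - k, avar t vO = offset (n - k) &
     forall u, u < n - k -> arr t aOff u = offset u].
have [] : I 0 (aden (AFor vX (AVar vN) offsets_body) s1).
  have V1 : aeval (AVar vN) s1 = n by rewrite /s1 /= /upd /= Hin.
  apply: (afor_ind V1).
  - by rewrite /I /s1 /= /upd /= subnn Hin /offset take0; split.
  - move=> k t lt [H1 H2 H3 H4 H5].
    have Ek : n - k = (n - k.+1).+1 by rewrite subnSK.
    have lt' : n - k.+1 < n by rewrite -Ek leq_subr.
    rewrite /I /offsets_body /= /upd /aupd /= H1 H3 H4 Ek; split=> //; first by rewrite addn1.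
      have := nth_encode (u := Ordinal lt') (ltn0Sn _); rewrite addn0 H2 => ->.
      by rewrite (offsetS (Ordinal lt')).
    move=> u; rewrite ltnS leq_eqVlt => /predU1P[->|lu]; first by rewrite eqxx.
    by rewrite ltn_eqF // H5.
move=> H1 H2 _ _; rewrite subn0 => H5; split=> // u; rewrite !H5 //; split=> [|j lt].
  by rewrite H2 -[offset u]addn0 nth_encode.
by rewrite H2 addSn -addnS nth_encode.
Qed.

End Encoding.

(** * Correctness and cost of the search *)

Section Bfs.
Variables (n : nat) (e : rel 'I_n) (adj : 'I_n -> seq 'I_n).
Hypotheses (es : symmetric e) (adj_uniq : forall i, uniq (adj i))
  (adjE : forall i j, (j \in adj i) = e i j).

Definition is_arr (f : nat -> nat) (l : seq 'I_n) : Prop :=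
  forall i, i < size l -> f i = nth 0 [seq nat_of_ord j | j <- l] i.

Lemma is_arr_rcons f l w :
  is_arr f l -> is_arr (fun i => if i == size l then nat_of_ord w else f i) (rcons l w).
Proof.
move=> H i; rewrite size_rcons map_rcons nth_rcons size_map ltnS leq_eqVlt => /predU1P[->|lt].
  by rewrite eqxx ltnn.
by rewrite lt ltn_eqF // H.
Qed.

Lemma is_arr_nth f l1 w l2 : is_arr f (l1 ++ w :: l2) -> f (size l1) = w.
Proof.
move=> H; rewrite H ?size_cat /= ?addnS ?ltnS ?leq_addr //.
by rewrite map_cat nth_cat size_map ltnn subnn.
Qed.

Lemma fresh_rcons (T : finType) (Q l : seq T) w :
  fresh Q (rcons l w) = if w \in Q then fresh Q l else rcons (fresh Q l) w.
Proof. by rewrite /fresh filter_rcons; case: (w \in Q). Qed.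

Lemma scan_ok s (u : 'I_n) Q :
  loaded adj s -> avar s vO = arr s aOff u -> avar s vTl = size Q ->
  is_arr (arr s aQueue) Q -> (forall x : 'I_n, (arr s aLev x != 0) = (x \in Q)) ->
  let s' := aden (AFor vY (AGet aIn (AVar vO)) scan_body) s in
  [/\ avar s' vTl = size (Q ++ fresh Q (adj u)),
      is_arr (arr s' aQueue) (Q ++ fresh Q (adj u)) &
      forall x : 'I_n, arr s' aLev x =
        if x \in fresh Q (adj u) then (avar s vD).+1 else arr s aLev x].
Proof.
move=> [_ L] HO HT HQ HD s'.
have [L1 L2] := L u.
pose I (l : seq 'I_n) t := [/\ avar t vTl = size (Q ++ fresh Q l),
  is_arr (arr t aQueue) (Q ++ fresh Q l),
  forall x : 'I_n, arr t aLev x = if x \in fresh Q l then (avar s vD).+1 else arr s aLev x,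
  avar t vO = avar s vO + size l /\ avar t vD = avar s vD
  & forall i, arr t aIn i = arr s aIn i].
suff [] : I (adj u) s' by split.
have V : aeval (AGet aIn (AVar vO)) s = size (adj u) by rewrite /= HO L1.
apply: (afor_list V) => [|l1 w l2 t El [H1 H2 H3 [H4 H5] H6]].
  by rewrite /I /= /upd /= cats0 addn0; split.
have w_in : arr t aIn (avar t vO + 1) = w.
  rewrite H6 H4 HO addn1 -addSn L2 El ?map_cat ?nth_cat ?size_cat /= ?addnS ?ltnS ?leq_addr //.
  by rewrite size_map ltnn subnn.
(* Adjacency lists have no repetitions, so marks set during this scan do not affect the test for
   w. *)
have wl1 : w \notin l1.
  by have := adj_uniq u; rewrite El -cat_rcons cat_uniq rcons_uniq => /andP[/andP[]].
have Dw : (arr t aLev w != 0) = (w \in Q).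
  by rewrite H3 mem_filter (negbTE wl1) andbF HD.
rewrite /I /scan_body /= /upd /aupd /= w_in.
rewrite Dw !fresh_rcons size_rcons; case: ifP => wQ /=.
  by split=> //; rewrite H4 addn1 addnS.
rewrite H1 -rcons_cat size_rcons !addn1 H4 H5 addnS; split=> //.
- exact: is_arr_rcons.
- by move=> x; rewrite mem_rcons inE H3 -(inj_eq val_inj); case: (_ == _ :> nat).
Qed.

Lemma deg_of_ok s (u : 'I_n) x : loaded adj s -> aeval x s = u -> aeval (deg_of x) s = #|e u|.
Proof.
move=> [_ /(_ u)[L _]] /= ->; rewrite L -(card_uniqP (adj_uniq u)).
by apply: eq_card => j; rewrite adjE.
Qed.

Definition level (s : ast) (x : 'I_n) := arr s aLev x.
(** A relation, because [vBs] need not hold any meaningful vertex while the queue is empty. *)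
Definition is_best (s : ast) (b : 'I_n) := avar s vBs = b.

Lemma pop_ok s (sds P : seq 'I_n) (u : 'I_n) (F used bests : seq 'I_n) :
  loaded adj s -> avar s vHd = size P -> avar s vTl = size (P ++ u :: F) ->
  is_arr (arr s aQueue) (P ++ u :: F) -> is_arr (arr s aBest) bests ->
  search e sds (level s) P (u :: F) (avar s vLv) used (is_best s) bests ->
  let s' := aden pop s in
  exists F' b, [/\ avar s' vHd = size (rcons P u), avar s' vTl = size (rcons P u ++ F'),
    is_arr (arr s' aQueue) (rcons P u ++ F'), is_arr (arr s' aBest) (rcons bests b) &
    search e sds (level s') (rcons P u) F' (avar s' vLv) used (is_best s') (rcons bests b)]
  /\ atime pop s <= atime pop_head s + (amax scan_body + 4) * size (adj u) + 20.
Proof.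
move=> L HH HT HQ HB S s'.
have Qu : arr s aQueue (size P) = u by apply: is_arr_nth HQ.
have [b0 ib0 [b0Q b0F b0P]] := se_best S isT.
pose b := if (level s u == level s b0) && (#|e b0| <= #|e u|) then b0 else u.
set s1 := aden pop_head s.
have sB : size bests = size P := se_size S.
have Db0 : level s b0 <= level s u.
  have := se_sorted S; rewrite (sorted_pairwise leq_trans) map_cat pairwise_cat.
  case/and3P=> /allrelP al _ _; case: b0Q => [b0P'|[-> _]] //.
  by apply: al; rewrite ?map_f //= inE eqxx.
have degE (x : 'I_n) : arr s aIn (arr s aOff x) = #|e x| by apply: (deg_of_ok (x := ACst x) L).
have ib0' : avar s vBs = b0 := ib0.
have s1E : avar s1 vBs = b /\ [/\ avar s1 vHd = (size P).+1, avar s1 vLv = level s u,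
   avar s1 vD = level s u & avar s1 vO = arr s aOff u] /\
   avar s1 vTl = avar s vTl /\ arr s1 = aupd (arr s) aBest (size P) b.
  rewrite /s1 /pop_head /= /upd /= HH Qu ib0' !degE /b /level /=.
  have -> : (arr s aLev u - arr s aLev b0 != 0) = (arr s aLev u != arr s aLev b0).
    by move: Db0; rewrite /level leq_eqVlt => /predU1P[->|lt];
      [rewrite subnn !eqxx | rewrite subn_eq0 leqNgt lt (gtn_eqF lt)].
  case: eqP => [E|_] /=; last by rewrite /upd /= HH addn1.
  rewrite /upd /= subn_eq0; case: (#|e b0| <= #|e u|) => /=.
    by rewrite /upd /= HH addn1 ib0'.
  by rewrite /upd /= HH addn1.
case: s1E => VB [[VH VL VD VO] [VT VA]].
have L1 : loaded adj s1 by apply: loaded_frame L.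
have HQ1 : is_arr (arr s1 aQueue) (P ++ u :: F) by rewrite VA.
have HD1 (x : 'I_n) : (arr s1 aLev x != 0) = (x \in P ++ u :: F).
  by rewrite VA; apply: (se_vis S).
have VO1 : avar s1 vO = arr s1 aOff u by rewrite VO VA.
have [T2 Q2 D2] := scan_ok L1 VO1 (etrans VT HT) HQ1 HD1.
have s'E : s' = aden (AFor vY (AGet aIn (AVar vO)) scan_body) s1 by [].
rewrite -s'E in T2 Q2 D2.
exists (F ++ fresh (P ++ u :: F) (adj u)), b; split; first split.
- by rewrite s'E asgsN // VH size_rcons.
- by rewrite T2 cat_rcons -cat_cons catA.
- by rewrite cat_rcons -cat_cons catA.
- rewrite s'E => i lt; rewrite putsN // VA /aupd /=; move: i lt; rewrite -sB.
  exact: is_arr_rcons.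
- rewrite s'E asgsN // VL -s'E.
  have -> : level s' = fun x => if x \in fresh (P ++ u :: F) (adj u) then (level s u).+1 else level s x.
    by apply: functional_extensionality => x; rewrite /level D2 VD VA.
  apply: (search_pop es (isb' := is_best s') S (adj_uniq u)) => //.
    move=> b1 ib1; have -> : b1 = b0 by apply: val_inj; rewrite /= -ib1.
    by [].
  by rewrite /is_best s'E asgsN.
have := atime_for vY (AGet aIn (AVar vO)) s1 (isT : aflat scan_body).
have -> : aeval (AGet aIn (AVar vO)) s1 = size (adj u) by rewrite -(proj1 (L1.2 u)) -VO1.
move=> le.
have -> : atime pop s = atime pop_head s + atime (AFor vY (AGet aIn (AVar vO)) scan_body) s1 by [].
by rewrite -addnA leq_add2l; apply: (leq_trans le); rewrite leq_add2l.
Qed.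

Lemma seed_ok s (sds P used : seq 'I_n) (z : 'I_n) (rest bests : seq 'I_n) :
  avar s vHd = size P -> avar s vTl = size P -> avar s vPt = size used ->
  is_arr (arr s aQueue) P -> is_arr (arr s aSeed) sds -> sds = used ++ z :: rest ->
  search e sds (level s) P [::] (avar s vLv) used (is_best s) bests ->
  let s' := aden seed s in
  exists F', [/\ avar s' vTl = size (P ++ F'), is_arr (arr s' aQueue) (P ++ F'),
    avar s' vPt = (size used).+1 &
    search e sds (level s') P F' (avar s' vLv) (rcons used z) (is_best s') bests].
Proof.
move=> HH HT HP HQ HS Es S s'.
have zS : arr s aSeed (size used) = z by apply: is_arr_nth (rest) _; rewrite -Es.
have zv : (arr s aLev z != 0) = (z \in P).
  by have := se_vis S z; rewrite cats0.
case: (boolP (z \in P)) => zP.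
  exists [::]; rewrite cats0 /s' /seed /= /upd /= HP zS zv zP /= /upd /= addn1; split=> //.
  exact: search_skip S zP.
exists [:: z]; rewrite /s' /seed /= /upd /= HP zS zv (negbTE zP) /= /upd /= ?HP ?zS ?HT /aupd /= !addn1.
rewrite cats1 size_rcons; split=> //; first exact: is_arr_rcons.
rewrite (_ : level _ = fun x => if x == z then (avar s vLv).+1 else level s x).
  exact: (search_seed es S zP Es).
by apply: functional_extensionality => x; rewrite /level /= -(inj_eq val_inj).
Qed.

Definition bfs_cost := amax pop_head + amax seed + 50.
Definition scan_cost := amax scan_body + 4.

(** Amortisation: a round adds one vertex to P or one seed to [used], and a scan is charged to the
    degree of the vertex processed. After 2n rounds both lists are full. *)
Lemma bfs_ok s (sds : seq 'I_n) :
  loaded adj s -> size sds = n -> is_arr (arr s aSeed) sds ->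
  (forall x, exists2 z, z \in sds & connect e z x) ->
  (forall x : 'I_n, arr s aLev x = 0) ->
  let s' := aden bfs s in
  exists P lv used isb bests,
    [/\ search e sds (level s') P [::] lv used isb bests,
        forall x, x \in P, size P = n, is_arr (arr s' aQueue) P & is_arr (arr s' aBest) bests]
    /\ atime bfs s <= bfs_cost * (2 * n + 1) + scan_cost * \sum_(i < n) size (adj i).
Proof.
move=> L sz HS cover D0 s'.
set s1 := aden bfs_init s.
have s'E : s' = aden (AFor vX (AAdd (AVar vN) (AVar vN)) bfs_body) s1 by [].
have L1 : loaded adj s1 by apply: loaded_frame L.
have V1 : aeval (AAdd (AVar vN) (AVar vN)) s1 = n + n by rewrite -[in RHS]L1.1.
pose I k t c := loaded adj t /\ is_arr (arr t aSeed) sds /\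
  exists P F used rest bests,
    [/\ search e sds (level t) P F (avar t vLv) used (is_best t) bests,
       [/\ avar t vHd = size P, avar t vTl = size (P ++ F) & avar t vPt = size used],
       is_arr (arr t aQueue) (P ++ F), is_arr (arr t aBest) bests &
       [/\ sds = used ++ rest, size P + size used + k = n + n &
        c <= bfs_cost * (size P + size used) + scan_cost * \sum_(i <- P) size (adj i)]].

suff [c [[L2 [_ [P [F [used [rest [bests [S [HH HT HP] HQ HB [Es sz2 le]]]]]]]]] Ec]] :
    exists c, I 0 s' c /\ 0 + lcost (aden bfs_body) (atime bfs_body) (aset^~ vX) (n + n) (aset s1 vX (n + n)) = c + 1.
  have := se_uniq S; rewrite cat_uniq => /and3P[uP _ _].
  have szP : size P <= n by have := max_card (mem P); rewrite card_ord (card_uniqP uP).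
  have szU : size used <= n by have := leq_addr (size rest) (size used); rewrite -size_cat -Es sz.
  have [EP EU] : size P = n /\ size used = n by clear - sz2 szP szU; lia.
  have allP x : x \in P.
    have H : #|P| = #|'I_n| by rewrite (card_uniqP uP) EP card_ord.
    by rewrite (subset_cardP H (subset_predT _)).
  have F0 : F = [::].
    by case: F {HQ HT} S => // y F /se_uniq; rewrite cat_uniq /= allP andbF.
  subst F; rewrite cats0 in HQ.
  exists P, (avar s' vLv), used, (is_best s'), bests; split; first by split.
  have -> : atime bfs s = atime bfs_init s + (cst (AAdd (AVar vN) (AVar vN)) + 2 + (c + 1)).
    by rewrite -Ec -V1.
  have -> : \sum_(i < n) size (adj i) = \sum_(i <- P) size (adj i).
    rewrite -big_enum; apply: perm_big; apply: uniq_perm; rewrite ?enum_uniq //.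
    by move=> x; rewrite mem_enum allP.
  have := atime_le s (isT : aflat bfs_init).
  move: le; rewrite EP EU; set A := _ * \sum_(i <- P) _; rewrite /bfs_cost.
  move: (amax pop_head) (amax seed) (atime bfs_init s) => a b x.
  rewrite addnn -mul2n mulnDr muln1; set C := (_ * _) => le.
  by rewrite /bfs_init /= /cst /= => lx; clear - le lx; lia.
have -> : s' = loop (aden bfs_body) (aset^~ vX) (n + n) (aset s1 vX (n + n)) by rewrite -V1.
apply: (lcost_ind (I := I)); last first.
  split; first exact: L1; split=> //.
  exists [::], [::], [::], sds, [::]; split=> //.
  rewrite (_ : level _ = fun=> 0); first exact: search0.
  by apply: functional_extensionality => x; apply: D0.
move=> k t c lt [L2 [S2 [P [F [used [rest [bests [S [HH HT HP] HQ HB [Es sz2 le]]]]]]]]].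
have uP := se_uniq S.
set t0 := aset t vX k.
have Lt0 : loaded adj t0 by [].
have szF : avar t vTl - avar t vHd = size F by rewrite HT HH size_cat addKn.
have bT : atime bfs_body t0 = cst (ASub (AVar vTl) (AVar vHd)) + 1 +
    (if size F != 0 then atime pop t0 + 1 else atime seed t0) by rewrite -szF.
have bD : aden bfs_body t0 = if size F != 0 then aden pop t0 else aden seed t0 by rewrite -szF.
rewrite {}bT {}bD {szF}.
have frame c' : ~~ puts aIn c' -> ~~ puts aOff c' -> ~~ puts aSeed c' -> ~~ asgs vN c' ->
    loaded adj (aden c' t0) /\ is_arr (arr (aden c' t0) aSeed) sds.
  move=> p1 p2 p3 a1; split; first exact: loaded_frame.
  by move=> i lti; rewrite putsN // S2.
case: F S HT HQ uP => [|u F] S HT HQ uP; rewrite ?[size [::] != 0]/false ?[size (u :: F) != 0]/true.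
  rewrite cats0 in HT HQ uP.
  (* An empty queue with no seeds left would mean that all n vertices and all n seeds are done, but
     a round remains. *)
  have [z [rest' Er]] : exists z rest', rest = z :: rest'.
    case: rest Es sz2 => [|z rest'] Es sz2; last by exists z, rest'.
    have all := search_stuck cover S; rewrite cats0 in Es; subst used.
    have allP := all (fun x => id).
    have : #|P| = #|'I_n| by apply: eq_card => x; rewrite allP.
    rewrite (card_uniqP uP) card_ord => EP.
    by rewrite EP sz in sz2; exfalso; clear - sz2; lia.
  subst rest.
  have [F' [T1 Q1 P1 S1]] := seed_ok (s := t0) HH HT HP HQ S2 Es S.
  have [L3 S3] := frame seed isT isT isT isT.
  split=> //; split=> //; exists P, F', (rcons used z), rest', bests; split=> //.
  - by split; [rewrite asgsN | exact: T1 | rewrite size_rcons; exact: P1].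
  - by move=> i lti; rewrite putsN // HB.
  - split; first by rewrite cat_rcons.
      by rewrite size_rcons -sz2 addnS addSnnS.
    have := atime_le t0 (isT : aflat seed).
    rewrite size_rcons (addnS (size P)) mulnS; move: le; rewrite /bfs_cost.
    set A := scan_cost * _; set B := (amax pop_head + _ + _) * _.
    move: (amax pop_head) (amax seed) (atime seed t0) => a b d; rewrite /cst /=.
    by clear; lia.
have [F' [b [[H1 H2 H3 H4 H5] H6]]] := pop_ok (s := t0) Lt0 HH HT HQ HB S.
have [L3 S3] := frame pop isT isT isT isT.
split=> //; split=> //; exists (rcons P u), F', used, rest, (rcons bests b); split=> //.
  by split=> //; rewrite asgsN.
split=> //; first by rewrite size_rcons -sz2 addSn addnS.
have := atime_le t0 (isT : aflat pop_head).
rewrite size_rcons (addSn (size P)) mulnS -cats1 big_cat big_seq1 (mulnDr scan_cost).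
move: le H6; rewrite /bfs_cost -/scan_cost.
set A := scan_cost * _; set A' := scan_cost * _; set B := (amax pop_head + _ + _) * _.
move: (amax pop_head) (amax seed) (atime pop t0) (atime pop_head t0) => p q x y; rewrite /cst /=.
by clear; lia.
Qed.

End Bfs.

(** * Sorting the vertices *)

Section Phases.
Variables (n : nat) (e : rel 'I_n) (adj : 'I_n -> seq 'I_n).
Hypotheses (es : symmetric e) (adj_uniq : forall i, uniq (adj i))
  (adjE : forall i j, (j \in adj i) = e i j).

Lemma initial_seeds_ok s : loaded adj s -> is_arr (arr (aden initial_seeds s) aSeed) (enum 'I_n).
Proof.
move=> L.
pose I k t := forall i, k <= i < n -> arr t aSeed i = i.
suff H : I 0 (aden initial_seeds s).
  by move=> i; rewrite size_enum_ord val_enum_ord => lt; rewrite nth_iota // H.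
apply: (afor_ind (k := n)) => [|i|k t lt H i].
- exact: L.1.
- by move=> /andP[le /(leq_ltn_trans le)]; rewrite ltnn.
- rewrite /= /upd /= /aupd /= leq_eqVlt => /andP[/predU1P[->|lt2] lt3]; first by rewrite eqxx.
  by rewrite gtn_eqF // H // lt2.
Qed.

Lemma reset_ok s (bests : seq 'I_n) : loaded adj s -> size bests = n -> is_arr (arr s aBest) bests ->
  let s' := aden reset s in
  is_arr (arr s' aSeed) (rev bests) /\ forall x : 'I_n, arr s' aLev x = 0.
Proof.
move=> L sz HB s'.
pose I k t := [/\ avar t vN = n, arr t aBest = arr s aBest,
  (forall i, k <= i < n -> arr t aLev i = 0) &
  forall i, k <= i < n -> arr t aSeed (n - i.+1) = arr s aBest i].
have [] : I 0 s'.
  apply: (afor_ind (k := n)) => [||k t lt [H1 H2 H3 H4]].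
  - exact: L.1.
  - by split=> //; [exact: L.1 | |] => i /andP[le /(leq_ltn_trans le)]; rewrite ltnn.
  - rewrite /I /= /upd /= /aupd /= H1 H2; split=> // i; rewrite leq_eqVlt => /andP[/predU1P[<-|lt2] lt3].
    + by rewrite eqxx.
    + by rewrite gtn_eqF // H3 // lt2.
    + by rewrite -subnDA add1n eqxx.
    + rewrite -subnDA add1n; case: eqP => [E|_]; last by rewrite H4 // lt2.
      by clear - E lt2 lt3; lia.
move=> _ _ H3 H4; split=> [i|x]; last by apply: H3; rewrite /=.
rewrite size_rev => lt; rewrite map_rev nth_rev ?size_map // -HB.
  rewrite -H4; last by rewrite sz ltn_subrL; clear - lt sz; lia.
  by rewrite sz; congr arr; clear - lt sz; lia.
by clear - lt sz; lia.
Qed.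

Lemma level_ends_ok s (P : seq 'I_n) : loaded adj s -> uniq P -> (forall x, x \in P) -> size P = n ->
  is_arr (arr s aQueue) P -> sorted leq (map (level s) P) ->
  let s' := aden level_ends s in
  forall x : 'I_n, arr s' aUpto (level s x) = #|[set z : 'I_n | level s z <= level s x]|.
Proof.
move=> L uP PT sz HQ so s' x.
set s1 := aden (AAsg vI (ACst 0)) s.
pose cnt l (x : 'I_n) := count (fun z : 'I_n => level s z <= level s x) l.
pose I l t := [/\ avar t vI = size l, arr t aQueue = arr s aQueue, arr t aLev = arr s aLev &
  forall y, y \in l -> arr t aUpto (level s y) = cnt l y].
have [_ _ _ /(_ x (PT x)) ->] : I P s'; last first.
  rewrite /cnt -size_filter cardE; apply: perm_size; apply: uniq_perm.
  - exact: filter_uniq.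
  - exact: enum_uniq.
  - by move=> z; rewrite mem_filter PT andbT mem_enum inE.
have V1 : aeval (AVar vN) s1 = size P by rewrite sz; apply: L.1.
rewrite /s' /level_ends aseqE -/s1.
apply: (afor_list V1) => [|l1 w l2 t EP [H1 H2 H3 H4]]; first by [].
have Qw : arr s aQueue (size l1) = w by apply: is_arr_nth (l2) _; rewrite -EP.
have le_w y : y \in l1 -> level s y <= level s w.
  move=> yl; move: so; rewrite (sorted_pairwise leq_trans) EP map_cat pairwise_cat.
  by case/and3P=> /allrelP al _ _; apply: al; rewrite ?map_f //= inE eqxx.
rewrite /I /= /upd /= /aupd /= H1 H2 H3 Qw addn1 size_rcons; split=> // y.
rewrite mem_rcons inE => yl; rewrite /cnt -cats1 count_cat /= addn0.
(* On the level of w every vertex read so far counts, by sortedness; other levels already seen are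
   lower and do not count w. *)
case: eqP => [E|nE].
  have -> : level s w <= level s y by rewrite -[level s w]/(arr s aLev w) -E.
  rewrite addn1; congr _.+1; apply/esym/eqP; rewrite -all_count; apply/allP=> z /le_w.
  by rewrite -[level s w]/(arr s aLev w) -E.
case/predU1P: yl => [Ey|yl]; first by rewrite Ey in nE.
rewrite H4 // [level s w <= _]leqNgt ltn_neqAle le_w // andbT.
by have /eqP -> := nE; rewrite addn0.
Qed.

Section Reaches.
Variable D : 'I_n -> nat.
Hypothesis D_edge : forall x y, e x y -> D y <= (D x).+1.

Notation reachD := (reach e D).
Notation keyD := (key e D).

Lemma reach_count x :
  #|[set z | D z <= D x]| + count (fun w => D x < D w) (adj x) = reachD x.
Proof.
rewrite /reach; set U := [set z | D z <= D x].
have -> : count (fun w => D x < D w) (adj x) = #|[set w | e x w & D x < D w]|.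
  rewrite -size_filter cardE; apply: perm_size; apply: uniq_perm.
  - exact: filter_uniq.
  - exact: enum_uniq.
  - by move=> z; rewrite mem_filter mem_enum inE adjE andbC.
rewrite -cardsUI (_ : U :&: _ = set0) ?cards0 ?addn0; last first.
  by apply/setP=> z; rewrite !inE ltnNge; case: (_ <= _); rewrite ?andbF.
apply: eq_card => z; rewrite !inE ltnNge; case: (_ <= _) => //=.
by rewrite andbT.
Qed.

Lemma reaches_ok s : loaded adj s -> (forall x, level s x = D x) ->
  (forall x, arr s aUpto (D x) = #|[set z | D z <= D x]|) ->
  (forall k, arr s aCnt k = 0) ->
  let s' := aden reaches s in
  [/\ forall x : 'I_n, arr s' aReach x = reachD x, forall x : 'I_n, arr s' aKey x = keyD x &
    forall k, arr s' aCnt k = #|[set x | keyD x == k]|].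
Proof.
move=> L HD HU HC s'.
pose body := (reach_head ;; (AFor vY (AGet aIn (AVar vU)) count_next) ;; reach_tail)%P.
pose I k t := [/\ loaded adj t /\ (forall x, level t x = D x),
  (forall x, arr t aUpto (D x) = #|[set z | D z <= D x]|),
  (forall x : 'I_n, k <= x -> arr t aReach x = reachD x),
  (forall x : 'I_n, k <= x -> arr t aKey x = keyD x) &
  forall j, arr t aCnt j = #|[set x : 'I_n | (k <= x) && (keyD x == j)]|].
have [_ _ H1 H2 H3] : I 0 s'; last by split=> *; rewrite ?H1 ?H2 ?H3.
have V0 : aeval (AVar vN) s = n := L.1.
apply: (afor_ind (c := body) V0) => [|k t lt [[Lt Dt] Ut H1 H2 H3]].
  split=> // [x|x|j]; try by rewrite leqNgt ltn_ord.
  rewrite [LHS]HC; apply/esym/eqP; rewrite cards_eq0; apply/eqP/setP=> x.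
  by rewrite !inE leqNgt ltn_ord.
pose x := Ordinal lt.
set t0 := aset t vX k.
set t1 := aden reach_head t0.
set t2 := aden (AFor vY (AGet aIn (AVar vU)) count_next) t1.
have [V1 V2 V3] : [/\ avar t1 vU = arr t aOff x, avar t1 vO = arr t aOff x & avar t1 vD = D x].
  by rewrite /t1 /= /upd /= -Dt.
have V4 : avar t1 vC = #|[set z | D z <= D x]|.
  by rewrite /t1 /= /upd /= -Ut -Dt.
have A1 : arr t1 = arr t by [].
have [L1 L2] := Lt.2 x.
pose J (l : seq 'I_n) r := [/\ avar r vO = arr t aOff x + size l, avar r vD = D x, arr r = arr t &
  avar r vC = #|[set z | D z <= D x]| + count (fun w => D x < D w) l].
have [_ _ A2 C2] : J (adj x) t2.
  have V : aeval (AGet aIn (AVar vU)) t1 = size (adj x) by rewrite -L1 -V1.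
  apply: (afor_list V) => [|l1 w l2 r El [J1 J2 J3 J4]].
    by split=> //=; rewrite ?addn0.
  have w_in : arr t aIn (avar r vO + 1) = w.
    rewrite J1 addn1 -addSn L2 El ?map_cat ?nth_cat ?size_cat /= ?addnS ?ltnS ?leq_addr //.
    by rewrite size_map ltnn subnn.
  rewrite /J /= /upd /= J3 w_in J2 -[arr t 3 w]/(level t w) Dt -lt0n subn_gt0 -cats1 count_cat /= addn0.
  rewrite size_cat addn1 J1 addn1.
  by case: ifP => _ /=; rewrite /upd /= J4 ?J3 ?addn0 ?addn1 ?addnS ?J1 ?J2; split.
have C2' : avar t2 vC = reachD x by rewrite C2 reach_count.
have U2 : avar t2 vU = arr t aOff x by rewrite asgsN.
have X2 : avar t2 vX = k by rewrite asgsN.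
have key_x : reachD x + (reachD x - arr t aIn (arr t aOff x)) = keyD x.
  by rewrite L1 /key -(card_uniqP (adj_uniq x)) (eq_card (adjE x)).
have bE : aden body t0 = aden reach_tail t2 by [].
rewrite bE /I; split.
- split=> [|y]; first by rewrite -bE; exact: (@loaded_frame _ _ body t0 isT isT isT (Lt : loaded adj t0)).
  by rewrite /level putsN // A2; apply: Dt.
- by move=> y; rewrite putsN // A2.
- move=> y; rewrite /= /upd /= /aupd /= X2 C2' A2 leq_eqVlt => /predU1P[E|lt2].
    have -> : y = x by apply: val_inj.
    by rewrite eqxx.
  by rewrite gtn_eqF // H1.
- move=> y; rewrite /= /upd /= /aupd /= X2 C2' A2 U2 key_x leq_eqVlt => /predU1P[E|lt2].
    have -> : y = x by apply: val_inj.
    by rewrite eqxx.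
  by rewrite gtn_eqF // H2.
- move=> j; rewrite /= /upd /= /aupd /= A2 C2' U2 key_x H3.
  rewrite [RHS](cardsD1 x) !inE leqnn /= eq_sym.
  have E : #|[set y : 'I_n | (k < y) && (keyD y == j)]| =
           #|[set y : 'I_n | (k <= y) && (keyD y == j)] :\ x|.
    apply: eq_card => y; rewrite !inE ltn_neqAle andbA; congr (_ && _ && _).
    by rewrite eq_sym -(inj_eq val_inj).
  by rewrite -E; case: eqP => [<-|_]; rewrite ?H3 ?addn1.
Qed.

Lemma key_le x : keyD x <= n + n.
Proof.
have : reachD x <= n by rewrite -[X in _ <= X]card_ord max_card.
by rewrite /key; lia.
Qed.

Lemma prefix_sums_ok s : avar s vN = n ->
  (forall k, arr s aCnt k = #|[set x | keyD x == k]|) ->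
  forall k, k <= n + n -> arr (aden prefix_sums s) aCnt k = #|[set x | keyD x < k]|.
Proof.
move=> HN HC.
set s1 := aden (AAsg vC (ACst 0)) (aden (AAsg vI (ACst 0)) s).
pose m := n + n + 1.
pose I k t := [/\ avar t vI = m - k, avar t vC = #|[set x | keyD x < m - k]|,
   forall j, j < m - k -> arr t aCnt j = #|[set x | keyD x < j]| &
   forall j, m - k <= j -> arr t aCnt j = #|[set x | keyD x == j]|].
have [] : I 0 (aden prefix_sums s).
  rewrite /prefix_sums !aseqE -/s1.
  have V : aeval (AAdd (AAdd (AVar vN) (AVar vN)) (ACst 1)) s1 = m by rewrite /m -HN.
  apply: (afor_ind V) => [|k t lt [H1 H2 H3 H4]].
    rewrite /I subnn; split=> [||j|j _]; [by [] | | by [] | exact: HC]; apply/esym/eqP; rewrite cards_eq0; apply/eqP/setP=> x.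
    by rewrite !inE.
  have Ek : m - k = (m - k.+1).+1 by rewrite subnSK.
  rewrite /I Ek; move: (m - k.+1) H1 H2 H3 H4 => j H1 H2 H3 H4.
  rewrite /= /upd /= /aupd /= H1 H2 H4 //; split; first by rewrite addn1.
  + rewrite -cardsUI (_ : _ :&: _ = set0) ?cards0 ?addn0.
      by apply: eq_card => x; rewrite !inE [RHS]ltnS [RHS]leq_eqVlt orbC.
    by apply/setP=> x; rewrite !inE; case: ltngtP.
  + move=> i; rewrite ltnS leq_eqVlt => /predU1P[->|lti]; first by rewrite eqxx.
    by rewrite ltn_eqF // H3.
  + by move=> i lti; rewrite gtn_eqF // H4 // ltnW.
move=> _ _ H _ k le; apply: H; rewrite subn0 /m; lia.
Qed.

(** The placement loop counts down, so among equal keys the larger index comes first. *)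
Definition before_pos (y x : 'I_n) := (keyD y < keyD x) || (keyD y == keyD x) && (x < y).

Lemma before_irr : irreflexive before_pos.
Proof. by move=> x; rewrite /before_pos !ltnn andbF. Qed.

Lemma before_trans : transitive before_pos.
Proof. by move=> y x z; rewrite /before_pos; lia. Qed.

Lemma before_total x y : x != y -> before_pos x y || before_pos y x.
Proof. by rewrite -(inj_eq val_inj) /before_pos /=; lia. Qed.

Notation pos := (rank before_pos).

Lemma pos_key x y : pos x < pos y -> keyD x <= keyD y.
Proof.
rewrite rank_ltE; [|exact: before_irr|exact: before_trans|exact: before_total].
by rewrite /before_pos; lia.
Qed.

Lemma pos_inj : injective pos.
Proof. by apply: rank_inj; [exact: before_irr|exact: before_trans|exact: before_total]. Qed.

Lemma placement_ok s : avar s vN = n -> (forall x : 'I_n, arr s aKey x = keyD x) ->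
  (forall x : 'I_n, arr s aReach x = reachD x) ->
  (forall k, k <= n + n -> arr s aCnt k = #|[set x | keyD x < k]|) ->
  let s' := aden placement s in
  (forall x, arr s' aVert (pos x) = x) /\ (forall x, arr s' aPos (pos x) = reachD x).
Proof.
move=> HN HK HR HC s'.
(* The counter of key j is the start of its block plus the number of vertices of that key already
   placed. *)
pose I k t := [/\ arr t aKey = arr s aKey /\ arr t aReach = arr s aReach,
   forall j, j <= n + n -> arr t aCnt j =
     #|[set x | keyD x < j]| + #|[set x : 'I_n | (k <= x) && (keyD x == j)]|,
   forall x : 'I_n, k <= x -> arr t aVert (pos x) = x &
   forall x : 'I_n, k <= x -> arr t aPos (pos x) = reachD x].
have [] : I 0 s'; last by move=> _ _ H1 H2; split=> x; [apply: H1 | apply: H2].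
apply: (afor_ind (HN : aeval (AVar vN) s = n)) => [|k t lt [[H1 H2] H3 H4 H5]].
  split=> // [j le|x|x]; try by rewrite leqNgt ltn_ord.
  rewrite /= HC // (_ : [set x : 'I_n | (n <= x) && _] = set0) ?cards0 ?addn0 //.
  by apply/setP=> x; rewrite !inE leqNgt ltn_ord.
pose x := Ordinal lt.
have px : arr t aCnt (keyD x) = pos x.
  rewrite H3 ?key_le // -cardsUI (_ : _ :&: _ = set0) ?cards0 ?addn0.
    by apply: eq_card => y; rewrite !inE /before_pos /= andbC.
  by apply/setP=> y; rewrite !inE; case: ltngtP; rewrite ?andbF.
rewrite /I /= /upd /= /aupd /= H1 -[k]/(nat_of_ord x) HK px H2 HR; split=> //.
- move=> j le; rewrite [X in _ = _ + X](cardsD1 x) !inE leqnn /=.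
  have E : #|[set y : 'I_n | (k < y) && (keyD y == j)]| =
           #|[set y : 'I_n | (k <= y) && (keyD y == j)] :\ x|.
    apply: eq_card => y; rewrite !inE ltn_neqAle andbA; congr (_ && _ && _).
    by rewrite eq_sym -(inj_eq val_inj).
  rewrite -E; case: (eqVneq j (keyD x)) => [->|_] /=; last by rewrite H3.
  by rewrite -px H3 ?key_le // addn1 add1n addnS.
- move=> y; rewrite leq_eqVlt => /predU1P[E2|lt2].
    have -> : y = x by apply: val_inj.
    by rewrite eqxx.
  case: eqP => [/pos_inj Eyx|_]; last by rewrite H4.
  by rewrite Eyx ltnn in lt2.
- move=> y; rewrite leq_eqVlt => /predU1P[E2|lt2].
    have -> : y = x by apply: val_inj.
    by rewrite eqxx.
  case: eqP => [/pos_inj Eyx|_]; last by rewrite H5.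
  by rewrite Eyx ltnn in lt2.
Qed.

End Reaches.
End Phases.

(** * Dynamic programming *)

Lemma subn_neq0 a b : (a - b != 0) = (b < a).
Proof. by rewrite -lt0n subn_gt0. Qed.

Section Dp.
Variables (n : nat) (r : nat -> nat).
Hypotheses (r_gt : forall i, i < n -> i < r i) (r_le : forall i, i < n -> r i <= n)
  (r_mono : forall i j, i <= j -> j < n -> r i <= r j).

Definition W_rec (W H : nat -> nat) i :=
  if i.+1 < r i then (maxn (W (r i)) (H i.+1)).+1 else W i.+1.

Definition H_rec (W H : nat -> nat) i :=
  if i.+1 == r i then W i.+1 else
  if r i.+1 == r i then H i.+1 else (maxn (W (r i.+1)) (H (r i))).+1.

Lemma dp_ok s : avar s vN = n -> (forall i, i < n -> arr s aPos i = r i) ->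
  (forall i, arr s aW i = 0) -> (forall i, arr s aH i = 0) ->
  let s' := aden dp s in
  [/\ forall i, i < n -> arr s' aW i = W_rec (arr s' aW) (arr s' aH) i,
      forall i, i < n -> arr s' aH i = H_rec (arr s' aW) (arr s' aH) i,
      forall i, n <= i -> arr s' aW i = 0 & forall i, n <= i -> arr s' aH i = 0].
Proof.
move=> HN HP W0 H0 s'.
pose I k t := [/\ forall i, i < n -> arr t aPos i = r i,
  forall i, k <= i < n -> arr t aW i = W_rec (arr t aW) (arr t aH) i,
  forall i, k <= i < n -> arr t aH i = H_rec (arr t aW) (arr t aH) i &
  forall i, n <= i -> arr t aW i = 0 /\ arr t aH i = 0].
have [] : I 0 s'; last first.
  by move=> _ H1 H2 H3; split=> // i lt; have [] := H3 i lt.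
apply: (afor_ind (HN : aeval (AVar vN) s = n)) => [|k t lt [H1 H2 H3 H4]].
  split=> [//|i|i|i _]; [| |by rewrite /= W0 H0]; by move=> /andP[le /(leq_ltn_trans le)]; rewrite ltnn.
set t' := aden dp_body (aset t vX k).
have Pk := H1 k lt; have c3 := H_cases r_gt r_le r_mono lt.
have tP : arr t' aPos = arr t aPos.
  by apply: functional_extensionality => i; rewrite putsN.
have [tW tH] : (forall i, arr t' aW i = if i == k then W_rec (arr t aW) (arr t aH) k else arr t aW i)
  /\ (forall i, arr t' aH i = if i == k then H_rec (arr t aW) (arr t aH) k else arr t aH i).
  set u := aden dp_W (aset t vX k).
  have uP : arr u aPos = arr t aPos.
    by apply: functional_extensionality => i; rewrite putsN.
  have uX : avar u vX = k by rewrite asgsN.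
  have uH : arr u aH = arr t aH.
    by apply: functional_extensionality => i; rewrite putsN.
  have uW i : arr u aW i = if i == k then W_rec (arr t aW) (arr t aH) k else arr t aW i.
    rewrite /u /dp_W /succ_max /= /upd /= !addn1 Pk subn_neq0 /W_rec.
    by case: ifP => _ /=; rewrite /aupd /= ?addn1 ?maxnE.
  have uWk i : k < i -> arr u aW i = arr t aW i by move=> lti; rewrite uW gtn_eqF.
  have -> : t' = aden dp_H u by [].
  split=> i; first by rewrite putsN.
  rewrite /dp_H /succ_max /= uX uP uH Pk !addn1 subn_neq0 /H_rec.
  case: c3 => [E|[l1 l2 E]|[l1 l2 l3 l4]].
  - by rewrite -E ltnn eqxx /= /aupd /= uH uWk.
  - by rewrite l2 (ltn_eqF l2) (H1 _ l1) E eqxx subnn /= /aupd /= uH.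
  - rewrite l1 (ltn_eqF l1) (H1 _ l3) (gtn_eqF l2) subn_neq0 l2 /= /aupd /= uH maxnE.
    by rewrite uWk // (ltn_trans (r_gt lt) l2).
have far i : k < i -> arr t' aW i = arr t aW i /\ arr t' aH i = arr t aH i.
  by move=> lti; rewrite tW tH gtn_eqF.
(* The recurrences look only at indices beyond i, whose entries are final, so they persist in the
   finished tables. *)
have rec i : k <= i < n -> W_rec (arr t' aW) (arr t' aH) i = W_rec (arr t aW) (arr t aH) i /\
    H_rec (arr t' aW) (arr t' aH) i = H_rec (arr t aW) (arr t aH) i.
  move=> /andP[le lti]; have ki : k < i.+1 by [].
  have [W1 H1'] := far _ ki; have [W2 H2'] := far _ (leq_ltn_trans le (r_gt lti)).
  rewrite /W_rec /H_rec W1 H1' W2 H2'; split=> //.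
  case: (H_cases r_gt r_le r_mono lti) => [->|[l1 l2 ->]|[l1 l2 l3 l4]]; rewrite ?eqxx //.
  by rewrite (ltn_eqF l1) (gtn_eqF l2); have [-> _] := far _ (ltn_trans ki (r_gt l3)).
split.
- by rewrite tP.
- move=> i ki; rewrite (rec i ki).1 tW; case: eqP => [-> //|/eqP ne].
  by apply: H2; move: ki; rewrite leq_eqVlt eq_sym (negbTE ne).
- move=> i ki; rewrite (rec i ki).2 tH; case: eqP => [-> //|/eqP ne].
  by apply: H3; move: ki; rewrite leq_eqVlt eq_sym (negbTE ne).
- by move=> i le; have [-> ->] := far i (leq_trans lt le); apply: H4.
Qed.

Section Trace.
Variables W H : nat -> nat.

Definition listed (f : nat -> nat) (v : nat -> nat) (ps : seq (nat * nat)) : Prop :=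
  forall i, i < size ps -> f (i + i + 1) = v (nth (0, 0) ps i).1 /\ f (i + i + 2) = v (nth (0, 0) ps i).2.

Lemma listed_rcons f v ps p : listed f v ps ->
  listed (fun i => if i == size ps + size ps + 2 then v p.2 else
                   if i == size ps + size ps + 1 then v p.1 else f i) v (rcons ps p).
Proof.
move=> L i; rewrite size_rcons ltnS leq_eqVlt nth_rcons => /predU1P[->|lt].
  by rewrite ltnn !eqxx; case: eqP => //; lia.
rewrite lt; have [<- <-] := L i lt.
by split; case: eqP; try lia; case: eqP; lia.
Qed.

Definition traced (t t' : ast) (v : nat -> nat) (o : option (nat * nat)) : Prop :=
  if o is Some p then
    avar t' vC = (avar t vC).+1 /\ forall j, arr t' aOut j =
      if j == avar t vC + avar t vC + 2 then v p.2 else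
      if j == avar t vC + avar t vC + 1 then v p.1 else arr t aOut j
  else avar t' vC = avar t vC /\ arr t' aOut = arr t aOut.

Section TraceStep.
Variable t : ast.
Hypotheses (tP : forall i, i < n -> arr t aPos i = r i)
  (tW : forall i, arr t aW i = W i) (tH : forall i, arr t aH i = H i).
Hypothesis lt_in : avar t vI < n.

Lemma trace_W_ok : avar t vM = 0 ->
  let t' := aden trace_W t in let oc := ostep n r W H false (avar t vI) in
  (avar t' vM != 0, avar t' vI) = oc.2 /\ traced t t' (arr t aVert) oc.1.
Proof.
move=> m0; have lti := lt_in; set i := avar t vI in lti *.
rewrite /= /ostep (leqNgt n) lti /=.
rewrite /= /upd /= -/i (tP lti) !addn1 subn_neq0.
case: ifP => _ /=; last by rewrite /upd /= m0 eqxx; split.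
rewrite /upd /= /aupd /= -/i (tP lti) tW tH !addn1 subn_neq0.
by case: leqP => _ /=; rewrite /upd /= -/i ?(tP lti) ?m0 ?eqxx ?addn1.
Qed.

Lemma trace_H_ok : avar t vM != 0 ->
  let t' := aden trace_H t in let oc := ostep n r W H true (avar t vI) in
  (avar t' vM != 0, avar t' vI) = oc.2 /\ traced t t' (arr t aVert) oc.1.
Proof.
move=> m0; have lti := lt_in; set i := avar t vI in lti *.
rewrite /= /ostep (leqNgt n) lti /=.
rewrite /= /upd /= -/i (tP lti) !addn1 subn_neq0.
case: (H_cases r_gt r_le r_mono lti) => [E|[l1 l2 E]|[l1 l2 l3 l4]].
- by rewrite -E ltnn eqxx /= /upd /=; split.
- by rewrite l2 (ltn_eqF l2) (tP l1) E eqxx subnn /= /upd /= m0; split.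
rewrite l1 (ltn_eqF l1) (tP l3) (gtn_eqF l2) subn_neq0 l2 /=.
rewrite /upd /= /aupd /= -/i (tP lti) !addn1 (tP l3) tW tH subn_neq0.
by case: leqP => _ /=; rewrite /upd /= /aupd /= -/i ?(tP lti) ?addn1 ?(tP l3) ?m0 ?eqxx.
Qed.

End TraceStep.

Lemma trace_ok s : avar s vN = n ->
  (forall i, i < n -> arr s aPos i = r i) ->
  (forall i, arr s aW i = W i) -> (forall i, arr s aH i = H i) ->
  let s' := aden trace s in
  let ps := optimum n r W H n (false, 0) in
  arr s' aOut 0 = size ps /\ listed (arr s' aOut) (arr s aVert) ps.
Proof.
move=> HN HP HW HH s' ps.
set s1 := aden (AAsg vC (ACst 0)) (aden (AAsg vI (ACst 0)) (aden (AAsg vM (ACst 0)) s)).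
(* Pairs already written, followed by what [optimum] yields from the current state with the
   remaining fuel, always form the full answer. *)
pose I k t := [/\ avar t vN = n, forall j, j != aOut -> arr t j = arr s j &
   exists qs, [/\ qs ++ optimum n r W H k (avar t vM != 0, avar t vI) = ps,
     avar t vC = size qs & listed (arr t aOut) (arr s aVert) qs]].
have [HN' HA [qs []]] : I 0 (aden (AFor vX (AVar vN) trace_body) s1).
  apply: (afor_ind (HN : aeval (AVar vN) s1 = n)) => [|k t lt [H1 H2 [qs [H3 H4 H5]]]].
    by split=> //; exists [::]; split.
  have P2 i : i < n -> arr t aPos i = r i by move=> lti; rewrite H2 // HP.
  set m := avar t vM in H3; set i := avar t vI in H3.
  have [A1 A2 A3] : [/\ forall j, arr t aW j = W j, forall j, arr t aH j = H j &
      arr t aVert = arr s aVert].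
    by split=> [j|j|]; rewrite H2.
  split.
  - by rewrite asgsN.
  - move=> j nj; apply: functional_extensionality => x; rewrite putsN ?H2 //=.
    by rewrite !orbF eq_sym (negbTE nj).
  case: (leqP n i) => [le|lti].
    have -> : aden trace_body (aset t vX k) = aset t vX k.
      have E : n - i = 0 by apply/eqP.
      by rewrite [LHS]/= /upd /= H1 -/i E.
    by exists qs; split=> //; rewrite -H3 /= /ostep le.
  have -> : aden trace_body (aset t vX k) =
      aden (if m != 0 then trace_H else trace_W) (aset t vX k).
    have E : (n - i != 0) = true by rewrite subn_neq0.
    by rewrite [LHS]/= /upd /= H1 -/i E; case: ifP.
  set t' := aden _ _.
  have [Ec Et] : (avar t' vM != 0, avar t' vI) = (ostep n r W H (m != 0) i).2 /\
      traced t t' (arr t aVert) (ostep n r W H (m != 0) i).1.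
    rewrite /t'; case: (eqVneq m 0) => [m0|m0].
      exact: (trace_W_ok (t := aset t vX k) P2 A1 A2 lti m0).
    exact: (trace_H_ok (t := aset t vX k) P2 A1 A2 lti m0).
  move: H3 Et; rewrite Ec /=; case: (ostep n r W H (m != 0) i) => [[p|] c] /= H3 [Et1 Et2].
    exists (rcons qs p); rewrite cat_rcons Et1 H4 size_rcons; split=> //.
    by move=> j lj; rewrite !Et2 H4 A3; apply: listed_rcons lj.
  by exists qs; rewrite Et1 Et2.
move=> E1 E2 E3.
have -> : s' = aden (APut aOut (ACst 0) (AVar vC)) (aden (AFor vX (AVar vN) trace_body) s1) by [].
rewrite /= cats0 in E1; rewrite -/ps -E1; split; first by rewrite /aupd /= -E2.
by move=> i lti; have [<- <-] := E3 i lti; rewrite /aupd /= addn1 addn2.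
Qed.

End Trace.
End Dp.

(** * The algorithm as a whole *)

Lemma size_optimum n r W H k c : size (optimum n r W H k c) <= k.
Proof.
elim: k c => //= k IH c; case: (ostep _ _ _ _ _ _) => [[p|] c'] /=; first exact: IH.
by apply: leq_trans (IH _) _.
Qed.

Lemma inj_surj n (f : 'I_n -> nat) : injective f -> (forall x, f x < n) ->
  forall p, p < n -> exists x, f x = p.
Proof.
move=> inj lt p ltp; pose g x := Ordinal (lt x).
have ginj : injective g by move=> x y [/inj].
have [h _ hK] := injF_bij ginj; exists (h (Ordinal ltp)).
by have := hK (Ordinal ltp) => /(congr1 val).
Qed.

(** The 7 is 4 per round plus 3 for entering and leaving; the factor [k.+1] in the bound also covers
    an empty loop. *)
Definition for_cost (e : aexp) (c : acom) := amax c + cst e + 7.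

Lemma atime_flat_for x e c s : aflat c -> atime (AFor x e c) s <= for_cost e c * (aeval e s).+1.
Proof.
move=> fc; apply: leq_trans (atime_for x e s fc) _; rewrite /for_cost mulnS.
by move: (amax c) (cst e) (aeval e s) => a b k; lia.
Qed.

Lemma aseqT a b s : atime (ASeq a b) s = atime a s + atime b (aden a s). Proof. by []. Qed.

Lemma leq_lin a b A B S : a <= A * S -> b <= B * S -> a + b <= (A + B) * S.
Proof. by rewrite mulnDl; apply: leq_add. Qed.

Lemma leq_linW a A k B S : a <= A * k -> k <= B * S -> a <= A * B * S.
Proof. by move=> H1 H2; apply: leq_trans H1 _; rewrite -mulnA leq_mul2l H2 orbT. Qed.

Section Correct.
Variables (n : nat) (e : rel 'I_n) (adj : 'I_n -> seq 'I_n).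
Hypotheses (es : symmetric e) (eirr : irreflexive e) (adj_uniq : forall i, uniq (adj i))
  (adjE : forall i j, (j \in adj i) = e i j).
Hypothesis pig : proper_interval_graph e.

Definition output_ok (f : nat -> nat) (ps : seq ('I_n * 'I_n)) : Prop :=
  f 0 = size ps /\ forall i, i < size ps ->
    f (i + i + 1) = nth 0 [seq nat_of_ord p.1 | p <- ps] i /\
    f (i + i + 2) = nth 0 [seq nat_of_ord p.2 | p <- ps] i.

Definition solution (ps : seq ('I_n * 'I_n)) : Prop :=
  [/\ uniq [seq [set p.1; p.2] | p <- ps], max_ur_matching e (edges_of ps) & size ps <= n].

Lemma ordered_solution s D rt :
  layering e D rt ->
  (forall r, rt r -> exists2 rk, umbrella e rk & forall z, connect e r z -> rk r <= rk z) ->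
  avar s vN = n -> (forall i, arr s aW i = 0) -> (forall i, arr s aH i = 0) ->
  (forall x, arr s aVert (rank (before_pos e D) x) = x) ->
  (forall x, arr s aPos (rank (before_pos e D) x) = reach e D x) ->
  exists ps, solution ps /\ output_ok (arr (aden trace (aden dp s)) aOut) ps.
Proof.
move=> lay ends HN W0 H0 HV HP.
set pos := rank _ in HV HP; set r := arr s aPos.
have pinj : injective pos := @pos_inj _ e D.
have plt x : pos x < n.
  by have := rank_max (@before_irr _ e D) x; rewrite card_ord.
have plt' x : pos x < #|'I_n| by rewrite card_ord.
have pkey x y : pos x < pos y -> key e D x <= key e D y := @pos_key _ e D x y.
have surj := inj_surj pinj plt.
have r_gt i : i < n -> i < r i.
  by move=> /surj[x <-]; rewrite /r HP; apply: (reach_gt es eirr lay ends pinj plt' pkey).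
have r_le i : i < n -> r i <= n.
  by move=> /surj[x <-]; rewrite /r HP; have := reach_le e D x; rewrite card_ord.
have r_mono i j : i <= j -> j < n -> r i <= r j.
  rewrite leq_eqVlt => /predU1P[-> //|lt] ltj.
  have lti := ltn_trans lt ltj; move: lt; have [x <-] := surj i lti; have [y <-] := surj j ltj => lt.
  by rewrite /r !HP; apply: (reach_mono es eirr lay ends pkey).
have edge x y : pos x < pos y -> e x y = (pos y < r (pos x)).
  by move=> lt; rewrite /r HP (reach_edge es eirr lay ends pinj plt' pkey).
have [WE HE Wn Hn] := dp_ok r_gt r_le r_mono HN (fun i _ => erefl) W0 H0.
set s1 := aden dp s in WE HE Wn Hn *.
have N1 : avar s1 vN = n by rewrite asgsN.
have P1 i : i < n -> arr s1 aPos i = r i by rewrite putsN.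
have [T1 T2] := trace_ok r_gt r_le r_mono N1 P1 (fun i => erefl (arr s1 aW i)) (fun i => erefl (arr s1 aH i)).
set os := optimum _ _ _ _ _ _ in T1 T2.
have [_ _ ad _] := optimum_ok r_gt r_le r_mono WE HE Wn Hn (k := n) (c := (false, 0)) (leqnn n).
(* Positions are turned back into vertices, every position below n being occupied. *)
have [ps Eps] : exists ps, map (at_pos pos) ps = os.
  move: ad; rewrite -/os; elim: os {T1 T2} => [|[a b] os IH] /=; first by exists [::].
  move=> /andP[/and3P[/= ab bn _] /IH[ps <-]].
  have [x Ex] := surj a (ltn_trans ab bn); have [y Ey] := surj b bn.
  by exists ((x, y) :: ps); rewrite /= /at_pos /= Ex Ey.
exists ps; split.
  have [m u] := chain_max es eirr pinj plt edge r_mono r_gt r_le WE HE Wn Hn Eps.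
  by split=> //; rewrite -(size_map (at_pos pos)) Eps size_optimum.
rewrite /output_ok T1 -Eps size_map; split=> // i lt.
have := T2 i; rewrite -Eps size_map => /(_ lt) [-> ->].
case: ps lt {Eps} => // p0 ps lt; rewrite !(nth_map p0) //=.
by rewrite !putsN // !HV.
Qed.

Definition init_ok (s : ast) : Prop :=
  (forall i, arr s aIn i = nth 0 (encode_adj adj) i) /\
  forall k i, 0 < k < 16 -> arr s k i = 0.

Definition reach_cost := amax reach_head + amax reach_tail + 25.
Definition next_cost := amax count_next + 4.

Lemma reaches_time s : loaded adj s ->
  atime reaches s <= reach_cost * n.+1 + next_cost * \sum_(i < n) size (adj i).
Proof.
move=> L; set body := (reach_head ;; (AFor vY (AGet aIn (AVar vU)) count_next) ;; reach_tail)%P.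
pose I k t c := loaded adj t /\
  c <= reach_cost * (n - k) + next_cost * \sum_(i < n | k <= i) size (adj i).
have V0 : aeval (AVar vN) s = n := L.1.
suff [c [[_ le] Ec]] : exists c, I 0 (loop (aden body) (aset^~ vX) n (aset s vX n)) c /\
    0 + lcost (aden body) (atime body) (aset^~ vX) n (aset s vX n) = c + 1.
  have -> : atime reaches s = cst (AVar vN) + 2 + (c + 1) by rewrite -Ec -V0.
  move: le; rewrite subn0 /= mulnS; set A := next_cost * _; set B := reach_cost * _.
  by rewrite /reach_cost /cst /=; move: (amax reach_head) (amax reach_tail) => a b; clear; lia.
apply: (lcost_ind (I := I)) => [k t c lt [Lt le]|].
  2: by split=> //; rewrite subnn muln0 big1 ?muln0 // => i; rewrite leqNgt ltn_ord.
pose x := Ordinal lt; set t0 := aset t vX k.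
have L0 : loaded adj t0 by [].
set t1 := aden reach_head t0.
set t2 := aden (AFor vY (AGet aIn (AVar vU)) count_next) t1.
have L1 : loaded adj t1 by apply: loaded_frame L0.
split; first exact: (@loaded_frame _ _ body t0 isT isT isT L0).
have V1 : aeval (AGet aIn (AVar vU)) t1 = size (adj x) := proj1 (Lt.2 x).
have := atime_for vY (AGet aIn (AVar vU)) t1 (isT : aflat count_next).
rewrite V1 -/next_cost => T2.
have T1 := atime_le t0 (isT : aflat reach_head).
have T3 := atime_le t2 (isT : aflat reach_tail).
have -> : atime body t0 = atime reach_head t0 +
    (atime (AFor vY (AGet aIn (AVar vU)) count_next) t1 + atime reach_tail t2) by [].
have Ek : n - k = (n - k.+1).+1 by rewrite subnSK.
have -> : \sum_(i < n | k <= i) size (adj i) = size (adj x) + \sum_(i < n | k < i) size (adj i).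
  rewrite (bigD1 x) ?leqnn //=; congr (_ + _); apply: eq_bigl => i.
  by rewrite ltn_neqAle andbC eq_sym -(inj_eq val_inj).
rewrite Ek mulnS mulnDr; move: le T1 T2 T3.
set A := next_cost * _; set A' := next_cost * _; set B := reach_cost * _.
rewrite /reach_cost; move: (amax reach_head) (amax reach_tail) (atime reach_head t0) (atime _ t1) (atime _ t2).
by move=> a b y1 y2 y3; rewrite /cst /=; clear; lia.
Qed.

Definition bfs_total := bfs_cost * 2 + scan_cost.

(** Bracketed like [ur_program], so that [leq_lin] splits the bound phase by phase. *)
Definition ur_cost :=
  (20 + for_cost (AVar vN) offsets_body) +
  (for_cost (AVar vN) seeds_body +
  (bfs_total +
  (for_cost (AVar vN) reset_body +
  (bfs_total +
  (20 + for_cost (AVar vN) ends_body +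
  (reach_cost + next_cost +
  (20 + for_cost (AAdd (AAdd (AVar vN) (AVar vN)) (ACst 1)) sums_body * 2 +
  (for_cost (AVar vN) placement_body +
  (for_cost (AVar vN) dp_body +
  (60 + for_cost (AVar vN) trace_body)))))))))).

Lemma ur_program_ok s : init_ok s ->
  atime ur_program s <= ur_cost * (adj_size adj + 1) /\
  exists ps, solution ps /\ output_ok (arr (aden ur_program s) aOut) ps.
Proof.
move=> [Hin H0]; rewrite /ur_program; do 10 rewrite aseqE; do 10 rewrite aseqT.
set s1 := aden offsets s; set s2 := aden initial_seeds s1; set s3 := aden bfs s2.
set s4 := aden reset s3; set s5 := aden bfs s4; set s6 := aden level_ends s5.
set s7 := aden reaches s6; set s8 := aden prefix_sums s7; set s9 := aden placement s8.
have L1 : loaded adj s1 := offsets_ok Hin.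
have L2 : loaded adj s2 by apply: loaded_frame L1.
have L3 : loaded adj s3 by apply: loaded_frame L2.
have L4 : loaded adj s4 by apply: loaded_frame L3.
have L5 : loaded adj s5 by apply: loaded_frame L4.
have L6 : loaded adj s6 by apply: loaded_frame L5.
have L7 : loaded adj s7 by apply: loaded_frame L6.
have lev2 (x : 'I_n) : arr s2 aLev x = 0 by rewrite !putsN // H0.
have cov1 x : exists2 z, z \in enum 'I_n & connect e z x.
  by exists x; rewrite ?mem_enum ?connect0.
have [P1 [lv1 [used1 [isb1 [bests1 [[S1 all1 sz1 Q1 B1] TB1]]]]]] :=
  bfs_ok es adj_uniq adjE L2 (size_enum_ord n) (initial_seeds_ok L1) cov1 lev2.
have szb : size bests1 = n by rewrite (se_size S1).
have [sd4 lev4] := reset_ok L3 szb B1.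
have [P2 [lv2 [used2 [isb2 [bests2 [[S2 all2 sz2 Q2 B2] TB2]]]]]] :=
  bfs_ok es adj_uniq adjE L4 (etrans (size_rev bests1) szb) sd4 (bests_cover S1 all1) lev4.
pose D : 'I_n -> nat := level s5.
have lay1 := search_layering es S1 all1; have lay2 := search_layering es S2 all2.
have [rk U] := interval_umbrella pig.
have ends r : first_seed e (rev bests1) r ->
    exists2 rk, umbrella e rk & forall z, connect e r z -> rk r <= rk z.
  move=> Hr; apply: (layer_end es eirr lay1 U) => z crz.
  exact: (bests_better es S1 all1 Hr crz).
have uP2 : uniq P2 by have := se_uniq S2; rewrite cats0.
have so2 : sorted leq (map (level s5) P2) by have := se_sorted S2; rewrite cats0.
have upto6 := level_ends_ok L5 uP2 all2 sz2 Q2 so2.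
have lev6 x : level s6 x = D x by rewrite /level putsN.
have cnt6 k : arr s6 aCnt k = 0 by rewrite !putsN // H0.
have [R7 K7 C7] := reaches_ok adj_uniq adjE L6 lev6 upto6 cnt6.
have N7 : avar s7 vN = n := L7.1.
have C8 := prefix_sums_ok N7 C7.
have N8 : avar s8 vN = n by rewrite asgsN.
have K8 (x : 'I_n) : arr s8 aKey x = key e D x by rewrite putsN.
have R8 (x : 'I_n) : arr s8 aReach x = reach e D x by rewrite putsN.
have [V9 P9] := placement_ok N8 K8 R8 C8.
have N9 : avar s9 vN = n by rewrite asgsN.
split; last by apply: (ordered_solution lay2 ends) => // i; rewrite !putsN // H0.
set S := adj_size adj + 1.
have nS : n.+1 <= 1 * S by rewrite mul1n /S /adj_size addn1 ltnS leq_addr.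
have sS : \sum_(i < n) size (adj i) <= S.
  by rewrite /S /adj_size; apply: leq_trans (leq_addl _ _) (leq_addr _ _).
have S_gt0 : 0 < S by rewrite /S addn1.
have flat x c t : aflat c -> avar t vN = n ->
    atime (AFor x (AVar vN) c) t <= for_cost (AVar vN) c * S.
  move=> fc Nt; rewrite -[for_cost _ _]muln1; apply: leq_linW (atime_flat_for _ _ _ fc) _.
  by rewrite /= Nt.
have const k a : a <= k -> a <= k * S.
  by move=> le; apply: leq_trans le _; rewrite -[X in X <= _]muln1 leq_mul2l S_gt0 orbT.
have bfsT t : atime bfs t <= bfs_cost * (2 * n + 1) + scan_cost * \sum_(i < n) size (adj i) ->
    atime bfs t <= bfs_total * S.
  move=> le; apply: leq_trans le _; rewrite /bfs_total mulnDl; apply: leq_add.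
    by rewrite -mulnA leq_mul2l; move: nS; rewrite mul1n; clear; lia.
  by rewrite leq_mul2l sS orbT.
have N i : loaded adj i -> avar i vN = n by case.
apply: leq_lin; [|apply: leq_lin; [|apply: leq_lin; [|apply: leq_lin; [|apply: leq_lin; [|
  apply: leq_lin; [|apply: leq_lin; [|apply: leq_lin; [|apply: leq_lin; [|apply: leq_lin]]]]]]]]].
- rewrite /offsets 3!aseqT 2!addnA; apply: leq_lin; first exact: const.
  by apply: flat => //=; rewrite /upd /= Hin.
- by apply: flat => //; apply: N.
- exact: bfsT TB1.
- by apply: flat => //; apply: N.
- exact: bfsT TB2.
- rewrite /level_ends aseqT; apply: leq_lin; first exact: const.
  by apply: flat => //=; apply: N.
- apply: leq_trans (reaches_time L6) _; rewrite mulnDl leq_add // leq_mul2l ?sS ?orbT //.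
  by move: nS; rewrite mul1n => ->; rewrite orbT.
- rewrite /prefix_sums 2!aseqT addnA; apply: leq_lin; first exact: const.
  apply: leq_linW; first exact: atime_flat_for.
  rewrite [aeval _ _](_ : _ = n + n + 1); last by rewrite -N7.
  by move: nS; clear; lia.
- exact: flat.
- exact: flat.
- have N10 : avar (aden dp s9) vN = n by rewrite asgsN.
  move: N10; move: (aden dp s9) => t Nt.
  rewrite /trace 4!aseqT.
  have := flat vX trace_body (aden (vC ::= #0)%P (aden (vI ::= #0)%P (aden (vM ::= #0)%P t))) isT Nt.
  set F := atime (AFor _ _ _) _; move: (for_cost _ _) => K HF.
  rewrite mulnDl; have := const 60 60 (leqnn _).
  by move: HF; rewrite /= /cst /=; clear; lia.
Qed.

End Correct.

(** * Input, output and the RAM program *)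

(** The arrays start right behind the input, whose length is found by walking over the blocks.
    Memory there is still zero, as the array program assumes of its arrays. *)
Definition input_length : com :=
  Seq (Asg 0 (Cst 1))
    (For 1 (Ld (Cst 0)) (Asg 0 (Add (Add (Var 0) (Ld (Var 0))) (Cst 1)))).

Definition copy_input : com :=
  For 1 (Var 0) (Str (acell aIn (Var 1)) (Ld (Var 1))).

(** Copying must run upwards: entry i sits at B + 14 + 16 i, beyond cell i, so filling a cell never
    destroys an entry still to be read. *)
Definition copy_output : com :=
  Seq (Asg 1 (Cst 0))
    (For 2 (Add (Dbl (Ld (acell aOut (Cst 0)))) (Cst 1))
       (Seq (Str (Var 1) (Ld (acell aOut (Var 1)))) (Asg 1 (Add (Var 1) (Cst 1))))).

Definition ram_com : com :=
  Seq input_length (Seq copy_input (Seq (tr ur_program) copy_output)).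

Definition ram_program : program := ccom 0 ram_com.

Lemma cfor_ind (I : nat -> cfg -> Prop) k x e c s :
  eval e s = k -> I k (cset s x k) ->
  (forall j t, j < k -> I j.+1 t -> I j (den c (cset t x j))) ->
  I 0 (den (For x e c) s).
Proof. by move=> /= -> H0 H; apply: loop_ind H0. Qed.

Lemma ctime_for x e c m s : (forall t, time c t <= m) ->
  time (For x e c) s <= (m + 4) * eval e s + (ecost e + 3).
Proof.
move=> H /=; have := lcost_le (den c) (cset^~ x) (eval e s) (cset s x (eval e s)) H.
by move: (lcost _ _ _ _ _) => l; lia.
Qed.

Lemma cseqT a b s : time (Seq a b) s = time a s + time b (den a s). Proof. by []. Qed.

Lemma cseqE a b s : den (Seq a b) s = den b (den a s). Proof. by []. Qed.

Section Ram.
Variables (n : nat) (adj : 'I_n -> seq 'I_n).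

Notation enc := (encode_adj adj).

Lemma input_length_ok s : (forall a, cmem s a = nth 0 enc a) ->
  let s' := den input_length s in
  cvar s' 0 = size enc /\ cmem s' = cmem s.
Proof.
move=> Hm s'.
set s1 := den (Asg 0 (Cst 1)) s.
have V : eval (Ld (Cst 0)) s1 = n by rewrite /= Hm.
pose I k t := cvar t 0 = offset adj (n - k) /\ cmem t = cmem s.
have [] : I 0 s'; last by rewrite subn0 offset_n.
rewrite /s' /input_length cseqE -/s1.
apply: (cfor_ind V) => [|k t lt [H1 H2]].
  by rewrite /I /= /upd /= subnn /offset take0.
have Ek : n - k = (n - k.+1).+1 by rewrite subnSK.
have lt' : n - k.+1 < n by rewrite -Ek leq_subr.
have E := nth_encode (adj := adj) (u := Ordinal lt') (ltn0Sn _); rewrite addn0 in E.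
by rewrite /I /= /upd /= H1 H2 Hm E Ek (offsetS _ (Ordinal lt')).
Qed.

Lemma copy_input_ok s : (forall a, cmem s a = nth 0 enc a) -> cvar s 0 = size enc ->
  let s' := den copy_input s in
  [/\ cvar s' 0 = size enc,
      forall i, cmem s' (size enc + 0 + 16 * i) = nth 0 enc i &
      forall k i, 0 < k < 16 -> cmem s' (size enc + k + 16 * i) = 0].
Proof.
move=> Hm HB s'; set B := size enc in HB *.
pose I k t := [/\ cvar t 0 = B, forall a, a < B -> cmem t a = nth 0 enc a,
  forall i, cmem t (B + 0 + 16 * i) = if k <= i then nth 0 enc i else 0 &
  forall j i, 0 < j < 16 -> cmem t (B + j + 16 * i) = 0].
have big a : B <= a -> cmem s a = 0 by move=> le; rewrite Hm nth_default.
have [] : I 0 s'; last by [].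
rewrite /s' /copy_input.
apply: (cfor_ind (HB : eval (Var 0) s = B)) => [|k t lt [H1 H2 H3 H4]].
  split=> [//|a _|i|j i _]; [exact: Hm | | ]; rewrite [LHS]big //; try by clear; lia.
  by case: leqP => // le; rewrite nth_default.
have -> : den (Str (acell aIn (Var 1)) (Ld (Var 1))) (cset t 1 k) =
    Cfg (cvar (cset t 1 k)) (upd (cmem t) (B + 0 + 16 * k) (cmem t k)).
  rewrite /= /upd /= H1; congr (Cfg _ _); apply: functional_extensionality => a.
  by congr (if a == _ then _ else _); clear; lia.
split=> [|a lta|i|j i lj] /=.
- by rewrite /upd.
- by rewrite updN ?H2 //; apply/eqP; clear - lta; lia.
- rewrite /upd; case: (eqVneq i k) => [->|ne].
    by rewrite eqxx leqnn H2.
  rewrite (_ : (_ == _) = false); last by apply/eqP; move/eqP: ne; clear; lia.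
  by rewrite H3 [k <= i]leq_eqVlt eq_sym (negbTE ne).
- by rewrite updN ?H4 //; apply/eqP; clear - lj; lia.
Qed.

Lemma copy_output_ok B s c (f : nat -> nat) : cvar s 0 = B ->
  (forall i, cmem s (B + 14 + 16 * i) = f i) -> f 0 = c ->
  forall j, j < c + c + 1 -> cmem (den copy_output s) j = f j.
Proof.
move=> HB Hf f0.
set s1 := den (Asg 1 (Cst 0)) s; set m := c + c + 1.
have V : eval (Add (Dbl (Ld (acell aOut (Cst 0)))) (Cst 1)) s1 = m.
  by rewrite /m -f0 -(Hf 0) /= /upd /= HB muln0 !addn0.
pose I k t := [/\ cvar t 0 = B, cvar t 1 = m - k, forall j, j < m - k -> cmem t j = f j &
  forall i, m - k <= i -> cmem t (B + 14 + 16 * i) = f i].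
have [] : I 0 (den copy_output s); last by move=> _ _ H _ j; rewrite subn0 in H; apply: H.
rewrite /copy_output cseqE -/s1.
apply: (cfor_ind V) => [|k t lt [H1 H2 H3 H4]].
  by rewrite /I subnn; split=> // i _; rewrite /= Hf.
have Ek : m - k = (m - k.+1).+1 by rewrite subnSK.
rewrite /I Ek; move: (m - k.+1) H2 H3 H4 => p H2 H3 H4.
have -> : den (Seq (Str (Var 1) (Ld (acell aOut (Var 1)))) (Asg 1 (Add (Var 1) (Cst 1)))) (cset t 2 k)
   = Cfg (upd (upd (cvar t) 2 k) 1 p.+1) (upd (cmem t) p (f p)).
  rewrite -(H4 p) //= /upd /= H1 H2 /cset /= addn1; congr (Cfg _ _).
  apply: functional_extensionality => a; congr (if _ then cmem t _ else _).
  by clear; lia.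
split=> //= [j|i lti].
  rewrite /upd ltnS leq_eqVlt => /predU1P[->|ltj]; first by rewrite eqxx.
  by rewrite ltn_eqF ?H3.
by rewrite updN ?H4 ?(ltnW lti) //; apply/eqP; clear - lti; lia.
Qed.

Definition io_cost := 300.

Lemma input_length_time s : cmem s 0 = n -> time input_length s <= io_cost * n.+1.
Proof.
move=> Hn; have := @ctime_for 1 (Ld (Cst 0)) (Asg 0 (Add (Add (Var 0) (Ld (Var 0))) (Cst 1)))
  20 (den (Asg 0 (Cst 1)) s) (fun t => isT).
rewrite (_ : eval _ _ = n) //.
have -> : time input_length s = time (Asg 0 (Cst 1)) s +
  time (For 1 (Ld (Cst 0)) (Asg 0 (Add (Add (Var 0) (Ld (Var 0))) (Cst 1)))) (den (Asg 0 (Cst 1)) s) by [].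
by move: (time (For _ _ _) _) => x /=; rewrite /io_cost; lia.
Qed.

Lemma copy_input_time s : time copy_input s <= io_cost * (cvar s 0).+1.
Proof.
have := @ctime_for 1 (Var 0) (Str (acell aIn (Var 1)) (Ld (Var 1))) 40 s (fun t => isT).
by rewrite -/copy_input; move: (time copy_input s) => x /=; rewrite /io_cost; lia.
Qed.

Lemma copy_output_time B s c : cvar s 0 = B -> cmem s (B + 14 + 16 * 0) = c ->
  time copy_output s <= io_cost * c.+1.
Proof.
move=> HB Hc.
have V : eval (Add (Dbl (Ld (acell aOut (Cst 0)))) (Cst 1)) (den (Asg 1 (Cst 0)) s) = c + c + 1.
  by rewrite -Hc /= /upd /= HB muln0 !addn0.
have := @ctime_for 2 (Add (Dbl (Ld (acell aOut (Cst 0)))) (Cst 1))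
  (Seq (Str (Var 1) (Ld (acell aOut (Var 1)))) (Asg 1 (Add (Var 1) (Cst 1)))) 40
  (den (Asg 1 (Cst 0)) s) (fun t => isT).
rewrite V; have -> : time copy_output s = time (Asg 1 (Cst 0)) s +
  time (For 2 (Add (Dbl (Ld (acell aOut (Cst 0)))) (Cst 1))
    (Seq (Str (Var 1) (Ld (acell aOut (Var 1)))) (Asg 1 (Add (Var 1) (Cst 1))))) (den (Asg 1 (Cst 0)) s) by [].
by move: (time (For _ _ _) _) => x /=; rewrite /io_cost; lia.
Qed.

End Ram.

Theorem theorem4 :
  exists (P : program) (c : nat),
  forall (n : nat) (e : rel 'I_n),
    simple_graph e ->
    proper_interval_graph e ->
    forall adj : 'I_n -> seq 'I_n,
      (forall i, uniq (adj i) /\ (forall j, (j \in adj i) = e i j)) ->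
      exists (t : nat) (s : state) (M : {set {set 'I_n}}),
        t <= c * (adj_size adj + 1) /\
        halts_in P (init_state (encode_adj adj)) t s /\
        outputs_matching s M /\
        max_ur_matching e M.
Proof.
(* With B the input length, the transfers cost at most [io_cost] times B, 2B and B, as n + 1 and the
   number of output pairs plus 1 are at most B. *)
exists ram_program, (ur_cost + io_cost * 4) => n e [es eirr] pig adj Hadj.
have adj_uniq i : uniq (adj i) := proj1 (Hadj i).
have adjE i j : (j \in adj i) = e i j := proj2 (Hadj i) j.
set enc := encode_adj adj.
pose s0 := Cfg (fun=> 0) (fun a => nth 0 enc a).
have m0 a : cmem s0 a = nth 0 (encode_adj adj) a by [].
have [B1 E1] := input_length_ok m0; set s1 := den input_length s0 in B1 E1.
have m1 a : cmem s1 a = nth 0 (encode_adj adj) a by rewrite E1.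
have [B2 I2 Z2] := copy_input_ok m1 B1; set s2 := den copy_input s1 in B2 I2 Z2.
rewrite -/enc in B1 B2 I2 Z2; set B := size enc in B1 B2 I2 Z2.
pose a2 := Ast (fun x => cvar s2 x.+1) (fun k i => cmem s2 (B + k + 16 * i)).
have sim2 : asim B a2 s2 by [].
have ini : init_ok adj a2 by split.
have /andP[wfa wft] := ur_program_wf.
have [T2 [ps [[ups max szps] [out0 outi]]]] := ur_program_ok es eirr adj_uniq adjE pig ini.
have [sim3 Etime] := tr_ok wfa sim2.
set a3 := aden ur_program a2 in out0 outi sim3.
set s3 := den (tr ur_program) s2 in sim3.
have [B3 _ M3] := sim3.
have f3 i : cmem s3 (B + 14 + 16 * i) = arr a3 14 i by rewrite M3.
have mem4 := copy_output_ok B3 f3 out0.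
set s4 := den copy_output s3 in mem4.
have wf_ram : wf ram_com by [].
have [r' [R _]] := ccom_ok (s := s0) (r := fun=> 0) wf_ram (code_at_self [::] ram_program)
  (fun x => erefl).
exists (time ram_com s0), (State (0 + csize ram_com) r' (cmem s4)), (edges_of ps).
split; last split; last split=> //.
- rewrite /ram_com 3!cseqT -/s1 -/s2 -/s3 -Etime.
  have T0 : time input_length s0 <= io_cost * n.+1 := input_length_time (n := n) (s := s0) erefl.
  have T1 := copy_input_time s1; rewrite B1 in T1.
  have T3 := copy_output_time B3 (etrans (f3 0) out0).
  have EB : B = adj_size adj + 1 := size_encode adj.
  have nB : n < B by rewrite EB addn1 ltnS leq_addr.
  move: T0 T1 T2 T3 EB nB szps; move: (size ps) (adj_size adj + 1).
  move: (time input_length s0) (time copy_input s1) (atime _ _) (time copy_output s3) => t0 t1 t2 t3.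
  by rewrite /io_cost; move: ur_cost; clear; nia.
- apply: halts_runs R _.
  (* The program halts by running past its end, where [nth] defaults to [IHalt]. *)
  by rewrite /step nth_default // /ram_program size_ccom.
- exists ps; split; last by split.
  move: (cmem s4) mem4 => m mem4.
  have m0E : m 0 = size ps by rewrite mem4 // addn1.
  rewrite /output_pairs [Defs.mem _]/= m0E.
  apply: (@eq_from_nth _ (0, 0)); rewrite size_map size_iota ?size_map // => i lt.
  rewrite (nth_map 0) ?size_iota // nth_iota // add0n mul2n -addnn.
  have [o1 o2] := outi i lt.
  rewrite !mem4; try by clear - lt; lia.
  rewrite (addnC 1) (addnC 2) o1 o2.
  by case: ps lt {max ups szps out0 outi o1 o2 mem4 m0E T2} => // p ps lt; rewrite !(nth_map p).
Qed.
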